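(* Let $T>0$ and let $u_0\ge 0$ be a $1$-periodic function such that $u_0^3\in H^2_{\mathrm{per}}([0,1])$ and $\int_0^1 \frac{1}{u_0}\,\mathrm{d}h=m_0<+\infty$. Let $u$ be a non-negative weak solution on $[0,T]$ to the PDE $u_t=-u^2(u^3)_{hhhh}$ with initial data $u_0$ (in the sense of the definition given in the context). Then $u^3$ has time-space Hölder continuity in the following sense: for any $t_1,t_2\in[0,T]$, $$|u^3(t_1,h)-u^3(t_2,h)|\le C(\|u_0^3\|_{H^2})\,|t_2-t_1|^{\frac14}\quad\text{for any }h\in[0,1],$$ where $C(\|u_0^3\|_{H^2})$ is a constant depending only on $\|u_0^3\|_{H^2([0,1])}$; and $$u^3(t,\cdot)\in C^{\frac12}([0,1])\quad\text{for any }t\in[0,T].$$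
   Context: All functions of $h$ are $1$-periodic in $h$. $H^m_{\mathrm{per}}([0,1])$ denotes the space of functions $u\in H^m_{\mathrm{loc}}(\mathbb{R})$ with $u(h+1)=u(h)$ for a.e. $h\in\mathbb{R}$, with the norm of $H^m([0,1])$; $L^2_{\mathrm{per}}([0,1])$ is the case $m=0$. $C^{1/2}([0,1])$ is the space of Hölder continuous functions with exponent $1/2$. Energies: $F(u):=\frac12\int_0^1u^2\,\mathrm{d}h$ and $E(u):=\int_0^1\frac16[(u^3)_{hh}]^2\,\mathrm{d}h$. For a function $u$ on $[0,T]\times[0,1]$ set $P_T:=(0,T)\times(0,1)\setminus\{(t,h):u(t,h)=0\}$. For $u$ with $u^3$ continuous this is an open set, and $(u^3)_{hhhh}$ is understood as a distribution on $P_T$. Definition (weak solution). For any $T>0$, a non-negative function $u(t,h)$ with regularities $$u^3\in L^\infty([0,T];H^2_{\mathrm{per}}([0,1])),\quad u^2(u^3)_{hhhh}\in L^2(P_T),\quad u_t\in L^2([0,T];L^2_{\mathrm{per}}([0,1])),\quad u^3\in C([0,T];H^1_{\mathrm{per}}([0,1]))$$ is called a weak solution to $u_t=-u^2(u^3)_{hhhh}$ with initial data $u_0$ (i.e. $u(0,\cdot)=u_0$) if (i) for any $\phi\in C^\infty([0,T]\times\mathbb{R})$ that is $1$-periodic in $h$, $$\int_0^T\int_0^1\phi u_t\,\mathrm{d}h\,\mathrm{d}t+\iint_{P_T}\phi u^2(u^3)_{hhhh}\,\mathrm{d}h\,\mathrm{d}t=0;$$ (ii) $E(u(T,\cdot))+\iint_{P_T}(u^2(u^3)_{hhhh})^2\,\mathrm{d}h\,\mathrm{d}t\le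 E(u(0,\cdot))$; (iii) $F(u(T,\cdot))+6\int_0^TE(u(t,\cdot))\,\mathrm{d}t\le F(u(0,\cdot))$.
   Formalization: The distribution (u³)_hhhh is taken on the 1-periodic extension of P_T, including the seam h=0, instead of only on P_T inside (0,T)×(0,1); otherwise sources at h=0 would go unnoticed and a constant independent of T fails. *)

(* Defs.v *)
From mathcomp Require Import all_boot all_order all_algebra.
From mathcomp Require Import all_classical all_reals all_analysis.

Set Implicit Arguments.
Unset Strict Implicit.
Unset Printing Implicit Defensive.

Import Order.TTheory GRing.Theory Num.Theory.
Import numFieldTopology.Exports numFieldNormedType.Exports.

Local Open Scope classical_set_scope.
Local Open Scope ring_scope.

Section TestFunctions.
Context {R : realType} {V : normedModType R}.

Definition iterD (s : seq V) (f : V -> R) : V -> R :=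
  foldr (fun v g => 'D_v g) f s.

Definition smooth (f : V -> R) : Prop :=
  forall (s : seq V) (x : V), differentiable (iterD s f) x.

Definition test_function (O : set V) (phi : V -> R) : Prop :=
  [/\ smooth phi, compact (closure [set x | phi x != 0]) &
      closure [set x | phi x != 0] `<=` O].

End TestFunctions.

Section PeriodicSobolev.
Context {R : realType}.
Notation mu := (@lebesgue_measure R).

Definition weak_deriv (k : nat) (w g : R -> R) : Prop :=
  [/\ locally_integrable setT w, locally_integrable setT g &
      forall phi : R -> R, test_function setT phi ->
        \int[mu]_x (w x * iterD (nseq k (1 : R)) phi x) = (-1) ^+ k * \int[mu]_x (g x * phi x)].

Definition Hloc (m : nat) (w : R -> R) : Prop :=
  forall k, (k <= m)%N -> exists2 g, weak_deriv k w g &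
    forall K, compact K -> (\int[mu]_(x in K) ((g x ^+ 2)%:E) < +oo)%E.

Definition Hper (m : nat) (w : R -> R) : Prop :=
  Hloc m w /\ {ae mu, forall h, w (h + 1) = w h}.

(* A choice of weak derivative, which is unique almost everywhere when it
   exists; the value is the junk function 0 otherwise. *)
Definition wderiv (k : nat) (w : R -> R) : R -> R :=
  xget (cst 0) [set g | weak_deriv k w g].

(* Norm of H^m([0,1]); only meaningful when Hper m w holds. *)
Definition Hnorm (m : nat) (w : R -> R) : R :=
  Num.sqrt (\sum_(k < m.+1) \int[mu]_(h in `[0, 1]) (wderiv k w h ^+ 2)).

Definition holder (a : R) (w : R -> R) : Prop :=
  exists L : R, forall x y, x \in `[0, 1] -> y \in `[0, 1] ->
    `|w x - w y| <= L * `|x - y| `^ a.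

Definition energyF (w : R -> R) : \bar R :=
  ((2^-1)%:E * \int[mu]_(h in `[0%R, 1%R]) ((w h ^+ 2)%:E))%E.

(* E is +oo outside of its domain {w | w^3 in H^2_per}. *)
Definition energyE (w : R -> R) : \bar R :=
  if `[< Hper 2 (fun h => w h ^+ 3) >] then
    (\int[mu]_(h in `[0%R, 1%R])
      ((6^-1 * wderiv 2 (fun h => w h ^+ 3) h ^+ 2)%:E))%E
  else +oo%E.

End PeriodicSobolev.

Section SpaceTime.
Context {R : realType}.
Notation mu := (@lebesgue_measure R).

(* A function u(t, h) is encoded as u : R * R -> R, and only its values at
   t in [0, T] are relevant. *)
Notation mu2 := (mu \x mu)%E.

Definition et : R * R := (1, 0).
Definition eh : R * R := (0, 1).

Definition locally_integrable2 (O : set (R * R)) (f : R * R -> R) : Prop :=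
  [/\ measurable_fun O f, open O &
      forall K, K `<=` O -> compact K ->
        (\int[mu2]_(z in K) (`|f z|%:E) < +oo)%E].

Definition weak_pderiv (O : set (R * R)) (v : R * R) (k : nat)
    (f g : R * R -> R) : Prop :=
  [/\ locally_integrable2 O f, locally_integrable2 O g &
      forall phi : R * R -> R, test_function O phi ->
        \int[mu2]_(z in O) (f z * iterD (nseq k v) phi z) =
        (-1) ^+ k * \int[mu2]_(z in O) (g z * phi z)].

Definition hperiodic (D : set R) (f : R * R -> R) : Prop :=
  forall t h, D t -> f (t, h + 1) = f (t, h).

Definition cube (u : R * R -> R) : R * R -> R := fun z => u z ^+ 3.

Definition slice (f : R * R -> R) (t : R) : R -> R := fun h => f (t, h).

Definition PT (T : R) (u : R * R -> R) : set (R * R) :=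
  [set z | [/\ 0 < z.1 < T, 0 < z.2 < 1 & u z != 0]].

(* PT T u seen on the circle R/Z and lifted to R: its periodic extension in h,
   including the seam h in Z where u <> 0.  Functions of h being 1-periodic,
   (u^3)_hhhh is taken as a distribution there; with test functions supported
   in the open cell 0 < h < 1 only, singularities at h = 0, which is not a
   special point of the circle, would go unnoticed. *)
Definition PTper (T : R) (u : R * R -> R) : set (R * R) :=
  [set z | 0 < z.1 < T /\ u z != 0].

(* ut stands for the weak derivative u_t and g for the function representing
   the distribution (u^3)_hhhh on {u <> 0}.  As u is continuous, u^2 is
   bounded away from 0 on compact subsets of this open set, so that
   u^2 (u^3)_hhhh being in L^2 means that (u^3)_hhhh is such a function g with
   u^2 g in L^2. *)
Record weak_solution_with (T : R) (u0 : R -> R) (u ut g : R * R -> R) :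
    Prop := WeakSolutionWith {
  ws_ge0 : forall t h, t \in `[0, T] -> 0 <= u (t, h);
  ws_periodic : hperiodic `[0, T] u;
  (* u^3 is the continuous representative of its class in C([0,T]; H^1_per) *)
  ws_continuous : {within `[0, T] `*` setT, continuous (cube u)};
  (* Strong measurability of t |-> u^3(t) in H^2 follows from ws_CH1. *)
  ws_LooH2 : exists M : R, {ae mu, forall t, t \in `[0, T] ->
    Hper 2 (slice (cube u) t) /\ Hnorm 2 (slice (cube u) t) <= M};
  ws_hhhh : weak_pderiv (PTper T u) eh 4 (cube u) g;
  ws_hhhh_periodic : hperiodic `]0, T[ g;
  ws_hhhh_L2 : (\int[mu2]_(z in PT T u) (((u z ^+ 2 * g z) ^+ 2)%:E) < +oo)%E;
  ws_t : weak_pderiv (`]0, T[ `*` setT) et 1 u ut;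
  ws_t_periodic : hperiodic `]0, T[ ut;
  ws_t_L2 : (\int[mu2]_(z in `]0%R, T[ `*` `[0%R, 1%R]) ((ut z ^+ 2)%:E)
             < +oo)%E;
  ws_H1 : forall t, t \in `[0, T] -> Hper 1 (slice (cube u) t);
  ws_CH1 : forall t0, t0 \in `[0, T] ->
    Hnorm 1 (fun h => cube u (t, h) - cube u (t0, h))
      @[t --> within `[0, T] (nbhs t0)] --> (0 : R);
  ws_initial : {ae mu, forall h, u (0, h) = u0 h};
  (* Elements of C^oo([0,T] x R) are taken as restrictions of smooth functions
     on R x R; periodicity in h is only needed for t in [0,T]. *)
  ws_weak : forall phi : R * R -> R, smooth phi -> hperiodic `[0, T] phi ->
    \int[mu2]_(z in `]0, T[ `*` `[0, 1]) (phi z * ut z) +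
    \int[mu2]_(z in PT T u) (phi z * (u z ^+ 2 * g z)) = 0;
  ws_dissipE : (energyE (slice u T) +
    \int[mu2]_(z in PT T u) (((u z ^+ 2 * g z) ^+ 2)%:E)
      <= energyE (slice u 0))%E;
  ws_dissipF : (energyF (slice u T) +
    6%:E * \int[mu]_(t in `[0%R, T]) energyE (slice u t)
      <= energyF (slice u 0))%E
}.

Definition weak_solution (T : R) (u0 : R -> R) (u : R * R -> R) : Prop :=
  exists ut g, weak_solution_with T u0 u ut g.

End SpaceTime.

(* Main.v *)
Require Import Defs.
From HB Require Import structures.
From mathcomp Require Import all_boot all_order all_algebra.
From mathcomp Require Import all_classical all_reals all_analysis.
From mathcomp Require Import measurable_realfun ring lra.

Set Implicit Arguments.
Unset Strict Implicit.
Unset Printing Implicit Defensive.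

Import Order.TTheory GRing.Theory Num.Theory.
Import numFieldTopology.Exports numFieldNormedType.Exports.

Local Open Scope classical_set_scope.
Local Open Scope ring_scope.
Local Notation iterD := Defs.iterD.

(** Write w = u^3.  Energy is controlled at the initial time and in time
    average only: dissipation of E, with the equation, bounds the integral of
    u_t^2 over the cell by E(u_0) ([ws_dissipation]), and dissipation of F
    bounds the time integral of E(u(t)).  Hence every time interval of length
    tau contains a time s with the integral of w_hh(s)^2 bounded by C / tau
    ([curv_time]).

    Two such times s and s', found in intervals of length r^4 and with
    |s - s'| of order r^4, can be compared ([interpolation]).  If w(s) - w(s')
    has a large maximum M, the curvature bound keeps it of size M on an
    interval of length r^2; there u(s) - u(s') is at least M / (3 U^2), where U
    bounds u; but the integral of u(s) - u(s') over this interval is that of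
    u_t over a box of area r^6, which Cauchy-Schwarz bounds by C r^3.  So M is
    at most C r.  An arbitrary time t is reached along times of bounded
    curvature at the scales r, r/2, r/4, ..., and the increments form a
    geometric series ([good_chain]); thus w(t1) - w(t2) is bounded by K r as
    soon as |t1 - t2| = r^4 is at most 1 ([time_holder]), with K affine in U^2.

    It remains to bound u independently of T ([sup_bound]).  By the previous
    step and the curvature bound at the scale r = 1 (or at the initial time if
    T < 1), the oscillation of w(t) is at most Q, affine in U^2
    ([osc_bound]).  As long as u >= 1, the equation reads
    (1/u)_t = (u^3)_hhhh, so that the integral of 1/u over a period is
    conserved ([ws_inv_conserved]) and the minimum of u cannot exceed an earlier
    maximum ([ws_min_max]).  Start from the last time at which the minimum is at
    most 1, where the oscillation bound controls the maximum of w by Q plus a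
    constant, or from the initial time: the minimum of w at any later time obeys
    the same bound, and its maximum exceeds it by at most Q.  So
    U^3 <= a + b U^2, which bounds U ([cubic_le]).  Times at distance more than
    1 are then covered by the bound on u.

    Hoelder continuity in h at a fixed time is the one-dimensional embedding of
    H^1 in C^(1/2) ([Hloc1_holder]).

    The weak formulations are exploited through explicit smooth test functions
    built from exp(-1/x): plateaus for the fundamental theorem of calculus
    ([weak_ftc]), hats for second differences ([second_difference]), and
    approximations of indicators, combined with a pi-lambda argument, for the
    equation almost everywhere ([ws_equation_ae]). *)

(** * Smooth functions *)

Section Smooth.
Context {R : realType} {V : normedModType R}.
Implicit Types (f g : V -> R) (n : nat).

(** Recursive form of differentiability up to order n: closure under products
    and compositions is then a direct induction on n. *)
Fixpoint Cn n f : Prop :=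
  (forall x, differentiable f x) /\
  if n is m.+1 then forall v, Cn m ('D_v f) else True.

Lemma CnS n f : Cn n.+1 f -> Cn n f.
Proof.
elim: n f => [|n IH] f [df Df]; split => // v.
by apply: IH; exact: Df.
Qed.

Lemma iterD_rcons (s : seq V) v f : iterD (rcons s v) f = iterD s ('D_v f).
Proof. by rewrite /iterD -cats1 foldr_cat. Qed.

Lemma smoothP f : smooth f <-> forall n, Cn n f.
Proof.
split=> [sf n|sf s].
  elim: n f sf => [|n IH] f sf; first by split=> // x; exact: (sf [::]).
  split=> [x|v]; first exact: (sf [::]).
  by apply: IH => s x; rewrite -iterD_rcons.
elim/last_ind: s f sf => [|s v IH] f sf x; first by case: (sf 0%N) => /(_ x).
by rewrite iterD_rcons; apply: IH => n; have [_ +] := sf n.+1; exact.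
Qed.

Lemma smooth_diff f x : smooth f -> differentiable f x.
Proof. by move=> sf; exact: (sf [::]). Qed.

Lemma smooth_derive f v : smooth f -> smooth ('D_v f).
Proof. by move=> sf s x; rewrite -iterD_rcons. Qed.

Lemma Cn_eq n f g : f =1 g -> Cn n f -> Cn n g.
Proof. by move=> /funext ->. Qed.

Lemma Cn_cst n (c : R) : Cn n (cst c : V -> R).
Proof.
elim: n c => [|n IH] c; first by split.
split=> // v; apply: (Cn_eq _ (IH 0)) => x.
by rewrite derive_cst.
Qed.

Lemma CnD n f g : Cn n f -> Cn n g -> Cn n (f \+ g).
Proof.
elim: n f g => [|n IH] f g; first by move=> [df _] [dg _]; split=> // x; exact: differentiableD.
move=> [df Df] [dg Dg]; split=> [x|v]; first exact: differentiableD.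
apply: (Cn_eq _ (IH _ _ (Df v) (Dg v))) => x /=.
by rewrite deriveD//; exact: diff_derivable.
Qed.

Lemma CnM n f g : Cn n f -> Cn n g -> Cn n (f \* g).
Proof.
elim: n f g => [|n IH] f g; first by move=> [df _] [dg _]; split=> // x; exact: differentiableM.
move=> cf cg; have [df Df] := cf; have [dg Dg] := cg.
split=> [x|v]; first exact: differentiableM.
apply: (Cn_eq _ (CnD (IH _ _ (CnS cf) (Dg v)) (IH _ _ (CnS cg) (Df v)))) => x /=.
by rewrite deriveM//; exact: diff_derivable.
Qed.

Lemma CnV n f : (forall x, f x != 0) -> Cn n f -> Cn n (fun x => (f x)^-1).
Proof.
move=> f0; elim: n => [|n IH].
  by move=> [df _]; split=> // x; exact: differentiableV.
move=> cf; have [df Df] := cf.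
have cV := IH (CnS cf).
split=> [x|v]; first exact: differentiableV.
apply: (Cn_eq _ (CnM (CnM (Cn_cst n (-1)) (CnM cV cV)) (Df v))) => x /=.
rewrite deriveV//; last exact: diff_derivable.
by rewrite mulN1r -invfM -expr2.
Qed.

Lemma smooth_cst (c : R) : smooth (cst c : V -> R).
Proof. by apply/smoothP => n; exact: Cn_cst. Qed.

Lemma smoothD f g : smooth f -> smooth g -> smooth (f \+ g).
Proof. by move=> /smoothP sf /smoothP sg; apply/smoothP => n; exact: CnD. Qed.

Lemma smoothM f g : smooth f -> smooth g -> smooth (f \* g).
Proof. by move=> /smoothP sf /smoothP sg; apply/smoothP => n; exact: CnM. Qed.

Lemma smoothZ c f : smooth f -> smooth (fun x => c * f x).
Proof. by move=> sf; exact: (smoothM (smooth_cst c) sf). Qed.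

Lemma smoothB f g : smooth f -> smooth g -> smooth (f \- g).
Proof.
move=> sf sg; have := smoothD sf (smoothZ (-1) sg); congr smooth.
by apply/funext => x /=; rewrite mulN1r.
Qed.

Lemma smoothV f : (forall x, f x != 0) -> smooth f -> smooth (fun x => (f x)^-1).
Proof. by move=> f0 /smoothP sf; apply/smoothP => n; exact: CnV. Qed.

Lemma smooth_linear (f : {linear V -> R}) : continuous f -> smooth f.
Proof.
move=> cf; apply/smoothP => -[|n]; first by split=> // x; exact: linear_differentiable.
split=> [x|v]; first exact: linear_differentiable.
apply: (Cn_eq _ (Cn_cst n (f v))) => x.
by rewrite deriveE ?diff_lin//; exact: linear_differentiable.
Qed.

End Smooth.

Section SmoothComp.
Context {R : realType} {V : normedModType R}.

Lemma derive_comp (F : R -> R) (f : V -> R) x v :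
  differentiable F (f x) -> differentiable f x ->
  'D_v (F \o f) x = 'D_1 F (f x) * 'D_v f x.
Proof.
move=> dF df.
rewrite (deriveE v (differentiable_comp df dF)) diff_comp//= (deriveE v df).
have -> : 'D_1 F (f x) = 'd F (f x) 1 by rewrite deriveE.
have -> : 'd f x v = 'd f x v *: (1 : R) by rewrite /GRing.scale /= mulr1.
by rewrite linearZ /= /GRing.scale /= mulrC mulr1.
Qed.

Lemma Cn_comp n (F : R -> R) (f : V -> R) : Cn n F -> Cn n f -> Cn n (F \o f).
Proof.
elim: n F => [|n IH] F.
  by move=> [dF _] [df _]; split=> // x; exact: differentiable_comp.
move=> [dF DF] cf; have [df Df] := cf.
split=> [x|v]; first exact: differentiable_comp.
apply: (Cn_eq _ (CnM (IH _ (DF 1) (CnS cf)) (Df v))) => x /=.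
by rewrite derive_comp.
Qed.

Lemma smooth_comp (F : R -> R) (f : V -> R) :
  smooth F -> smooth f -> smooth (F \o f).
Proof. by move=> /smoothP sF /smoothP sf; apply/smoothP => n; exact: Cn_comp. Qed.

End SmoothComp.

Section Smooth1.
Context {R : realType}.
Implicit Types f : R -> R.

Lemma smooth_id : smooth (id : R -> R).
Proof.
apply/smoothP => -[|n]; first by split.
split=> // v; apply: (Cn_eq _ (Cn_cst n v)) => x.
by rewrite derive_id.
Qed.

Lemma smooth_affine (a b : R) : smooth (fun x : R => a * x + b).
Proof. exact: (smoothD (smoothZ a smooth_id) (smooth_cst b)). Qed.

Lemma derive_dir f (x v : R) : differentiable f x -> 'D_v f x = v * 'D_1 f x.
Proof.
move=> df; rewrite (deriveE v df).
have -> : 'D_1 f x = 'd f x 1 by rewrite deriveE.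
have -> : v = v *: (1 : R) by rewrite /GRing.scale /= mulr1.
by rewrite linearZ /= /GRing.scale /= mulr1.
Qed.

Lemma smooth_bisin : smooth (sin : R -> R) /\ smooth (cos : R -> R).
Proof.
suff H n : Cn n (sin : R -> R) /\ Cn n (cos : R -> R).
  by split; apply/smoothP => n; case: (H n).
have ds (x : R) : differentiable (sin : R -> R) x.
  by apply/derivable1_diffP; exact: derivable_sin.
have dc (x : R) : differentiable (cos : R -> R) x.
  by apply/derivable1_diffP; exact: derivable_cos.
elim: n => [|n [IHs IHc]]; first by [].
split; split=> // v.
  apply: (Cn_eq _ (CnM (Cn_cst n v) IHc)) => x /=.
  by rewrite derive_dir// derive_val.
apply: (Cn_eq _ (CnM (Cn_cst n (- v)) IHs)) => x /=.
by rewrite derive_dir// derive_val mulrN mulNr.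
Qed.

Lemma smooth_sin : smooth (sin : R -> R). Proof. by case: smooth_bisin. Qed.

End Smooth1.

(** * Steps, ramps and test functions *)

Section Plateau.
Context {R : realType}.

(** The factors x^-k are those that differentiation of exp(-1/x) produces, so
    that the family is closed under differentiation. *)
Definition flat (k : nat) (x : R) : R :=
  if 0 < x then x^-1 ^+ k * expR (- x^-1) else 0.

Lemma flat_pos k x : 0 < x -> flat k x = x^-1 ^+ k * expR (- x^-1).
Proof. by rewrite /flat => ->. Qed.

Lemma flat_neg k x : x <= 0 -> flat k x = 0.
Proof. by rewrite /flat ltNge => ->. Qed.

Lemma flat_ge0 k x : 0 <= flat k x.
Proof.
rewrite /flat; case: ifPn => // x0.
by rewrite mulr_ge0 ?expR_ge0// exprn_ge0// invr_ge0 ltW.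
Qed.

(** Quadratic decay at 0, which makes the difference quotient at 0 vanish. *)
Lemma flat_sq k x : flat k x <= k.+2`!%:R * x ^+ 2.
Proof.
have [x0|x0] := lerP x 0.
  by rewrite flat_neg// mulr_ge0// sqr_ge0.
rewrite flat_pos// expRN.
have y0 : 0 < x^-1 by rewrite invr_gt0.
have := @expR_ge1Dxn R x^-1 k.+1 (ltW y0).
set y := x^-1 in y0 *; set F := k.+2`!%:R.
have F0 : 0 < F by rewrite ltr0n fact_gt0.
move=> H; have {}H : y ^+ k.+2 <= F * expR y.
  rewrite mulrC -ler_pdivrMr//; apply: le_trans H.
  by rewrite lerDr.
have e0 : 0 < expR y by exact: expR_gt0.
have -> : x = y^-1 by rewrite /y invrK.
rewrite ler_pdivrMr// [y^-1 ^+ 2]exprVn -mulrA [_ * expR y]mulrC mulrA.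
by rewrite ler_pdivlMr ?exprn_gt0// -exprD addn2.
Qed.

Lemma is_derive_flat k (x : R) :
  is_derive x (1 : R) (flat k) (- k%:R * flat k.+1 x + flat k.+2 x).
Proof.
have [x0|x0|->] := ltgtP x 0.
- have E : {near x, cst 0 =1 flat k}.
    near=> z; rewrite flat_neg// ltW//; near: z; exact: lt_nbhsl.
  apply: (near_eq_is_derive E).
  rewrite !flat_neg ?(ltW x0)// mulr0 addr0; exact: is_derive_cst.
- pose f := fun z : R => z^-1 ^+ k * expR (- z^-1).
  have E : {near x, f =1 flat k}.
    by near=> z; rewrite flat_pos//; near: z; exact: lt_nbhsr.
  apply: (near_eq_is_derive E).
  rewrite !flat_pos//.
  have x1 : x != 0 by rewrite gt_eqF.
  have dV : is_derive x 1 (fun z : R => z^-1) (- x ^- 2).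
    have := @is_deriveV R id x 1 1 x1 (is_derive_id _ _).
    by rewrite /GRing.scale /= mulr1.
  have dX := @is_deriveX R R (fun z : R => z^-1) k x 1 _ dV.
  have dE : is_derive x 1 (fun z : R => expR (- z^-1)) (x ^- 2 * expR (- x^-1)).
    have := @is_derive1_comp R expR (fun z : R => - z^-1) x _ _ (is_derive_expR _) (is_deriveN dV).
    by rewrite opprK mulrC.
  have H := is_deriveM dX dE.
  have -> : f = (fun z : R => z^-1) ^+ k * (fun z : R => expR (- z^-1)).
    by apply/funext => z; rewrite /f /GRing.mul /= exprfctE.
  apply: (is_derive_eq H); rewrite exprfctE /GRing.scale /= -exprVn.
  case: k {H dX E f} => [|k] /=.
    by rewrite !mul0r oppr0 mulr0 mul0r addr0 add0r expr0 mul1r.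
  by rewrite !exprS; ring.
- rewrite !flat_neg// mulr0 addr0.
  have H : h^-1 *: (flat k (h *: 1 + 0) - flat k 0) @[h --> 0^'] --> (0 : R).
    apply/cvgrPdist_le => eps e0; near=> h.
    rewrite (flat_neg _ (lexx 0)) subr0 addr0 /GRing.scale /= mulr1 sub0r normrN.
    have h0 : h != 0 by near: h; exact: nbhs_dnbhs_neq.
    rewrite normrM normfV ler_pdivrMl ?normr_gt0// (ger0_norm (flat_ge0 _ _)).
    apply: (le_trans (flat_sq _ _)).
    rewrite -real_normK ?num_real// expr2 mulrCA; apply: ler_wpM2l => //.
    rewrite mulrC -ler_pdivlMr ?ltr0n ?fact_gt0//.
    near: h; apply: dnbhs0_le; rewrite divr_gt0// ltr0n fact_gt0//.
  apply: DeriveDef; first by apply/cvg_ex; exists 0.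
  by apply/cvg_lim.
Unshelve. all: end_near. Qed.

End Plateau.

Section Step.
Context {R : realType}.
Implicit Types x y : R.

Lemma smooth_flat k : smooth (flat k : R -> R).
Proof.
apply/smoothP => n; elim: n k => [|n IH] k; (split; last try by []).
- move=> x; apply/derivable1_diffP; by case: (is_derive_flat k x).
- move=> x; apply/derivable1_diffP; by case: (is_derive_flat k x).
move=> v; apply: (Cn_eq _ (CnM (Cn_cst n v)
  (CnD (CnM (Cn_cst n (- k%:R)) (IH k.+1)) (IH k.+2)))) => x /=.
rewrite derive_dir; first by case: (is_derive_flat k x) => _ ->.
by apply/derivable1_diffP; case: (is_derive_flat k x).
Qed.

Lemma flat0_gt0 x : 0 < x -> 0 < flat 0 x.
Proof. by move=> x0; rewrite flat_pos// expr0 mul1r expR_gt0. Qed.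

Lemma flat0_le1 x : flat 0 x <= 1.
Proof.
have [x0|x0] := lerP x 0; first by rewrite flat_neg.
by rewrite flat_pos// expr0 mul1r -expR0 ler_expR oppr_le0 invr_ge0 ltW.
Qed.

(** Smooth approximation of the indicator of a ray, from which all other
    indicators are approximated. *)
Lemma cvg_flat0 x : flat 0 (n%:R * x) @[n --> \oo] --> ((0 < x)%R%:R : R).
Proof.
have [x0|x0] := lerP x 0.
  rewrite (_ : (fun _ => _) = cst 0); first exact: cvg_cst.
  by apply/funext => n; apply: flat_neg; rewrite mulr_ge0_le0.
rewrite mulr1n; apply/cvgrPdist_le => e e0; near=> n.
have nx : 0 < n%:R * x.
  by rewrite mulr_gt0// ltr0n; near: n; exact: nbhs_infty_gt.
rewrite flat_pos// expr0 mul1r ger0_norm; last first.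
  rewrite subr_ge0 -[leRHS]expR0 ler_expR oppr_le0 invr_ge0; exact: ltW.
rewrite lerBlDr -lerBlDl; apply: le_trans (expR_ge1Dx _).
rewrite lerD2l lerN2 -[leRHS]invrK lef_pV2 ?posrE ?invr_gt0//.
rewrite -ler_pdivrMr//; near: n; exact: nbhs_infty_ger.
Unshelve. all: end_near. Qed.

Definition step x : R := flat 0 x / (flat 0 x + flat 0 (1 - x)).

Let den x : 0 < flat 0 x + flat 0 (1 - x).
Proof.
have [x0|x0] := ltrP 0 x; first by rewrite ltr_pwDl ?flat0_gt0 ?flat_ge0.
by rewrite ltr_pwDr ?flat_ge0// flat0_gt0// subr_gt0 (le_lt_trans x0).
Qed.

Lemma smooth_step : smooth step.
Proof.
apply: smoothM; first exact: smooth_flat.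
apply: smoothV => [x|]; first by rewrite gt_eqF// den.
apply: smoothD; first exact: smooth_flat.
rewrite (_ : (fun x => _) = flat 0 \o (fun x => -1 * x + 1)); last first.
  by apply/funext => x /=; rewrite mulN1r addrC.
by apply: smooth_comp; [exact: smooth_flat|exact: smooth_affine].
Qed.

Lemma step_le0 x : x <= 0 -> step x = 0.
Proof. by move=> x0; rewrite /step flat_neg// mul0r. Qed.

Lemma step_ge1 x : 1 <= x -> step x = 1.
Proof.
move=> x1; rewrite /step (@flat_neg _ _ (1 - x)) ?subr_le0// addr0 divff//.
by rewrite gt_eqF// flat0_gt0// (lt_le_trans ltr01).
Qed.

Lemma step_ge0 x : 0 <= step x.
Proof. by rewrite /step divr_ge0 ?flat_ge0// ltW// den. Qed.

Lemma step_le1 x : step x <= 1.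
Proof. by rewrite /step ler_pdivrMr ?den// mul1r lerDl flat_ge0. Qed.

(** A smoothed positive part: combinations of ramps give the hat functions used
    as test functions for second derivatives. *)
Definition ramp x : R := x * step x.

Lemma smooth_ramp : smooth ramp.
Proof. by apply: smoothM; [exact: smooth_id|exact: smooth_step]. Qed.

Lemma ramp_le0 x : x <= 0 -> ramp x = 0.
Proof. by move=> x0; rewrite /ramp step_le0// mulr0. Qed.

Lemma ramp_ge1 x : 1 <= x -> ramp x = x.
Proof. by move=> x0; rewrite /ramp step_ge1// mulr1. Qed.

Lemma ramp_ge0 x : 0 <= ramp x.
Proof.
have [x0|x0] := lerP x 0; first by rewrite ramp_le0.
by rewrite mulr_ge0 ?step_ge0// ltW.
Qed.

Lemma ramp_le x : 0 <= x -> ramp x <= x.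
Proof. by move=> x0; rewrite /ramp ler_piMr// step_le1. Qed.

Lemma derive_locally_affine (f : R -> R) (a b c d x : R) :
  (forall y, a < y < b -> f y = c * y + d) -> a < x < b -> 'D_1 f x = c.
Proof.
move=> H /andP[ax xb].
have E : {near x, (fun y => c * y + d) =1 f}.
  near=> z; rewrite H//; apply/andP; split; near: z.
    exact: lt_nbhsr.
  exact: lt_nbhsl.
have : is_derive x (1 : R) (fun y => c * y + d) c.
  have := is_deriveD (is_deriveM (is_derive_cst c x (1:R)) (is_derive_id x (1:R))) (is_derive_cst d x (1:R)).
  by rewrite /GRing.scale /= mulr1 mulr0 !addr0.
by move=> /(near_eq_is_derive E)[].
Unshelve. all: end_near. Qed.

Lemma derive_eventually_affine (f : R -> R) (c d x : R) :
  (forall y, 1 <= y -> f y = c * y + d) -> 1 < x -> 'D_1 f x = c.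
Proof.
move=> H x1; apply: (@derive_locally_affine _ 1 (x + 1) c d).
  by move=> y /andP[/ltW/H].
by rewrite x1 ltrDl ltr01.
Qed.

Lemma derive_lt0 (f : R -> R) (x : R) :
  (forall y, y <= 0 -> f y = 0) -> x < 0 -> 'D_1 f x = 0.
Proof.
move=> H x1; apply: (@derive_locally_affine _ (x - 1) 0 0 0).
  by move=> y /andP[_ /ltW/H ->]; rewrite mul0r addr0.
by rewrite x1 andbT ltrBlDr ltrDl.
Qed.

Lemma derive_affine_comp (f : R -> R) (c d x : R) : smooth f ->
  'D_1 (fun y => f (c * y + d)) x = c * 'D_1 f (c * x + d).
Proof.
move=> sf; rewrite (_ : (fun y => _) = f \o (fun y => c * y + d))//.
rewrite derive_comp; last 2 first.
- exact: smooth_diff.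
- exact/smooth_diff/smooth_affine.
rewrite mulrC; congr (_ * _).
by apply: (@derive_locally_affine _ (x - 1) (x + 1) c d) => //; rewrite ltrBlDr ltrDl ltr01.
Qed.

Lemma smooth_continuous (V : normedModType R) (f : V -> R) : smooth f -> continuous f.
Proof. by move=> sf x; exact/differentiable_continuous/smooth_diff. Qed.

Lemma smooth_iterD k (f : R -> R) : smooth f -> smooth (iterD (nseq k (1 : R)) f).
Proof. by move=> sf; elim: k => [//|k IH]; exact: smooth_derive. Qed.

Lemma smooth_shift (f : R -> R) (c : R) : smooth f -> smooth (fun x => f (1 * x + c)).
Proof. by move=> sf; apply: (smooth_comp sf); exact: smooth_affine. Qed.

Lemma iterD_shift k (f : R -> R) (c : R) : smooth f ->
  iterD (nseq k (1 : R)) (fun x => f (1 * x + c)) =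
  (fun x => iterD (nseq k (1 : R)) f (1 * x + c)).
Proof.
move=> sf; elim: k => [//|k IH].
transitivity ('D_1 (iterD (nseq k (1 : R)) (fun x => f (1 * x + c)))); first by [].
rewrite IH; apply/funext => x.
by apply: (etrans (derive_affine_comp 1 c x (smooth_iterD k sf))); exact: mul1r.
Qed.

Lemma smooth_tensor (a b : R -> R) : smooth a -> smooth b ->
  smooth (fun z : R * R => a z.1 * b z.2).
Proof.
move=> sa sb.
have cfst : continuous (fst : R * R -> R) by move=> z; exact: cvg_fst.
have csnd : continuous (snd : R * R -> R) by move=> z; exact: cvg_snd.
pose f1 : {linear (R * R)%type -> R} := fst.
pose f2 : {linear (R * R)%type -> R} := snd.
have sfst : smooth (fst : R * R -> R) := @smooth_linear R _ f1 cfst.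
have ssnd : smooth (snd : R * R -> R) := @smooth_linear R _ f2 csnd.
exact: (smoothM (smooth_comp sa sfst) (smooth_comp sb ssnd)).
Qed.

Lemma derive_et_tensor (a b : R -> R) (z : R * R) : smooth a -> smooth b ->
  'D_et (fun z : R * R => a z.1 * b z.2) z = 'D_1 a z.1 * b z.2.
Proof.
move=> sa sb; rewrite /derive.
rewrite (_ : (fun h : R => _) =
    fun h => h^-1 *: (a (h *: 1 + z.1) - a z.1) * b z.2); last first.
  by apply/funext => h /=; rewrite scaler0 add0r -mulrBl scalerAl.
apply: cvg_lim => //; apply: cvgMr_tmp.
have : derivable a z.1 1 by apply: diff_derivable; exact: smooth_diff.
exact.
Qed.

Lemma derive_eh_tensor (a b : R -> R) (z : R * R) : smooth a -> smooth b ->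
  'D_eh (fun z : R * R => a z.1 * b z.2) z = a z.1 * 'D_1 b z.2.
Proof.
move=> sa sb; rewrite /derive.
rewrite (_ : (fun h : R => _) =
    fun h => a z.1 * (h^-1 *: (b (h *: 1 + z.2) - b z.2))); last first.
  by apply/funext => h /=; rewrite scaler0 add0r -mulrBr scalerAr.
apply: cvg_lim => //; apply: cvgMl_tmp.
have : derivable b z.2 1 by apply: diff_derivable; exact: smooth_diff.
exact.
Qed.

Lemma iterD_eh_tensor k (a b : R -> R) : smooth a -> smooth b ->
  iterD (nseq k eh) (fun z : R * R => a z.1 * b z.2) =
  (fun z => a z.1 * iterD (nseq k (1:R)) b z.2).
Proof.
move=> sa; elim: k b => [//|k IH] b sb.
have E : iterD (nseq k.+1 eh) (fun z : R * R => a z.1 * b z.2) =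
    iterD (nseq k eh) (fun z : R * R => a z.1 * 'D_1 b z.2).
  have -> : nseq k.+1 (eh : R * R) = rcons (nseq k eh) eh.
    by rewrite -cats1 -(nseqD k 1) addn1.
  rewrite iterD_rcons; congr iterD.
  by apply/funext => z; rewrite derive_eh_tensor.
rewrite E; have /= -> := IH _ (smooth_derive (1:R) sb).
apply/funext => z; congr (_ * _).
rewrite -iterD_rcons -cats1 -(nseqD k 1) addn1//.
Qed.

Lemma test_function_supp (V : normedModType R) (O K : set V) (phi : V -> R) :
  smooth phi -> compact K -> K `<=` O ->
  (forall p, ~ K p -> phi p = 0) -> test_function O phi.
Proof.
move=> sphi cK KO H.
have KK : closed K by apply: compact_closed => //; exact: norm_hausdorff.
have sub : closure [set p | phi p != 0] `<=` K.
  rewrite [X in _ `<=` X](closure_id K).1//; apply: closure_subset => p /= /eqP px.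
  by apply: contrapT => /H.
split=> //; last exact: subset_trans sub KO.
by apply: (subclosed_compact _ cK sub); exact: closed_closure.
Qed.

Lemma test_function1 (O : set R) (a b : R) (phi : R -> R) : smooth phi ->
  `[a, b] `<=` O -> (forall x, x \notin `[a, b] -> phi x = 0) ->
  test_function O phi.
Proof.
move=> sphi abO H; apply: (@test_function_supp _ _ `[a, b]%classic) => //.
  exact: segment_compact.
by move=> x xab; apply: H; apply/negP.
Qed.

Lemma test_function2 (O : set (R * R)) (a b c d : R) (f g : R -> R) :
  smooth f -> smooth g -> `[a, b] `*` `[c, d] `<=` O ->
  (forall x, x \notin `[a, b] -> f x = 0) ->
  (forall x, x \notin `[c, d] -> g x = 0) ->
  test_function O (fun z => f z.1 * g z.2).
Proof.
move=> sf sg sub fab gcd.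
apply: (@test_function_supp _ _ (`[a, b] `*` `[c, d])%classic) => //.
- exact: smooth_tensor.
- by apply: compact_setX; exact: segment_compact.
move=> z /=; have [z1|/fab -> _] := boolP (z.1 \in `[a, b]); last by rewrite mul0r.
have [z2|/gcd ->] := boolP (z.2 \in `[c, d]); last by rewrite mulr0.
by case.
Qed.
End Step.

(** * Integration tools *)

Section MeasureTools.
Context d (T : measurableType d) (R : realType).
Variable mu : {measure set T -> \bar R}.
Implicit Types (f g : T -> R) (D A B X : set T).

(** Dynkin's pi-lambda theorem for the measurable sets over which f has integral
    0.  The map p is a projection when the factors of a rectangle are extended
    one at a time, and the identity otherwise. *)
Lemma Rintegral_setI_pi d' (T' : measurableType d') (p : T -> T')
    (G : set (set T')) X f :
  setI_closed G -> @measurable _ T' = <<s G >> ->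
  measurable_fun setT p -> measurable X -> mu.-integrable X (EFin \o f) ->
  \int[mu]_(x in X) f x = 0 ->
  (forall A : set T', G A -> \int[mu]_(x in X `&` p @^-1` A) f x = 0) ->
  forall A : set T', measurable A -> \int[mu]_(x in X `&` p @^-1` A) f x = 0.
Proof.
move=> GI mG mp mX iX X0 G0.
have mpA (A : set T') : measurable A -> measurable (X `&` p @^-1` A).
  by move=> mA; apply: measurableI => //; rewrite -[X in measurable X]setTI; exact: mp.
have iXA (A : set T') : measurable A -> mu.-integrable (X `&` p @^-1` A) (EFin \o f).
  by move=> mA; apply: integrableS iX => //; exact: mpA.
pose H := [set A : set T' | measurable A /\ \int[mu]_(x in X `&` p @^-1` A) f x = 0].
suff HH : lambda_system setT H.
  move=> A mA; suff : H A by case.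
  apply: (@lambda_system_subset _ G GI setT H HH) => //.
    by move=> B GB; split; [rewrite mG; exact: sub_sigma_algebra|exact: G0].
  by rewrite -mG.
apply/dynkin_lambda_system; split.
- by split => //; rewrite preimage_setT setIT.
- move=> A [mA A0]; split; first exact: measurableC.
  have := @Rintegral_setU _ _ _ mu (X `&` p @^-1` A) (X `&` p @^-1` (~` A)) f
    (mpA _ mA) (mpA _ (measurableC mA)).
  rewrite -setIUr -preimage_setU setUCr preimage_setT setIT X0 A0 add0r => <- //.
  apply/disj_setPS => x [[_ Ax] [_ nAx]]; exact: nAx.
- move=> F tF HF; have mF n : measurable (F n) by case: (HF n).
  split; first exact: bigcupT_measurable.
  rewrite preimage_bigcup setI_bigcupr /Rintegral integral_bigcup//=.
  + rewrite eseries0// => n _ _.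
    rewrite -[LHS]fineK; last by apply: integrable_fin_num => //; [exact: mpA|exact: iXA].
    by have [_ +] := HF n; rewrite /Rintegral => ->.
  + apply/trivIsetP => i j _ _ ij.
    move/trivIsetP : tF => /(_ i j Logic.I Logic.I ij) Fij.
    rewrite -subset0 => x [[_ Fx] [_ Fx']].
    by have : (F i `&` F j) (p x) by []; rewrite Fij.
  + by move=> n; exact: mpA.
  + rewrite -setI_bigcupr -preimage_bigcup; apply: iXA; exact: bigcupT_measurable.
Qed.

Lemma Rintegral_setI_ae0 X f :
  measurable X -> mu.-integrable X (EFin \o f) ->
  (forall A, measurable A -> \int[mu]_(x in X `&` A) f x = 0) ->
  {ae mu, forall x, X x -> f x = 0}.
Proof.
move=> mX iX H.
have := @integral_ae_eq _ _ _ mu X mX (cst 0%E) (EFin \o f) iX.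
move=> /(_ (measurable_cst _)) K; have {}K : ae_eq mu X (EFin \o f) (cst 0%E).
  apply: K => E EX mE; rewrite integral0.
  have := H E mE; rewrite setIidr// /Rintegral => E0.
  rewrite -[LHS]fineK; first by rewrite E0.
  by apply: integrable_fin_num => //; apply: integrableS iX.
by apply: filterS K => x K Xx; have := K Xx => /= -[].
Qed.

Lemma Rintegral_dct D (f_ : nat -> T -> R) f g : measurable D ->
  (forall n, measurable_fun D (f_ n)) -> measurable_fun D f ->
  (forall x, D x -> f_ n x @[n --> \oo] --> f x) ->
  mu.-integrable D (EFin \o g) ->
  (forall x n, D x -> `|f_ n x| <= g x) ->
  mu.-integrable D (EFin \o f) /\
  \int[mu]_(x in D) f_ n x @[n --> \oo] --> \int[mu]_(x in D) f x.
Proof.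
move=> mD mf_ mf ff ig fg.
have [| | |//||if_ _ H] := @dominated_convergence _ _ _ mu D mD
    (fun n => EFin \o f_ n) (EFin \o f) (EFin \o g).
- by move=> n; exact/measurable_EFinP.
- exact/measurable_EFinP.
- by apply: aeW => x Dx; apply: cvg_EFin; [exact: nearW|exact: ff].
- by apply: aeW => x n Dx; rewrite lee_fin fg.
split => //; apply: (@fine_cvg _ _ _ _ (fun n => \int[mu]_(x in D) (EFin \o f_ n) x)%E).
rewrite fineK//; exact: integrable_fin_num.
Qed.

Lemma Rintegral_mul_indic D A f : \int[mu]_(x in D `&` A) f x =
  \int[mu]_(x in D) (f x * \1_A x).
Proof.
rewrite Rintegral_mkcondr; apply: eq_Rintegral => x _.
rewrite /restrict indicE; by case: ifPn => _; rewrite ?mulr1 ?mulr0.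
Qed.

Lemma integrableM_bounded D f g (M : R) : measurable D ->
  mu.-integrable D (EFin \o f) -> measurable_fun D g ->
  (forall x, D x -> `|g x| <= M) -> mu.-integrable D (EFin \o (fun x => f x * g x)).
Proof.
move=> mD intf mg gM.
have mf : measurable_fun D f by exact/measurable_EFinP/(measurable_int mu).
apply: (@le_integrable _ _ _ mu D mD _ (fun x => (M * f x)%:E)).
- by apply/measurable_EFinP/measurable_funM.
- move=> x Dx /=; rewrite lee_fin !normrM mulrC ler_wpM2r//.
  by rewrite (le_trans (gM x Dx))// ler_norm.
- exact: (integrableZl mD M intf).
Qed.

(** The passage from test functions to indicators. *)
Lemma Rintegral_indic_lim D A f (phi : nat -> T -> R) : measurable D -> measurable A ->
  mu.-integrable D (EFin \o f) ->
  (forall n, measurable_fun D (phi n)) ->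
  (forall x, D x -> phi n x @[n --> \oo] --> (\1_A x : R)) ->
  (forall x n, D x -> `|phi n x| <= 1) ->
  \int[mu]_(x in D) (f x * phi n x) @[n --> \oo] --> \int[mu]_(x in D `&` A) f x.
Proof.
move=> mD mA intf mphi cphi phi1.
have mf : measurable_fun D f by exact/measurable_EFinP/(measurable_int mu).
rewrite Rintegral_mul_indic.
have [//||||||] := @Rintegral_dct D (fun n x => f x * phi n x) (fun x => f x * \1_A x)
  (fun x => `|f x|).
- by move=> n; exact: measurable_funM.
- by apply: measurable_funM => //; exact: measurable_indic.
- by move=> x Dx; apply: cvgMl_tmp; exact: cphi.
- exact: integrable_norm.
- by move=> x n Dx; rewrite normrM ler_piMr// phi1.
- by [].
Qed.

Lemma Rintegral_indic_lim0 D A f (phi : nat -> T -> R) : measurable D -> measurable A ->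
  mu.-integrable D (EFin \o f) ->
  (forall n, measurable_fun D (phi n)) ->
  (forall x, D x -> phi n x @[n --> \oo] --> (\1_A x : R)) ->
  (forall x n, D x -> `|phi n x| <= 1) ->
  (forall n, \int[mu]_(x in D) (f x * phi n x) = 0) ->
  \int[mu]_(x in D `&` A) f x = 0.
Proof.
move=> mD mA intf mphi cphi phi1 H.
have := Rintegral_indic_lim mD mA intf mphi cphi phi1.
under eq_cvg do rewrite H.
by move=> /cvg_lim <- //; rewrite lim_cst.
Qed.

Lemma Rintegral_supp D E f : D `<=` E -> (forall x, E x -> ~ D x -> f x = 0) ->
  \int[mu]_(x in E) f x = \int[mu]_(x in D) f x.
Proof.
move=> DE H; rewrite Rintegral_mkcond [RHS]Rintegral_mkcond.
apply: eq_Rintegral => x _; rewrite /patch.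
case: ifPn => [xE|xE]; case: ifPn => [xD|xD] //.
  by apply: H; [exact: set_mem|move=> Dx; rewrite mem_set in xD].
by rewrite mem_set in xE => //; apply: DE; exact: set_mem.
Qed.

Lemma Rintegral_ae_eq D f g : measurable D -> measurable_fun D f -> measurable_fun D g ->
  {ae mu, forall x, D x -> f x = g x} ->
  \int[mu]_(x in D) f x = \int[mu]_(x in D) g x.
Proof.
move=> mD mf mg H; congr fine; apply: ae_eq_integral => //.
- exact/measurable_EFinP.
- exact/measurable_EFinP.
- by apply: filterS H => x H Dx /=; rewrite H.
Qed.

End MeasureTools.

(** * The fundamental lemma of the calculus of variations *)

Section Lebesgue1.
Context {R : realType}.
Notation mu := (@lebesgue_measure R).
Implicit Types (f g w : R -> R).

Lemma locally_integrable_itv f (a b : R) : locally_integrable setT f ->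
  mu.-integrable `[a, b] (EFin \o f).
Proof.
move=> [mf _ H]; apply/integrableP; split.
  by apply/measurable_EFinP; exact: measurable_funS mf.
by apply: H => //; exact: segment_compact.
Qed.

Lemma continuous_integrable_itv f (a b : R) :
  {within `[a, b], continuous f} -> mu.-integrable `[a, b] (EFin \o f).
Proof.
by move=> cf; apply: continuous_compact_integrable => //; exact: segment_compact.
Qed.

Lemma integrable_cst_itv (a b c : R) : mu.-integrable `[a, b] (EFin \o (fun=> c)).
Proof.
by apply: continuous_integrable_itv; apply: continuous_subspaceT => x; exact: cvg_cst.
Qed.

Lemma Rintegral_cst_itv (a b c : R) : a <= b -> \int[mu]_(x in `[a, b]) c = c * (b - a).
Proof.
rewrite Rintegral_cst//= lebesgue_measure_itv/= lte_fin le_eqVlt => /predU1P[->|->].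
  by rewrite ltxx subrr.
by rewrite -EFinD.
Qed.

Lemma continuous_measurable_itv f (a b : R) :
  {within `[a, b], continuous f} -> measurable_fun `[a, b] f.
Proof.
move=> cf; apply/measurable_EFinP; apply: (measurable_int mu).
exact: continuous_integrable_itv.
Qed.

Lemma integrableM_cont f g (a b : R) : mu.-integrable `[a, b] (EFin \o f) ->
  {within `[a, b], continuous g} ->
  mu.-integrable `[a, b] (EFin \o (fun x => f x * g x)).
Proof.
move=> intf cg.
have [ab|ba] := leP a b; last first.
  by rewrite set_itv_ge ?bnd_simp -?ltNge//; exact: integrable_set0.
have cn : {within `[a, b], continuous (fun x => `|g x|)}.
  by move=> x; apply: (continuous_comp (cg x)); exact: norm_continuous.
have [c _ H] := EVT_max ab cn.
apply: (@integrableM_bounded _ _ _ mu _ _ _ `|g c|) => //.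
exact: continuous_measurable_itv.
Qed.

Lemma smooth_within f (A : set R) : smooth f -> {within A, continuous f}.
Proof. by move=> sf; apply: continuous_subspaceT; exact: smooth_continuous. Qed.

Lemma derive_supp f (a b x : R) : (forall x, x \notin `[a, b] -> f x = 0) ->
  x \notin `[a, b] -> 'D_1 f x = 0.
Proof.
move=> H; rewrite in_itv/= negb_and -!ltNge => /orP[xa|bx].
  apply: (@derive_locally_affine _ _ (x - 1) a 0 0).
    by move=> y /andP[_ ya]; rewrite H ?mul0r ?addr0// in_itv/= negb_and -ltNge ya.
  by rewrite xa andbT ltrBlDr ltrDl.
apply: (@derive_locally_affine _ _ b (x + 1) 0 0).
  move=> y /andP[ya _]; rewrite H ?mul0r ?addr0// in_itv/= negb_and -!ltNge ya.
  by rewrite orbT.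
by rewrite bx ltrDl ltr01.
Qed.

Lemma Rintegral_supp_itv (E : set R) f (a b : R) : `[a, b] `<=` E ->
  (forall x, x \notin `[a, b] -> f x = 0) ->
  \int[mu]_(x in E) f x = \int[mu]_(x in `[a, b]) f x.
Proof.
move=> abE H; apply: Rintegral_supp => // x _ xab; apply: H.
exact/negP.
Qed.

(** The intervals ]c, b[ form a pi-system that generates the Borel sets of
    ]a, b[. *)
Lemma ae0_of_rays f (a b : R) : mu.-integrable `[a, b] (EFin \o f) ->
  (forall c, a <= c -> c < b -> \int[mu]_(x in `]c, b[) f x = 0) ->
  {ae mu, forall x, x \in `[a, b] -> f x = 0}.
Proof.
move=> intf H.
have int' : mu.-integrable `]a, b[ (EFin \o f).
  by apply: integrableS intf => //; exact: subset_itv_oo_cc.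
have K A : measurable A -> \int[mu]_(x in `]a, b[ `&` A) f x = 0.
  have [ab|ba] := ltP a b; last first.
    by rewrite set_itv_ge -?leNgt ?bnd_simp// set0I Rintegral_set0.
  apply: (@Rintegral_setI_pi _ _ _ mu _ _ id (@RGenOInfty.G R)) => //.
  - move=> A1 A2 [x ->] [y ->]; exists (Num.max x y).
    apply/seteqP; split => z /=; rewrite !in_itv/= !andbT gt_max.
      by move=> [-> ->].
    by move=> /andP[-> ->].
  - exact: RGenOInfty.measurableE.
  - exact: H.
  - move=> B [x ->] /=.
    have [bx|xb] := lerP b x.
      rewrite (_ : _ `&` _ = set0) ?Rintegral_set0//.
      rewrite -subset0 => z /=; rewrite !in_itv/= !andbT => -[/andP[_ zb] xz].
      by have := lt_trans (le_lt_trans bx xz) zb; rewrite ltxx.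
    have -> : `]a, b[ `&` `]x, +oo[ = `]Num.max a x, b[%classic.
      apply/seteqP; split => z /=; rewrite !in_itv/= !andbT gt_max.
        by move=> [/andP[-> ->] ->].
      by move=> /andP[/andP[-> ->] ->].
    by apply: H; rewrite ?le_max ?lexx// gt_max ab.
have [//|N [mN N0 NN]] := Rintegral_setI_ae0 _ int' K.
exists (N `|` ([set a] `|` [set b])); split.
- by apply: measurableU => //; apply: measurableU.
- rewrite null_set_setU//; first by apply: measurableU.
  by rewrite null_set_setU//; exact: lebesgue_measure_set1.
- move=> x /= /not_implyP[]; rewrite in_itv/= => /andP[ax xb] fx.
  have [->|xa] := eqVneq x a; first by right; left.
  have [->|xb'] := eqVneq x b; first by right; right.
  left; apply: NN => /= /(_ _); rewrite in_itv/= lt_neqAle eq_sym xa ax.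
  by rewrite lt_neqAle xb' xb; move/(_ isT).
Qed.

Lemma smooth_bump (c d k : R) :
  smooth (fun x => flat 0 (k * (x - c)) * flat 0 (k * (d - x))).
Proof.
apply: smoothM.
  rewrite (_ : (fun x => _) = flat 0 \o (fun x => k * x + - (k * c))).
    by apply: smooth_comp; [exact: smooth_flat|exact: smooth_affine].
  by apply/funext => x /=; rewrite mulrBr.
rewrite (_ : (fun x => _) = flat 0 \o (fun x => - k * x + k * d)).
  by apply: smooth_comp; [exact: smooth_flat|exact: smooth_affine].
by apply/funext => x /=; congr flat; ring.
Qed.

Lemma bump_supp (c d k x : R) : 0 <= k -> x \notin `]c, d[ ->
  flat 0 (k * (x - c)) * flat 0 (k * (d - x)) = 0.
Proof.
move=> k0; rewrite in_itv/= negb_and -!leNgt => /orP[xa|bx].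
  by rewrite flat_neg ?mul0r// mulr_ge0_le0// subr_le0.
by rewrite [X in _ * X]flat_neg ?mulr0// mulr_ge0_le0// subr_le0.
Qed.

Lemma bump_cvg (c d x : R) :
  flat 0 (n%:R * (x - c)) * flat 0 (n%:R * (d - x)) @[n --> \oo] -->
  (\1_`]c, d[%classic x : R).
Proof.
have -> : \1_`]c, d[%classic x = (0 < x - c)%R%:R * (0 < d - x)%R%:R :> R.
  by rewrite indicE mem_setE in_itv/= !subr_gt0 -natrM mulnb.
by apply: cvgM; exact: cvg_flat0.
Qed.

Lemma bump_le1 (c d k x : R) :
  `|flat 0 (k * (x - c)) * flat 0 (k * (d - x))| <= 1.
Proof. by rewrite normrM mulr_ile1// ger0_norm ?flat_ge0// flat0_le1. Qed.

Lemma Rintegral_bump_lim0 (D : set R) f (c d : R) : measurable D ->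
  mu.-integrable D (EFin \o f) -> `]c, d[ `<=` D ->
  (forall n, \int[mu]_(x in D)
     (f x * (flat 0 (n%:R * (x - c)) * flat 0 (n%:R * (d - x)))) = 0) ->
  \int[mu]_(x in `]c, d[) f x = 0.
Proof.
move=> mD intf sub H.
rewrite -(setIidr sub).
apply: (@Rintegral_indic_lim0 _ _ _ mu _ _ _
  (fun k x => flat 0 (k%:R * (x - c)) * flat 0 (k%:R * (d - x)))) => //.
- move=> k; apply: measurable_funTS; apply: continuous_measurable_fun.
  exact/smooth_continuous/smooth_bump.
- by move=> x _; exact: bump_cvg.
- by move=> x k _; exact: bump_le1.
Qed.

(** Products of two rescaled functions [flat 0], one for each end, tend to the
    indicator of an interval. *)
Lemma fundamental_itv f (a b : R) : mu.-integrable `[a, b] (EFin \o f) ->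
  (forall phi : R -> R, smooth phi -> (forall x, x \notin `[a, b] -> phi x = 0) ->
    \int[mu]_(x in `[a, b]) (f x * phi x) = 0) ->
  {ae mu, forall x, x \in `[a, b] -> f x = 0}.
Proof.
move=> intf H; apply: ae0_of_rays => // c ac cb.
apply: (@Rintegral_bump_lim0 `[a, b]) => //.
  by apply: subset_itvW => //; rewrite bnd_simp.
move=> k; apply: H; first exact: smooth_bump.
move=> x xn; apply: bump_supp => //; apply: contra xn.
by rewrite !in_itv/= => /andP[cx /ltW ->]; rewrite (le_trans ac (ltW cx)).
Qed.

Lemma fundamental_lemma f : locally_integrable setT f ->
  (forall phi, test_function setT phi -> \int[mu]_x (f x * phi x) = 0) ->
  {ae mu, forall x, f x = 0}.
Proof.
move=> lf H.
suff K (n : nat) : {ae mu, forall x, x \in `[- n%:R, n%:R] -> f x = 0}.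
  have := (ae_foralln K); apply: filterS => x Hx.
  apply: (Hx (Num.truncn `|x|).+1); rewrite in_itv/= -ler_norml.
  by rewrite ltW// truncnS_gt.
apply: fundamental_itv => [|phi sphi H0]; first exact: locally_integrable_itv.
rewrite -(@Rintegral_supp_itv setT)//; last by move=> x /H0 ->; rewrite mulr0.
by apply: H; exact: test_function1 H0.
Qed.

End Lebesgue1.

(** * Approximate Dirac masses and the weak fundamental theorem of calculus *)

Section Kernel.
Context {R : realType}.
Notation mu := (@lebesgue_measure R).
Implicit Types (f g w S : R -> R) (c e x : R).

(** This is S ((x - c) / e), in the affine form to which [derive_affine_comp]
    applies. *)
Definition rescale S (c e : R) := fun x => S (e^-1 * x + - (e^-1 * c)).

Lemma smooth_rescale S c e : smooth S -> smooth (rescale S c e).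
Proof.
by move=> sS; apply: (@smooth_comp _ _ S) => //; exact: smooth_affine.
Qed.

Lemma rescaleE S c e x : rescale S c e x = S ((x - c) / e).
Proof. by rewrite /rescale mulrC [_ * c]mulrC -mulrBl. Qed.

Lemma derive_rescale S c e x : smooth S ->
  'D_1 (rescale S c e) x = e^-1 * rescale ('D_1 S) c e x.
Proof. by move=> sS; rewrite derive_affine_comp. Qed.

Lemma derive_step1 : 'D_1 step (1 : R) = 0.
Proof.
suff [_ ->] : is_derive (1 : R) 1 (step : R -> R) 0 by [].
apply: (@derive1_at_max R step 0 2) => //.
- by move=> t _; apply: diff_derivable; exact/smooth_diff/smooth_step.
- by rewrite in_itv/=; lra.
- by move=> t _; rewrite [leRHS]step_ge1// step_le1.
Qed.

Lemma derive_rampE (x : R) : 'D_1 ramp x = step x + x * 'D_1 step x.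
Proof.
have sd : derivable (step : R -> R) x 1.
  by apply: diff_derivable; exact/smooth_diff/smooth_step.
have -> : 'D_1 ramp x = 'D_1 (id * step) x by [].
rewrite deriveM; [|exact: derivable_id|exact: sd].
by rewrite derive_id /GRing.scale /= mulr1 addrC.
Qed.

(** The rescaled derivatives of such functions are approximate Dirac masses.
    There are two instances: [step] for first derivatives and the derivative of
    [ramp] for second derivatives. *)
Definition cutoff S := [/\ smooth S, forall x : R, x <= 0 -> S x = 0 &
  forall x : R, 1 <= x -> S x = 1].

Lemma cutoff_step : cutoff step.
Proof. by split; [exact: smooth_step|exact: step_le0|exact: step_ge1]. Qed.

(** At the ends 0 and 1 the values come from the product rule, since [step] is
    critical at 1, its maximum. *)
Lemma cutoff_dramp : cutoff ('D_1 ramp).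
Proof.
split; first exact/smooth_derive/smooth_ramp.
- move=> x; rewrite le_eqVlt => /predU1P[->|x0].
    by rewrite derive_rampE step_le0// mul0r addr0.
  by apply: derive_lt0 => //; exact: ramp_le0.
- move=> x; rewrite le_eqVlt => /predU1P[<-|x1].
    by rewrite derive_rampE derive_step1 mulr0 addr0 step_ge1.
  by apply: (@derive_eventually_affine _ _ 1 0) => // y y1; rewrite mul1r addr0 ramp_ge1.
Qed.

Lemma cutoff_derive_supp S x : cutoff S -> x \notin `[0, 1] -> 'D_1 S x = 0.
Proof.
move=> [sS S0 S1]; rewrite in_itv/= negb_and -!ltNge => /orP[x0|x1].
  exact: derive_lt0.
by apply: (@derive_eventually_affine _ _ 0 1) => // y y1; rewrite mul0r add0r S1.
Qed.

Lemma cutoff_bound S : cutoff S -> exists2 C : R, 0 <= C & forall x : R, `|'D_1 S x| <= C.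
Proof.
move=> cS; have [sS _ _] := cS.
have cn : {within `[0, 1], continuous (fun x => `|'D_1 S x|)}.
  have cD : {within `[0, 1], continuous ('D_1 S)} by exact/smooth_within/smooth_derive.
  move=> x; apply: (continuous_comp (cD x)); exact: norm_continuous.
have [c _ H] := EVT_max ler01 cn.
exists `|'D_1 S c| => // x; have [/H//|xn] := boolP (x \in `[0, 1]).
by rewrite cutoff_derive_supp// normr0.
Qed.

Lemma rescale_supp S c e x : 0 < e -> cutoff S -> x \notin `[c, c + e] ->
  'D_1 (rescale S c e) x = 0.
Proof.
move=> e0 cS xn; have [sS _ _] := cS; rewrite derive_rescale// rescaleE.
rewrite cutoff_derive_supp ?mulr0//; apply: contra xn; rewrite !in_itv/=.
move=> /andP[H1 H2]; apply/andP; split.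
  by rewrite -subr_ge0 -(pmulr_lge0 _ (_ : 0 < e^-1)) ?invr_gt0.
by rewrite -lerBlDl -[leRHS]mul1r -ler_pdivrMr.
Qed.

Lemma kernel_mass S c e : 0 < e -> cutoff S ->
  \int[mu]_(x in `[c, c + e]) 'D_1 (rescale S c e) x = 1.
Proof.
move=> e0 [sS S0 S1]; have sr := smooth_rescale c e sS.
rewrite /Rintegral (@continuous_FTC2 _ _ (rescale S c e)).
- by rewrite !rescaleE subrr mul0r addrAC subrr add0r divff ?gt_eqF// (S0 0)// S1//= subr0.
- by rewrite ltrDl.
- exact/smooth_within/smooth_derive.
- split.
  + by move=> x _; apply: diff_derivable; exact: smooth_diff.
  + by apply: cvg_at_right_filter; exact: smooth_continuous.
  + by apply: cvg_at_left_filter; exact: smooth_continuous.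
- by move=> x _; rewrite derive1E.
Qed.

(** The kernel may change sign: its size C / e against the length e of its
    support is all that enters. *)
Lemma kernel_avg S f c e (eta C : R) : 0 < e -> cutoff S ->
  (forall x : R, `|'D_1 S x| <= C) ->
  {within `[c, c + e], continuous f} ->
  (forall x : R, x \in `[c, c + e] -> `|f x - f c| <= eta) ->
  `|\int[mu]_(x in `[c, c + e]) (f x * 'D_1 (rescale S c e) x) - f c| <= C * eta.
Proof.
move=> e0 cS SC cf feta; have [sS _ _] := cS.
have sK := smooth_derive (1:R) (smooth_rescale c e sS).
have cK : {within `[c, c + e], continuous ('D_1 (rescale S c e))} by exact: smooth_within.
have iK := continuous_integrable_itv cK.
have ifK := integrableM_cont (continuous_integrable_itv cf) cK.
have ifcK : mu.-integrable `[c, c + e] (EFin \o (fun x => f c * 'D_1 (rescale S c e) x)).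
  exact: (integrableZl _ (f c) iK).
have E : \int[mu]_(x in `[c, c + e]) (f x * 'D_1 (rescale S c e) x) - f c =
    \int[mu]_(x in `[c, c + e]) ((f x - f c) * 'D_1 (rescale S c e) x).
  under [RHS]eq_Rintegral do rewrite mulrBl.
  rewrite RintegralB//; congr (_ - _).
  by rewrite RintegralZl// kernel_mass// mulr1.
have iD : mu.-integrable `[c, c + e] (EFin \o (fun x => (f x - f c) * 'D_1 (rescale S c e) x)).
  have := integrableB _ ifK ifcK; move=> /(_ _) H.
  apply: eq_integrable (H _) => // x _ /=; rewrite mulrBl EFinB//.
rewrite E; apply: (le_trans (le_normr_Rintegral _ iD)) => //.
have -> : C * eta = \int[mu]_(x in `[c, c + e]) (C * eta / e).
  by rewrite Rintegral_cst_itv ?lerDl ?(ltW e0)// addrAC subrr add0r divfK// gt_eqF.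
apply: le_Rintegral => //.
- exact: integrable_norm.
- exact: integrable_cst_itv.
- move=> x xce; rewrite normrM derive_rescale// normrM normfV (gtr0_norm e0).
  rewrite mulrCA mulrC ler_pM2r ?invr_gt0// mulrC.
  by apply: ler_pM => //; [exact: SC|exact: feta].
Qed.

Lemma kernel_cvg S f c (e0 : R) : 0 < e0 -> cutoff S ->
  {within `[c, c + e0], continuous f} ->
  \int[mu]_(x in `[c, c + e0 / n.+1%:R])
     (f x * 'D_1 (rescale S c (e0 / n.+1%:R)) x) @[n --> \oo] --> f c.
Proof.
move=> e00 cS cf; have [C C0 SC] := cutoff_bound cS.
apply/cvgrPdist_le => eps eps0.
have eta0 : 0 < eps / (C + 1) by rewrite divr_gt0// ltr_wpDl.
have cc : c < c + e0 by rewrite ltrDl.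
have [_ cr _] := (continuous_within_itvP f cc).1 cf.
have /cvgrPdist_le/(_ _ eta0) [d /= d0 Hd] := cr.
have sub (n : nat) : c + e0 / n.+1%:R <= c + e0.
  by rewrite lerD2l ler_pdivrMr//; apply: ler_peMr; [exact: ltW|rewrite ler1n].
near=> n.
have nd : e0 / n.+1%:R < d.
  rewrite ltr_pdivrMr// mulrC -ltr_pdivrMr//.
  apply: lt_le_trans (_ : n%:R <= _); last by rewrite ler_nat.
  near: n; exact: nbhs_infty_gtr.
rewrite distrC.
apply: (le_trans (@kernel_avg S f c (e0 / n.+1%:R) (eps / (C + 1)) C _ cS SC _ _)).
- by rewrite divr_gt0.
- by apply: continuous_subspaceW cf; apply: subset_itvl; rewrite bnd_simp.
- move=> x; rewrite in_itv/= => /andP[cx xc].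
  move: cx; rewrite le_eqVlt => /predU1P[<-|cx]; first by rewrite subrr normr0 ltW.
  rewrite distrC; apply: Hd => //=.
  by rewrite distrC gtr0_norm ?subr_gt0// ltrBlDl (le_lt_trans xc)// ltrD2l.
- by rewrite mulrCA ger_pMr// ler_pdivrMr ?ltr_wpDl// mul1r lerDl.
Unshelve. all: end_near. Qed.

(** Test with a smooth plateau, equal to 1 between a and b: its derivative tends
    to the difference of the Dirac masses at a and b.  The open interval ]A, B[
    is R for functions of h, and ]0, T[ for functions of t. *)
Lemma weak_ftc (A B : R) w g :
  (forall x, A < x -> x < B -> {for x, continuous w}) ->
  (forall a b, A < a -> b < B -> mu.-integrable `[a, b] (EFin \o g)) ->
  (forall a b (phi : R -> R), A < a -> b < B -> smooth phi ->
    (forall x, x \notin `[a, b] -> phi x = 0) ->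
    \int[mu]_(x in `[a, b]) (w x * 'D_1 phi x) =
    - \int[mu]_(x in `[a, b]) (g x * phi x)) ->
  forall a b, A < a -> a <= b -> b < B ->
  w b - w a = \int[mu]_(x in `[a, b]) g x.
Proof.
move=> cw ig H a b Aa ab bB.
have cs := cutoff_step; have [sS S0 S1] := cs.
(* The plateau needs room to descend between b and B. *)
have [e0 e00 be] : exists2 e0 : R, 0 < e0 & b + e0 < B.
  by exists ((B - b) / 2); lra.
have cwi c d : A < c -> d < B -> {within `[c, d], continuous w}.
  move=> Ac dB; apply: continuous_in_subspaceT => x; rewrite inE/= in_itv/= => /andP[cx xd].
  by apply: cw; [exact: lt_le_trans cx|exact: le_lt_trans dB].
pose e (n : nat) := e0 / n.+1%:R.
have e_gt0 n : 0 < e n by rewrite divr_gt0.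
have e_le n : e n <= e0 by rewrite /e ler_pdivrMr//; apply: ler_peMr; [exact: ltW|rewrite ler1n].
pose phi n x := rescale step a (e n) x - rescale step b (e n) x.
have sphi n : smooth (phi n) by apply: smoothB; exact: smooth_rescale.
have resc0 c n x : x <= c -> rescale step c (e n) x = 0.
  by move=> xc; rewrite rescaleE S0// mulr_le0_ge0 ?subr_le0// invr_ge0 ltW.
have resc1 c n x : c + e n <= x -> rescale step c (e n) x = 1.
  by move=> xc; rewrite rescaleE S1// ler_pdivlMr// mul1r lerBrDl.
have phi0 n x : x \notin `[a, b + e0] -> phi n x = 0.
  rewrite in_itv/= negb_and -!ltNge /phi => /orP[xa|bx].
    by rewrite !resc0 ?subrr// ltW// (lt_le_trans xa).
  rewrite !resc1 ?subrr//.
    by apply: le_trans (ltW bx); rewrite lerD.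
  by apply: le_trans (ltW bx); rewrite lerD.
have L1 : \int[mu]_(x in `[a, b + e0]) (w x * 'D_1 (phi n) x) @[n --> \oo] --> w a - w b.
  have E n : \int[mu]_(x in `[a, b + e0]) (w x * 'D_1 (phi n) x) =
     \int[mu]_(x in `[a, a + e n]) (w x * 'D_1 (rescale step a (e n)) x) -
     \int[mu]_(x in `[b, b + e n]) (w x * 'D_1 (rescale step b (e n)) x).
    have sub1 : `[a, a + e n] `<=` `[a, b + e0].
      by apply: subset_itvl; rewrite bnd_simp lerD.
    have sub2 : `[b, b + e n] `<=` `[a, b + e0].
      by move=> x /=; rewrite !in_itv/= => /andP[bx xb]; have := e_le n; lra.
    rewrite -(@Rintegral_supp_itv _ `[a, b + e0] _ a (a + e n))//; last first.
      by move=> x xn; rewrite rescale_supp ?mulr0.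
    rewrite -(@Rintegral_supp_itv _ `[a, b + e0] _ b (b + e n))//; last first.
      by move=> x xn; rewrite rescale_supp ?mulr0.
    have iw := continuous_integrable_itv (cwi _ _ Aa be).
    rewrite -RintegralB//; last 2 first.
      by apply: (integrableM_cont iw); exact/smooth_within/smooth_derive/smooth_rescale.
      by apply: (integrableM_cont iw); exact/smooth_within/smooth_derive/smooth_rescale.
    apply: eq_Rintegral => x _; rewrite -mulrBr; congr (_ * _).
    by rewrite deriveB//; apply: diff_derivable; exact/smooth_diff/smooth_rescale.
  under eq_cvg do rewrite E.
  apply: cvgB; apply: kernel_cvg => //; apply: cwi => //.
    by rewrite (le_lt_trans _ be)// lerD2r.
  exact: lt_le_trans ab.
(* The plateau itself tends to the indicator of ]a, b]. *)
have L2 : \int[mu]_(x in `[a, b + e0]) (w x * 'D_1 (phi n) x) @[n --> \oo] -->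
    - \int[mu]_(x in `[a, b + e0] `&` `]a, b]) g x.
  under eq_cvg do rewrite (H _ _ _ Aa be (sphi _) (phi0 _)).
  apply: cvgN; apply: Rintegral_indic_lim => //.
  - exact: ig.
  - move=> n; apply: measurable_funTS; apply: continuous_measurable_fun.
    exact: smooth_continuous.
  - move=> x; rewrite /= in_itv/= => /andP[ax xbe].
    have small d : 0 < d -> \forall n \near \oo, e n < d.
      move=> d0; near=> n; rewrite /e ltr_pdivrMr// mulrC -ltr_pdivrMr//.
      apply: lt_le_trans (_ : n%:R <= _); last by rewrite ler_nat.
      near: n; exact: nbhs_infty_gtr.
    rewrite indicE mem_setE in_itv/=.
    move: ax; rewrite le_eqVlt => /predU1P[<-|ax].
      rewrite ltxx/=; apply: cvg_near_cst.
      by near=> n; rewrite /phi !resc0 ?subrr.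
    have [xb|bx] := leP x b.
      rewrite ax/=; apply: cvg_near_cst; have := small _ (_ : 0 < x - a).
      rewrite subr_gt0 => /(_ ax); apply: filterS => n en.
      by rewrite /phi resc1 ?resc0 ?subr0//; lra.
    rewrite ax/=; apply: cvg_near_cst; have := small _ (_ : 0 < x - b).
    rewrite subr_gt0 => /(_ bx); apply: filterS => n en.
    by rewrite /phi !resc1 ?subrr//; lra.
  - move=> x n _; rewrite /phi !rescaleE ler_norml.
    have := @step_ge0 R ((x - a) / e n); have := @step_le1 R ((x - a) / e n).
    have := @step_ge0 R ((x - b) / e n); have := @step_le1 R ((x - b) / e n).
    lra.
have : w a - w b = - \int[mu]_(x in `[a, b + e0] `&` `]a, b]) g x.
  by move/cvg_lim : L1 => <- //; move/cvg_lim : L2 => <-.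
rewrite setIidr; last first.
  by move=> x /=; rewrite !in_itv/= => /andP[/ltW -> xb]; lra.
move=> E; rewrite -opprB E opprK.
rewrite Rintegral_itv_obnd_cbnd//; apply: integrableS (ig a b _ _) => //.
by apply: subset_itvr; rewrite bnd_simp.
Unshelve. all: end_near. Qed.

End Kernel.

(** * Second differences and the second weak derivative *)

Section SecondDifference.
Context {R : realType}.
Notation mu := (@lebesgue_measure R).
Implicit Types (f g w S : R -> R) (c e x a k : R).

(** A smoothing of the positive part of x - c at the scale e; the factor e makes
    its slope 1. *)
Definition sramp c e := fun x => e * rescale ramp c e x.

Lemma smooth_sramp c e : smooth (sramp c e).
Proof. by apply: smoothZ; apply: smooth_rescale; exact: smooth_ramp. Qed.

Lemma derive_sramp c e x : 0 < e -> 'D_1 (sramp c e) x = rescale ('D_1 ramp) c e x.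
Proof.
move=> e0; have -> : sramp c e = e *: rescale ramp c e by [].
rewrite deriveZ; last first.
  by apply: diff_derivable; apply/smooth_diff/smooth_rescale; exact: smooth_ramp.
rewrite derive_rescale; last exact: smooth_ramp.
by rewrite /GRing.scale /= mulrA divff ?gt_eqF// mul1r.
Qed.

Lemma sramp_le0 c e x : 0 < e -> x <= c -> sramp c e x = 0.
Proof.
move=> e0 xc; rewrite /sramp rescaleE ramp_le0 ?mulr0//.
by rewrite mulr_le0_ge0 ?subr_le0// invr_ge0 ltW.
Qed.

Lemma sramp_ge1 c e x : 0 < e -> c + e <= x -> sramp c e x = x - c.
Proof.
move=> e0 xc; rewrite /sramp rescaleE ramp_ge1; last first.
  by rewrite ler_pdivlMr// mul1r lerBrDl.
by rewrite mulrC divfK// gt_eqF.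
Qed.

Lemma sramp_ge0 c e x : 0 < e -> 0 <= sramp c e x.
Proof. by move=> e0; rewrite mulr_ge0 ?(ltW e0)// rescaleE ramp_ge0. Qed.

Lemma sramp_le c e x : 0 < e -> c <= x -> sramp c e x <= x - c.
Proof.
move=> e0 cx; rewrite /sramp rescaleE.
have H : 0 <= (x - c) / e by rewrite divr_ge0 ?subr_ge0// ltW.
apply: le_trans (ler_wpM2l (ltW e0) (ramp_le H)) _.
by rewrite mulrC divfK// gt_eqF.
Qed.

(** A smoothing of the tent of height k over [a - k, a + k], whose second
    derivative is the combination of Dirac masses that evaluates the second
    difference at a. *)
Definition hat a k e := fun x => sramp (a - k) e x + sramp (a + k) e x - 2 * sramp a e x.

Lemma smooth_hat a k e : smooth (hat a k e).
Proof.
apply: smoothB; last by apply: smoothZ; exact: smooth_sramp.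
by apply: smoothD; exact: smooth_sramp.
Qed.

Lemma hat_supp a k e x : 0 < e -> e <= k -> x \notin `[a - k, a + 2 * k] -> hat a k e x = 0.
Proof.
move=> e0 ek; rewrite in_itv/= negb_and -!ltNge /hat => /orP[xa|bx].
  by rewrite !sramp_le0//; lra.
by rewrite !sramp_ge1//; lra.
Qed.

Lemma hat_bound a k e x : 0 < e -> e <= k -> `|hat a k e x| <= 4 * k.
Proof.
move=> e0 ek; have [xs|/hat_supp ->//] := boolP (x \in `[a - k, a + 2 * k]); last first.
  by rewrite normr0; lra.
move: xs; rewrite in_itv/= => /andP[x1 x2].
have H1 := sramp_ge0 (a - k) x e0; have H2 := sramp_ge0 (a + k) x e0.
have H3 := sramp_ge0 a x e0.
have G1 : sramp (a - k) e x <= 3 * k by apply: le_trans (sramp_le e0 x1) _; lra.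
have G2 : sramp (a + k) e x <= k.
  have [xk|kx] := leP x (a + k); first by rewrite sramp_le0//; lra.
  by apply: le_trans (sramp_le e0 (ltW kx)) _; lra.
have G3 : sramp a e x <= 2 * k.
  have [xk|kx] := leP x a; first by rewrite sramp_le0//; lra.
  by apply: le_trans (sramp_le e0 (ltW kx)) _; lra.
by rewrite /hat ler_norml; lra.
Qed.

Lemma derive_comb3 (f1 f2 f3 : R -> R) c x : smooth f1 -> smooth f2 -> smooth f3 ->
  'D_1 (fun y => f1 y + f2 y - c * f3 y) x = 'D_1 f1 x + 'D_1 f2 x - c * 'D_1 f3 x.
Proof.
move=> s1 s2 s3.
have d f : smooth f -> is_derive x 1 f ('D_1 f x).
  by move=> sf; apply: derivableP; apply: diff_derivable; exact: smooth_diff.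
by have [_ <-] := is_deriveB (is_deriveD (d _ s1) (d _ s2)) (is_deriveZ c (d _ s3)).
Qed.

Lemma derive2_hat a k e x : 0 < e -> 'D_1 ('D_1 (hat a k e)) x =
  'D_1 (rescale ('D_1 ramp) (a - k) e) x + 'D_1 (rescale ('D_1 ramp) (a + k) e) x
  - 2 * 'D_1 (rescale ('D_1 ramp) a e) x.
Proof.
move=> e0.
have sr c : smooth (rescale ('D_1 ramp) c e).
  by apply/smooth_rescale/smooth_derive; exact: smooth_ramp.
have -> : 'D_1 (hat a k e) = (fun y => rescale ('D_1 ramp) (a - k) e y +
    rescale ('D_1 ramp) (a + k) e y - 2 * rescale ('D_1 ramp) a e y).
  apply/funext => y; rewrite -!(derive_sramp _ _ e0); apply: derive_comb3; exact: smooth_sramp.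
exact: derive_comb3.
Qed.

Lemma integrable_sq_locally g (a b : R) : locally_integrable setT g ->
  (\int[mu]_(x in `[a, b]) ((g x ^+ 2)%:E) < +oo)%E ->
  mu.-integrable `[a, b] (EFin \o (fun x => g x ^+ 2)).
Proof.
move=> [mg _ _] H; apply/integrableP; split.
  apply/measurable_EFinP; apply: measurable_funX; exact: measurable_funS mg.
move: H; congr (_ < _)%E; apply: eq_integral => x _ /=.
by rewrite ger0_norm// sqr_ge0.
Qed.

(** Test w'' = g with the smoothed hat.  As e tends to 0 the left-hand side tends
    to the second difference, while |g hat| <= lam g^2 + (hat)^2 / (4 lam),
    where the hat is at most 4 k and its support has length 3 k. *)
Lemma second_difference w g a k (lam : R) : continuous w -> weak_deriv 2 w g ->
  0 < k -> 0 < lam ->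
  mu.-integrable `[a - k, a + 2 * k] (EFin \o (fun x => g x ^+ 2)) ->
  `|w (a - k) + w (a + k) - 2 * w a| <=
  lam * \int[mu]_(x in `[a - k, a + 2 * k]) (g x ^+ 2) + 12 * k ^+ 3 / lam.
Proof.
move=> cw [lw lg H] k0 lam0 ig2.
have cwi c d : {within `[c, d], continuous w} by exact: continuous_subspaceT.
pose e (n : nat) := k / n.+1%:R.
have e_gt0 n : 0 < e n by rewrite divr_gt0.
have e_le n : e n <= k by rewrite /e ler_pdivrMr//; apply: ler_peMr; [exact: ltW|rewrite ler1n].
pose I := `[a - k, a + 2 * k].
have ig := locally_integrable_itv (a - k) (a + 2 * k) lg.
have bnd n : `|\int[mu]_(x in `[a - k, a + 2 * k]) (w x * 'D_1 ('D_1 (hat a k (e n))) x)|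
    <= lam * \int[mu]_(x in `[a - k, a + 2 * k]) (g x ^+ 2) + 12 * k ^+ 3 / lam.
  have := H (hat a k (e n)).
  have hs x : x \notin `[a - k, a + 2 * k] -> hat a k (e n) x = 0.
    by move=> xn; rewrite hat_supp.
  move=> /(_ (test_function1 (smooth_hat a k (e n)) (@subsetT _ _) hs)).
  rewrite sqrrN expr1n mul1r -/(iterD _ _) [iterD _ _]/=.
  rewrite (@Rintegral_supp_itv _ setT _ (a - k) (a + 2 * k))//; last first.
    by move=> x xn; rewrite (derive_supp (fun y yn => derive_supp hs yn) xn) ?mulr0.
  rewrite (@Rintegral_supp_itv _ setT _ (a - k) (a + 2 * k))//; last first.
    by move=> x xn; rewrite hs ?mulr0.
  move=> ->.
  have igh : mu.-integrable `[a - k, a + 2 * k] (EFin \o (fun x => g x * hat a k (e n) x)).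
    by apply: integrableM_cont => //; exact/smooth_within/smooth_hat.
  apply: (le_trans (le_normr_Rintegral _ igh)) => //.
  have ic : mu.-integrable `[a - k, a + 2 * k] (EFin \o (fun _ => 4 * k ^+ 2 / lam)).
    exact: integrable_cst_itv.
  have il : mu.-integrable `[a - k, a + 2 * k] (EFin \o (fun x => lam * g x ^+ 2)).
    exact: (integrableZl _ lam ig2).
  apply: (@le_trans _ _ (\int[mu]_(x in `[a - k, a + 2 * k]) (lam * g x ^+ 2 + 4 * k ^+ 2 / lam))).
    apply: le_Rintegral => //.
    - exact: integrable_norm.
    - exact: (integrableD _ il ic).
    - move=> x _; rewrite normrM.
      have := @hat_bound a k (e n) x (e_gt0 n) (e_le n).
      have : 0 <= `|hat a k (e n) x| by [].
      rewrite -(real_normK (num_real (g x))).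
      move: (normr_ge0 (g x)); set G := `|g x|; set h := `|hat _ _ _ _| => G0 h0 hk.
      apply: (@le_trans _ _ (G * (4 * k))); first exact: ler_wpM2l.
      rewrite -subr_ge0.
      have -> : lam * G ^+ 2 + 4 * k ^+ 2 / lam - G * (4 * k) = (lam * G - 2 * k) ^+ 2 / lam.
        by field; rewrite gt_eqF.
      by rewrite divr_ge0 ?sqr_ge0// ltW.
  rewrite RintegralD// RintegralZl// Rintegral_cst_itv; last by lra.
  rewrite lerD2l le_eqVlt; apply/orP; left; apply/eqP.
  by field; rewrite gt_eqF.
(* The second derivative of the hat is a combination of three approximate
   Dirac masses, at the two feet and at the top. *)
have L : \int[mu]_(x in `[a - k, a + 2 * k]) (w x * 'D_1 ('D_1 (hat a k (e n))) x) @[n --> \oo]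
    --> w (a - k) + w (a + k) - 2 * w a.
  have iw c d := continuous_integrable_itv (cwi c d).
  have E (m : nat) : \int[mu]_(x in `[a - k, a + 2 * k]) (w x * 'D_1 ('D_1 (hat a k (e m))) x) =
     \int[mu]_(x in `[a - k, a - k + e m]) (w x * 'D_1 (rescale ('D_1 ramp) (a - k) (e m)) x) +
     \int[mu]_(x in `[a + k, a + k + e m]) (w x * 'D_1 (rescale ('D_1 ramp) (a + k) (e m)) x) -
     2 * \int[mu]_(x in `[a, a + e m]) (w x * 'D_1 (rescale ('D_1 ramp) a (e m)) x).
    have cd := @cutoff_dramp R.
    have R1 c : a - k <= c -> c <= a + k ->
       \int[mu]_(x in `[c, c + e m]) (w x * 'D_1 (rescale ('D_1 ramp) c (e m)) x) =
       \int[mu]_(x in `[a - k, a + 2 * k]) (w x * 'D_1 (rescale ('D_1 ramp) c (e m)) x).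
      move=> c1 c2; rewrite -(@Rintegral_supp_itv _ `[a - k, a + 2 * k] _ c (c + e m))//.
        by move=> x /=; rewrite !in_itv/= => /andP[cx xc]; have := e_le m; lra.
      by move=> x xn; rewrite rescale_supp ?mulr0.
    have alg (W p q r : R) : W * (p + q - 2 * r) = W * p + W * q - 2 * (W * r) by ring.
    pose J c := \int[mu]_(x in `[a - k, a + 2 * k]) (w x * 'D_1 (rescale ('D_1 ramp) c (e m)) x).
    transitivity (J (a - k) + J (a + k) - 2 * J a); last first.
      have comb (x1 x2 x3 y1 y2 y3 : R) : x1 = y1 -> x2 = y2 -> x3 = y3 ->
        y1 + y2 - 2 * y3 = x1 + x2 - 2 * x3 by move=> -> -> ->.
      have [h1 h2 h3] : [/\ a - k <= a - k, a - k <= a + k & a + k <= a + k] by split; lra.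
      have [h4 h5] : a - k <= a /\ a <= a + k by split; lra.
      exact: (comb _ _ _ _ _ _ (R1 _ h1 h2) (R1 _ h2 h3) (R1 _ h4 h5)).
    rewrite /J; clear R1 J.
    have iK c : mu.-integrable `[a - k, a + 2 * k]
        (EFin \o (fun x => w x * 'D_1 (rescale ('D_1 ramp) c (e m)) x)).
      apply: integrableM_cont; first exact: iw.
      by apply/smooth_within/smooth_derive/smooth_rescale/smooth_derive; exact: smooth_ramp.
    rewrite -RintegralZl// -RintegralD// -RintegralB//; last 2 first.
      exact: (integrableD _ (iK (a - k)) (iK (a + k))).
      exact: (integrableZl _ 2 (iK a)).
    apply: eq_Rintegral => x _; rewrite (derive2_hat a k x (e_gt0 m)).
    exact: alg.
  under eq_cvg do rewrite E.
  have K c := @kernel_cvg R _ w c k k0 (@cutoff_dramp R) (cwi _ _).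
  by apply: cvgB; [apply: cvgD; exact: K|apply: cvgMl_tmp; exact: K].
move: bnd L; set s := fun n => \int[mu]_(x in `[a - k, a + 2 * k]) (w x * 'D_1 ('D_1 (hat a k (e n))) x).
move=> bnd L; have L' : `|s n| @[n --> \oo] --> `|w (a - k) + w (a + k) - 2 * w a|.
  by apply: cvg_norm; exact: L.
have <- := cvg_lim (@norm_hausdorff _ _) L'.
apply: limr_le; first by apply/cvg_ex; eexists; exact: L'.
by apply: nearW => n; exact: bnd.
Qed.

End SecondDifference.

(** * Translations and uniqueness of weak derivatives *)

Section Shift.
Context {R : realType}.
Notation mu := (@lebesgue_measure R).
Implicit Types (f g w : R -> R) (a b c x : R).

Lemma measurable_shift c : measurable_fun setT (fun x : R => x + c).
Proof. exact: measurable_funD. Qed.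

Lemma lebesgue_measure_shift c (A : set R) : measurable A ->
  pushforward mu (fun x : measurableTypeR R => x + c : measurableTypeR R) A = mu A.
Proof.
have ms : measurable_fun setT (fun x : measurableTypeR R => x + c : measurableTypeR R).
  exact: measurable_shift.
pose m := @pushforward _ _ _ _ R mu (fun x : measurableTypeR R => x + c : measurableTypeR R).
pose mm := isMeasurableFun.Build _ _ _ _ _ ms.
pose F : {mfun _ >-> _} := HB.pack (fun x : measurableTypeR R => x + c : measurableTypeR R) mm.
move=> mA; apply/esym.
apply: (@lebesgue_measure_unique R (pushforward mu F)) => //= _ [[p q]] _ <-.
rewrite /pushforward /=.
rewrite (_ : _ @^-1` _ = `]p - c, q - c]%classic).
  rewrite !lebesgue_measure_itv/= !lte_fin ltrD2r.
  by case: ifP => // _; rewrite -!EFinD; congr (_%:E); lra.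
by apply/seteqP; split => x /=; rewrite !in_itv/= ltrBlDr lerBrDr.
Qed.

Lemma ge0_integral_shift c (D : set R) (f : R -> \bar R) : measurable D ->
  measurable_fun D f -> (forall x, D x -> 0 <= f x)%E ->
  (\int[mu]_(x in (fun x => x + c)%R @^-1` D) f (x + c)%R = \int[mu]_(x in D) f x)%E.
Proof.
move=> mD mf f0.
have := @ge0_integral_pushforward _ _ _ _ R (fun x : measurableTypeR R => x + c : measurableTypeR R)
  (measurable_shift c) mu D f mD mf.
move=> <-; last by move=> x xD; apply: f0; exact: set_mem.
by apply: eq_measure_integral => [|? A mA _]; [exact: measurable_shift|exact: lebesgue_measure_shift].
Qed.

Lemma measurable_fun_shift c (D : set R) f : measurable D -> measurable_fun D f ->
  measurable_fun ((fun x => x + c) @^-1` D) (fun x => f (x + c)).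
Proof.
move=> mD mf; apply: (measurable_comp mD _ mf); first by move=> _ [y Dy <-].
by apply: measurable_funTS; exact: measurable_shift.
Qed.

Lemma integrable_shift c (D : set R) f : measurable D -> mu.-integrable D (EFin \o f) ->
  mu.-integrable ((fun x => x + c) @^-1` D) (EFin \o (fun x => f (x + c))).
Proof.
move=> mD /integrableP[/measurable_EFinP mf H]; apply/integrableP; split.
  by apply/measurable_EFinP; exact: measurable_fun_shift.
move: H; rewrite -(@ge0_integral_shift c)//.
by apply/measurable_EFinP; apply: measurableT_comp.
Qed.

Lemma Rintegral_shift c (D : set R) f : measurable D -> mu.-integrable D (EFin \o f) ->
  \int[mu]_(x in (fun x => x + c) @^-1` D) f (x + c) = \int[mu]_(x in D) f x.
Proof.
move=> mD intf; have /measurable_EFinP mf := measurable_int _ intf.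
have mE : measurable_fun D (EFin \o f) by exact/measurable_EFinP.
rewrite /Rintegral; congr fine; rewrite integralE [RHS]integralE; congr (_ - _)%E.
  rewrite -(ge0_integral_shift c mD (measurable_funepos mE)) => [|x _]; last exact: funepos_ge0.
  by apply: eq_integral => x _; exact: (congr1 (@^~ x) (funepos_comp (EFin \o f) (fun x => x + c))).
rewrite -(ge0_integral_shift c mD (measurable_funeneg mE)) => [|x _]; last exact: funeneg_ge0.
by apply: eq_integral => x _; exact: (congr1 (@^~ x) (funeneg_comp (EFin \o f) (fun x => x + c))).
Qed.

Lemma preshift_itv c a b : (fun x => x + c) @^-1` `[a, b] = `[a - c, b - c]%classic.
Proof. by apply/seteqP; split => x /=; rewrite !in_itv/= lerBlDr lerBrDr. Qed.

Lemma Rintegral_shift_itv c a b f : mu.-integrable `[a, b] (EFin \o f) ->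
  \int[mu]_(x in `[a - c, b - c]) f (x + c) = \int[mu]_(x in `[a, b]) f x.
Proof. by move=> intf; rewrite -preshift_itv Rintegral_shift. Qed.

Lemma integrable_shift_itv c a b f : mu.-integrable `[a, b] (EFin \o f) ->
  mu.-integrable `[a - c, b - c] (EFin \o (fun x => f (x + c))).
Proof. by move=> intf; rewrite -preshift_itv; exact: integrable_shift. Qed.

End Shift.

Section WeakDeriv.
Context {R : realType}.
Notation mu := (@lebesgue_measure R).
Implicit Types (f g w phi : R -> R) (a b c : R) (k : nat).

Lemma ae_imply (P Q : R -> Prop) : (forall x, P x -> Q x) ->
  {ae mu, forall x, P x} -> {ae mu, forall x, Q x}.
Proof.
move=> PQ [N [mN N0 H]]; exists N; split => // x /= nQ; apply: H => /= /PQ.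
exact: nQ.
Qed.

Lemma ae_imply2 (P1 P2 Q : R -> Prop) : (forall x, P1 x -> P2 x -> Q x) ->
  {ae mu, forall x, P1 x} -> {ae mu, forall x, P2 x} -> {ae mu, forall x, Q x}.
Proof.
move=> PQ [N [mN N0 H]] [M [mM M0 G]]; exists (N `|` M); split.
- exact: measurableU.
- by rewrite null_set_setU.
move=> x /= nQ; apply: contrapT => /not_orP[nN nM]; apply: nQ; apply: PQ.
  by apply: contrapT => nP; apply: nN; exact: H.
by apply: contrapT => nP; apply: nM; exact: G.
Qed.

Lemma test_function_bounded phi : test_function setT phi ->
  exists2 n : R, 0 < n & forall x, x \notin `[- n, n] -> phi x = 0.
Proof.
move=> [sp cp _]; have [M [_ HM]] := compact_bounded cp.
exists (`|M| + 1); first by rewrite ltr_wpDl.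
move=> x xn; apply: contrapT => /eqP px.
have := HM (`|M| + 1); rewrite (le_lt_trans (ler_norm M)) ?ltrDl// => /(_ isT x).
have cx : closure [set x | phi x != 0] x by exact: subset_closure.
move=> /(_ cx) xM.
by move: xn; rewrite in_itv/= -ler_norml xM.
Qed.

Lemma test_function_iter s phi O : test_function O phi -> forall n, 
  (forall x, x \notin `[- n, n] -> phi x = 0) ->
  smooth (iterD (nseq s (1:R)) phi) /\
  forall x, x \notin `[- n, n] -> iterD (nseq s (1:R)) phi x = 0.
Proof.
move=> [sp _ _] n H; elim: s => [//|s [IH1 IH2]] /=; split; first exact: smooth_derive.
by move=> x; exact: (derive_supp (fun y yn => IH2 y yn)).
Qed.

Lemma weak_deriv_sub k w1 w2 g1 g2 : weak_deriv k w1 g1 -> weak_deriv k w2 g2 ->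
  weak_deriv k (w1 \- w2) (g1 \- g2).
Proof.
move=> [lw1 lg1 H1] [lw2 lg2 H2]; split; [exact: locally_integrableB..|].
move=> phi tp; have [n n0 Hn] := test_function_bounded tp.
have [s1 S1] := test_function_iter k tp Hn.
have E w : \int[mu]_x (w x * iterD (nseq k (1:R)) phi x) =
    \int[mu]_(x in `[- n, n]) (w x * iterD (nseq k (1:R)) phi x).
  by apply: Rintegral_supp_itv => // x xn; rewrite S1 ?mulr0.
have F w : \int[mu]_x (w x * phi x) = \int[mu]_(x in `[- n, n]) (w x * phi x).
  by apply: Rintegral_supp_itv => // x xn; rewrite Hn ?mulr0.
have i1 w : locally_integrable setT w -> mu.-integrable `[- n, n]
    (EFin \o (fun x => w x * iterD (nseq k (1:R)) phi x)).
  move=> lw; apply: integrableM_cont; first exact: locally_integrable_itv.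
  exact: smooth_within.
have i2 w : locally_integrable setT w -> mu.-integrable `[- n, n]
    (EFin \o (fun x => w x * phi x)).
  move=> lw; apply: integrableM_cont; first exact: locally_integrable_itv.
  by case: tp => sp _ _; exact: smooth_within.
have := H1 _ tp; have := H2 _ tp; rewrite !E !F => e2 e1.
transitivity (\int[mu]_(x in `[- n, n]) (w1 x * iterD (nseq k (1:R)) phi x) -
   \int[mu]_(x in `[- n, n]) (w2 x * iterD (nseq k (1:R)) phi x)).
  rewrite -RintegralB//; [|exact: i1..].
  by apply: eq_Rintegral => x _; exact: mulrBl.
rewrite e1 e2 -mulrBr; congr (_ * _).
rewrite -RintegralB//; [|exact: i2..].
by apply: eq_Rintegral => x _; rewrite -mulrBl.
Qed.

Lemma weak_deriv_unique k w g1 g2 : weak_deriv k w g1 -> weak_deriv k w g2 ->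
  {ae mu, forall x, g1 x = g2 x}.
Proof.
move=> d1 d2; have [_ lg H] := weak_deriv_sub d1 d2.
have K := fundamental_lemma lg _.
suff : {ae mu, forall x, (g1 \- g2) x = 0}.
  by apply: ae_imply => x /eqP; rewrite subr_eq0 => /eqP.
apply: K => phi tp; have := H phi tp.
rewrite (_ : \int[mu]_x _ = 0); last first.
  by rewrite /Rintegral integral0_eq// => x _ /=; rewrite subrr mul0r.
by move/esym/eqP; rewrite mulf_eq0 signr_eq0/= => /eqP.
Qed.

Lemma weak_deriv_ae k w w' g : {ae mu, forall x, w x = w' x} ->
  locally_integrable setT w' -> weak_deriv k w g -> weak_deriv k w' g.
Proof.
move=> ww' lw' [lw lg H]; split => // phi tp; rewrite -H//.
have [n n0 Hn] := test_function_bounded tp.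
have [s1 S1] := test_function_iter k tp Hn.
have mS : measurable_fun setT (iterD (nseq k (1:R)) phi).
  by apply: continuous_measurable_fun; exact: smooth_continuous.
apply: Rintegral_ae_eq => //.
- by apply: measurable_funM => //; case: lw'.
- by apply: measurable_funM => //; case: lw.
- by apply: ae_imply ww' => x -> _.
Qed.

Lemma weak_deriv0 w : locally_integrable setT w -> weak_deriv 0 w w.
Proof. by move=> lw; split => // phi _; rewrite expr0 mul1r. Qed.

Lemma wderivP k w g : weak_deriv k w g -> weak_deriv k w (wderiv k w).
Proof. by move=> H; apply: (xgetPex (cst 0)); exists g. Qed.

(** The choice in [wderiv] is made among all weak derivatives, a set that depends
    only on the class of w. *)
Lemma wderiv_ae k w w' : {ae mu, forall x, w x = w' x} ->
  locally_integrable setT w -> locally_integrable setT w' -> wderiv k w = wderiv k w'.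
Proof.
move=> ww' lw lw'; rewrite /wderiv; congr xget; apply/seteqP; split => g /=.
  exact: weak_deriv_ae.
by apply: weak_deriv_ae => //; apply: ae_imply ww'.
Qed.

Lemma weak_deriv_shift k w g c : weak_deriv k w g ->
  weak_deriv k (fun x => w (x + c)) (fun x => g (x + c)).
Proof.
move=> [lw lg H].
have ls f : locally_integrable setT f -> locally_integrable setT (fun x => f (x + c)).
  move=> lf; have [mf _ _] := lf; split; [|exact: openT|].
    by have := @measurable_fun_shift _ c setT f measurableT mf; rewrite preimage_setT.
  move=> K _ cK; have [M [_ HM]] := compact_bounded cK.
  have i := locally_integrable_itv (c - (`|M| + 1)) (c + (`|M| + 1)) lf.
  have /integrableP[_] := integrable_shift_itv c i; apply: le_lt_trans.
  apply: ge0_subset_integral => //.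
  - exact: compact_measurable.
  - apply/measurable_EFinP; apply: measurableT_comp => //.
    have := @measurable_fun_shift _ c setT f measurableT mf; rewrite preimage_setT => mfs.
    exact: measurable_funS mfs.
  - move=> x Kx; have := HM (`|M| + 1); rewrite (le_lt_trans (ler_norm M)) ?ltrDl// => /(_ isT x Kx).
    by rewrite /= in_itv/= ler_norml => /andP[? ?]; apply/andP; split; lra.
split; [exact: ls..|] => phi tp.
have [n n0 Hn] := test_function_bounded tp.
have [s1 S1] := test_function_iter k tp Hn.
have sphi : smooth phi by case: tp.
pose psi := fun x => phi (1 * x + - c).
have psiE : iterD (nseq k (1:R)) psi = _ := iterD_shift k (- c) sphi.
have spsi : smooth psi := smooth_shift (- c) sphi.
have psi0 x : x \notin `[c - n, c + n] -> psi x = 0.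
  move=> xn; rewrite /psi mul1r Hn//; apply: contra xn; rewrite !in_itv/= => /andP[? ?].
  by apply/andP; split; lra.
have tpsi : test_function setT psi by apply: test_function1 psi0.
have := H _ tpsi; rewrite psiE.
have E f q : locally_integrable setT f -> smooth q -> (forall x, x \notin `[- n, n] -> q x = 0) ->
   \int[mu]_x (f x * q (1 * x + - c)) = \int[mu]_x (f (x + c) * q x).
  move=> lf sq q0.
  rewrite (@Rintegral_supp_itv _ setT _ (c - n) (c + n))//; last first.
    move=> x xn; rewrite mul1r q0 ?mulr0//; apply: contra xn; rewrite !in_itv/= => /andP[? ?].
    by apply/andP; split; lra.
  rewrite (@Rintegral_supp_itv _ setT _ (- n) n)//; last by move=> x xn; rewrite q0 ?mulr0.
  rewrite -(@Rintegral_shift_itv _ c)//; last first.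
    apply: integrableM_cont; first exact: locally_integrable_itv.
    exact/smooth_within/smooth_shift.
  have -> : c - n - c = - n by lra.
  have -> : c + n - c = n by lra.
  by apply: eq_Rintegral => x _; rewrite mul1r addrK.
by rewrite E// E.
Qed.

End WeakDeriv.

(** * Periodic functions with square integrable derivatives *)

Section Curvature.
Context {R : realType}.
Notation mu := (@lebesgue_measure R).
Implicit Types (f g w phi : R -> R) (a b c k : R).

Lemma Rintegral_itv_split f a b c : a <= b -> b <= c -> mu.-integrable `[a, c] (EFin \o f) ->
  \int[mu]_(x in `[a, c]) f x = \int[mu]_(x in `[a, b]) f x + \int[mu]_(x in `[b, c]) f x.
Proof.
move=> ab bc intf; have := @Rintegral_itvB _ f (BLeft a) (BRight c) b intf.
rewrite !bnd_simp => /(_ ab bc).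
rewrite Rintegral_itv_obnd_cbnd; last first.
  by apply: integrableS intf => //; move=> x /=; rewrite !in_itv/= => /andP[/ltW ? ->]; rewrite andbT (le_trans ab).
by move=> /eqP; rewrite subr_eq addrC => /eqP.
Qed.

Lemma le_Rintegral_subset f (A B : set R) : measurable A -> measurable B -> A `<=` B ->
  mu.-integrable B (EFin \o f) -> (forall x, B x -> 0 <= f x) ->
  \int[mu]_(x in A) f x <= \int[mu]_(x in B) f x.
Proof.
move=> mA mB AB intf f0; apply: fine_le.
- by apply: integrable_fin_num => //; apply: integrableS intf.
- exact: integrable_fin_num.
- by apply: ge0_subset_integral => //; exact: (measurable_int mu).
Qed.

Lemma periodicz w : (forall x, w (x + 1) = w x) -> forall (n : int) x, w (x + n%:~R) = w x.
Proof.
move=> pw; suff H (n : nat) x : w (x + n%:R) = w x.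
  case=> n x; first exact: H.
  by rewrite NegzE mulrNz -pmulrn -[LHS](H n.+1) subrK.
elim: n x => [|n IH] x; first by rewrite addr0.
by rewrite -natr1 addrA pw.
Qed.

Lemma periodic_repr w : (forall x, w (x + 1) = w x) -> forall x, exists2 y, 0 <= y < 1 & w x = w y.
Proof.
move=> pw x; exists (x - (Num.floor x)%:~R).
  by rewrite subr_ge0 ltrBlDl ge_floor/= -intrD1 floorD1_gt.
by rewrite -mulrNz periodicz.
Qed.

Lemma periodic_max w : continuous w -> (forall x, w (x + 1) = w x) ->
  exists2 h0, 0 <= h0 <= 1 & forall x, w x <= w h0.
Proof.
have c01 : continuous w -> {within `[0, 1], continuous w} by exact: continuous_subspaceT.
move=> cw pw; have [h0 + H] := EVT_max ler01 (c01 cw).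
rewrite in_itv/= => h01; exists h0 => // x.
have [y /andP[y0 y1] ->] := periodic_repr pw x.
by apply: H; rewrite in_itv/= y0 ltW.
Qed.

(** The window [-1, 2] contains the intervals [h - k, h + 2 k] of
    [second_difference] for h in [0, 1] and k <= 1/2. *)
Definition curv w (N : R) := exists2 g, weak_deriv 2 w g &
  mu.-integrable `[-1, 2] (EFin \o (fun x => g x ^+ 2)) /\
  \int[mu]_(x in `[-1, 2]) (g x ^+ 2) <= N.

Lemma curv_sub w1 w2 N1 N2 : curv w1 N1 -> curv w2 N2 -> curv (w1 \- w2) (2 * (N1 + N2)).
Proof.
move=> [g1 d1 [i1 I1]] [g2 d2 [i2 I2]]; exists (g1 \- g2); first exact: weak_deriv_sub.
have ii : mu.-integrable `[-1, 2] (EFin \o (fun x => 2 * (g1 x ^+ 2 + g2 x ^+ 2))).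
  exact: (integrableZl _ 2 (integrableD _ i1 i2)).
have le x : (g1 x - g2 x) ^+ 2 <= 2 * (g1 x ^+ 2 + g2 x ^+ 2).
  rewrite -subr_ge0.
  have -> : 2 * (g1 x ^+ 2 + g2 x ^+ 2) - (g1 x - g2 x) ^+ 2 = (g1 x + g2 x) ^+ 2 by ring.
  exact: sqr_ge0.
have id : mu.-integrable `[-1, 2] (EFin \o (fun x => (g1 x - g2 x) ^+ 2)).
  apply: le_integrable ii => //.
    have [_ [mg1 _ _] _] := d1; have [_ [mg2 _ _] _] := d2.
    apply/measurable_EFinP; apply: measurable_funX.
    by apply: measurable_funB; exact: measurable_funTS.
  move=> x _ /=; rewrite lee_fin ger0_norm ?sqr_ge0//.
  exact: (le_trans (le x) (ler_norm _)).
split => //; apply: (@le_trans _ _ (\int[mu]_(x in `[-1, 2]) (2 * (g1 x ^+ 2 + g2 x ^+ 2)))).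
  by apply: le_Rintegral => // x _; exact: le.
rewrite RintegralZl//; last exact: (integrableD _ i1 i2).
by rewrite RintegralD// ler_pM2l// lerD.
Qed.

(** At a maximum each of the two neighbours lies below w h0, so that the bound on
    the second difference bounds each of them from below. *)
Lemma curv_max w N h0 k (lam : R) : continuous w -> curv w N -> 0 <= h0 <= 1 ->
  (forall x, w x <= w h0) -> 0 < k -> k <= 2^-1 -> 0 < lam ->
  w h0 - (lam * N + 12 * k ^+ 3 / lam) <= w (h0 - k) /\
  w h0 - (lam * N + 12 * k ^+ 3 / lam) <= w (h0 + k).
Proof.
move=> cw [g dg [ig Ig]] /andP[h00 h01] H k0 k1 lam0.
have sub : `[h0 - k, h0 + 2 * k] `<=` `[-1, 2].
  by move=> x /=; rewrite !in_itv/= => /andP[? ?]; apply/andP; split; lra.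
have := @second_difference _ w g h0 k lam cw dg k0 lam0.
have ig' : mu.-integrable `[h0 - k, h0 + 2 * k] (EFin \o (fun x => g x ^+ 2)).
  by apply: integrableS ig.
move=> /(_ ig').
have le : \int[mu]_(x in `[h0 - k, h0 + 2 * k]) (g x ^+ 2) <= N.
  by apply: le_trans Ig; apply: le_Rintegral_subset => // x _; exact: sqr_ge0.
have {}le := ler_wpM2l (ltW lam0) le.
have := H (h0 - k); have := H (h0 + k).
set e := 12 * k ^+ 3 / lam; set i := lam * _ in le *; set j := lam * N in le *.
by rewrite ler_norml => ? ? /andP[? ?]; split; lra.
Qed.

(** On the circle every point is at distance at most 1/2 from the maximum; then
    [curv_max] applies with lam = 1. *)
Lemma curv_osc w N : continuous w -> (forall x, w (x + 1) = w x) -> curv w N ->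
  forall x y, w x - w y <= N + 2.
Proof.
move=> cw pw cN x y.
have [h0 h01 H] := periodic_max cw pw; have /andP[h0a h0b] := h01.
have [z /andP[z0 z1] ->] := periodic_repr pw y.
suff : w h0 - w z <= N + 2 by have := H x; lra.
have N0 : 0 <= N.
  by case: cN => g _ [_]; apply: le_trans; apply: Rintegral_ge0 => ? _; exact: sqr_ge0.
have K k : 0 < k -> k <= 2^-1 -> w h0 - (N + 2) <= w (h0 - k) /\ w h0 - (N + 2) <= w (h0 + k).
  move=> k0 k1; have := @curv_max w N h0 k 1 cw cN h01 H k0 k1 ltr01.
  have : 12 * k ^+ 3 <= 2.
    have : k ^+ 3 <= 2^-1 ^+ 3 by rewrite lerXn2r ?nnegrE// ?ltW.
    by rewrite exprVn; lra.
  by rewrite divr1 mul1r; lra.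
have [zh|zh|->] := ltgtP z h0; last by rewrite subrr; lra.
  have [le|lt] := leP (h0 - z) 2^-1.
    have [+ _] := K (h0 - z) ltac:(lra) le.
    have -> : h0 - (h0 - z) = z by ring.
    lra.
  (* The short way from h0 to z goes through 1. *)
  have [E|E] := eqVneq h0 (z + 1); first by rewrite E pw subrr; lra.
  have zh1 : h0 < z + 1 by rewrite lt_neqAle E; lra.
  have [_ +] := K (z + 1 - h0) ltac:(lra) ltac:(lra).
  have -> : h0 + (z + 1 - h0) = z + 1 by ring.
  by rewrite pw; lra.
have [le|lt] := leP (z - h0) 2^-1.
  have [_ +] := K (z - h0) ltac:(lra) le.
  have -> : h0 + (z - h0) = z by ring.
  lra.
have [+ _] := K (h0 + 1 - z) ltac:(lra) ltac:(lra).
have -> : h0 - (h0 + 1 - z) = z - 1 by ring.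
by rewrite -(pw (z - 1)) subrK; lra.
Qed.

Lemma Hloc_wderiv (m k : nat) w : Hloc m w -> (k <= m)%N ->
  weak_deriv k w (wderiv k w) /\
  forall a b, mu.-integrable `[a, b] (EFin \o (fun x => wderiv k w x ^+ 2)).
Proof.
move=> Hm km; have [g dg g2] := Hm k km; have d := wderivP dg; split => // a b.
apply: integrable_sq_locally; first by case: d.
have := g2 `[a, b]%classic (@segment_compact _ a b); congr (_ < _)%E.
have [_ [mg _ _] _] := dg; have [_ [md _ _] _] := d.
apply: ge0_ae_eq_integral => //.
- by apply/measurable_EFinP; apply: measurable_funX; exact: measurable_funTS.
- by apply/measurable_EFinP; apply: measurable_funX; exact: measurable_funTS.
- by move=> x _; rewrite lee_fin sqr_ge0.
- by move=> x _; rewrite lee_fin sqr_ge0.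
- by apply: ae_imply (weak_deriv_unique dg d) => x -> _.
Qed.

(** The weak derivative inherits the periodicity of w, being unique; three
    periods make the factor 3. *)
Lemma Hper2_curv w : Hper 2 w -> (forall x, w (x + 1) = w x) ->
  curv w (3 * \int[mu]_(x in `[0, 1]) (wderiv 2 w x ^+ 2)).
Proof.
move=> [Hw _] pw; have [d i] := Hloc_wderiv Hw (leqnn 2).
exists (wderiv 2 w) => //; split => //.
set g := wderiv 2 w in d i *.
have ds := weak_deriv_shift 1 d.
have pws : (fun x => w (x + 1)) = w by apply/funext.
rewrite pws in ds; have ae := weak_deriv_unique d ds.
have [_ [mg _ _] _] := d; have [_ [mgs _ _] _] := ds.
have S a : \int[mu]_(x in `[a + 1, a + 2]) (g x ^+ 2) = \int[mu]_(x in `[a, a + 1]) (g x ^+ 2).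
  rewrite -(@Rintegral_shift_itv _ 1)//.
  have -> : a + 1 - 1 = a by lra.
  have -> : a + 2 - 1 = a + 1 by lra.
  apply: Rintegral_ae_eq => //.
  - by apply: measurable_funX; exact: measurable_funTS.
  - by apply: measurable_funX; exact: measurable_funTS.
  - by apply: ae_imply ae => x <- _.
have [h1 h2 h3 h4] : [/\ -1 <= 0 :> R, 0 <= 2 :> R, 0 <= 1 :> R & 1 <= 2 :> R] by split; lra.
rewrite (Rintegral_itv_split h1 h2 (i _ _)) (Rintegral_itv_split h3 h4 (i _ _)).
have := S 0; have := S (-1); rewrite !add0r.
have -> : (-1) + 1 = 0 :> R by lra.
have -> : (-1) + 2 = 1 :> R by lra.
by move=> <- ->; lra.
Qed.

(** Integrated with a suitable weight lam, this has the effect of the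
    Cauchy-Schwarz inequality. *)
Lemma ler_weighted_sq (lam q : R) : 0 < lam -> q <= lam / 2 * q ^+ 2 + (2 * lam)^-1.
Proof.
move=> lam0; rewrite -subr_ge0.
have -> : lam / 2 * q ^+ 2 + (2 * lam)^-1 - q = (lam * q - 1) ^+ 2 / (2 * lam).
  by field; rewrite gt_eqF.
by rewrite divr_ge0 ?sqr_ge0// mulr_ge0// ltW.
Qed.

(** By [weak_ftc] an increment of w is the integral of its derivative, which
    [ler_weighted_sq] bounds with the weight |x - y|^(1/2). *)
Lemma Hloc1_holder w : continuous w -> Hloc 1 w -> holder 2^-1 w.
Proof.
move=> cw H; have [[lw lg D] ig2] := Hloc_wderiv H (leqnn 1).
set g := wderiv 1 w in lg D ig2.
have ftc : forall a b, -1 < a -> a <= b -> b < 2 -> w b - w a = \int[mu]_(x in `[a, b]) g x.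
  apply: weak_ftc => [x _ _|a b _ _|a b phi _ _ sphi H0]; first exact: cw.
    exact: locally_integrable_itv.
  have := D phi (test_function1 sphi (@subsetT _ _) H0).
  rewrite expr1 mulN1r (@Rintegral_supp_itv _ setT _ a b)//; last first.
    by move=> x xn; have /= := derive_supp H0 xn => ->; rewrite mulr0.
  by rewrite (@Rintegral_supp_itv _ setT _ a b)// => x xn; rewrite H0 ?mulr0.
pose G := \int[mu]_(x in `[0, 1]) (g x ^+ 2).
have G0 : 0 <= G by apply: Rintegral_ge0 => x _; exact: sqr_ge0.
exists ((G + 1) / 2) => x y; rewrite !in_itv/= => /andP[x0 x1] /andP[y0 y1].
wlog xy : x y x0 x1 y0 y1 / y <= x.
  move=> W; have [xy|/ltW xy] := leP y x; first exact: W.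
  by rewrite distrC [`|x - y|]distrC; exact: W.
rewrite ftc; [|lra|by []|lra].
have [->|xny] := eqVneq x y.
  rewrite set_interval.set_itv1 Rintegral_set1 normr0.
  by apply: mulr_ge0; [apply: divr_ge0; lra|exact: powR_ge0].
have d0 : 0 < x - y by rewrite subr_gt0 lt_neqAle eq_sym xny.
rewrite (gtr0_norm d0) (powR12_sqrt (ltW d0)).
set s := Num.sqrt (x - y); have s0 : 0 < s by rewrite sqrtr_gt0.
have sE : x - y = s ^+ 2 by rewrite sqr_sqrtr// ltW.
have ig := locally_integrable_itv y x lg.
apply: le_trans; first by apply: le_normr_Rintegral.
have ic : mu.-integrable `[y, x] (EFin \o (fun _ => (2 * s)^-1)).
  exact: integrable_cst_itv.
have is' : mu.-integrable `[y, x] (EFin \o (fun z => s / 2 * g z ^+ 2)).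
  exact: (integrableZl _ (s / 2) (ig2 y x)).
apply: (@le_trans _ _ (\int[mu]_(z in `[y, x]) (s / 2 * g z ^+ 2 + (2 * s)^-1))).
  apply: le_Rintegral => //.
  - exact: integrable_norm.
  - exact: (integrableD _ is' ic).
  - by move=> z _; rewrite -(real_normK (num_real (g z))); exact: ler_weighted_sq.
rewrite RintegralD// RintegralZl// Rintegral_cst_itv; last by lra.
rewrite sE.
have -> : (2 * s)^-1 * s ^+ 2 = s / 2 by field; rewrite gt_eqF.
have le : \int[mu]_(z in `[y, x]) (g z ^+ 2) <= G.
  apply: le_Rintegral_subset => //.
  - by move=> z /=; rewrite !in_itv/= => /andP[? ?]; apply/andP; split; lra.
  - by move=> z _; exact: sqr_ge0.
have := ler_wpM2l (_ : 0 <= s / 2) le; rewrite divr_ge0 ?(ltW s0)// => /(_ isT).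
by move=> H1; rewrite (le_trans (lerD H1 (lexx _)))//; lra.
Qed.

End Curvature.

(** * Fubini on rectangles *)

Section FinePart.
Context d (T : measurableType d) (R : realType) (m : {measure set T -> \bar R}).

Lemma integrable_fine (D : set T) (f : T -> \bar R) : measurable D -> m.-integrable D f ->
  m.-integrable D (EFin \o (fine \o f)) /\
  \int[m]_(x in D) (fine \o f) x = fine (\int[m]_(x in D) f x)%E.
Proof.
move=> mD intf; have mf := measurable_int _ intf.
have mff : measurable_fun D (EFin \o (fine \o f)).
  by apply/measurable_EFinP; apply: (@measurableT_comp _ _ _ _ _ _ fine).
have ae : ae_eq m D (EFin \o (fine \o f)) f.
  by apply: filterS (integrable_ae mD intf) => x H Dx; rewrite /= fineK// H.
split; last by congr fine; exact: ae_eq_integral.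
apply/integrableP; split => //; have /integrableP[_] := intf; apply: le_lt_trans.
rewrite le_eqVlt; apply/orP; left; apply/eqP; apply: ae_eq_integral => //.
- exact: measurableT_comp.
- exact: measurableT_comp.
- by apply: filterS ae => x H Dx; rewrite /= -H.
Qed.

End FinePart.

Section RectFubini.
Context d1 d2 (T1 : measurableType d1) (T2 : measurableType d2) (R : realType).
Variable m1 : {sigma_finite_measure set T1 -> \bar R}.
Variable m2 : {sigma_finite_measure set T2 -> \bar R}.
Implicit Types (F : T1 * T2 -> R) (A : set T1) (B : set T2).

Let restrE F A B x y : ((EFin \o F) \_ (A `*` B)) (x, y) =
  (if x \in A then ((fun y => (F (x, y))%:E) \_ B) y else 0)%E.
Proof.
rewrite /patch; have -> : ((x, y) \in A `*` B) = (x \in A) && (y \in B).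
  by apply/idP/andP => [/set_mem[? ?]|[/set_mem ? /set_mem ?]]; [split|]; exact/mem_set.
by case: ifPn => [/andP[-> ->]//|]; case: (x \in A) => //=; case: (y \in B).
Qed.

(** The inner integrals are real-valued, hence meaningful only for almost every
    slice. *)
Lemma rect_fubini1 F A B : measurable A -> measurable B ->
  (m1 \x m2)%E.-integrable (A `*` B) (EFin \o F) ->
  [/\ {ae m1, forall x, A x -> m2.-integrable B (EFin \o (fun y => F (x, y)))},
      m1.-integrable A (EFin \o (fun x => \int[m2]_(y in B) F (x, y))) &
      \int[(m1 \x m2)%E]_(z in A `*` B) F z = \int[m1]_(x in A) \int[m2]_(y in B) F (x, y)].
Proof.
move=> mA mB iF; set f := (EFin \o F) \_ (A `*` B).
have mAB : measurable (A `*` B) by exact: measurableX.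
have imf : (m1 \x m2)%E.-integrable setT f by apply/(integrable_mkcond _ mAB).
have ae1 : {ae m1, forall x, A x -> m2.-integrable B (EFin \o (fun y => F (x, y)))}.
  apply: filterS (ae_integrable1 imf) => x + Ax.
  rewrite (_ : (fun y => f (x, y)) = (EFin \o (fun y => F (x, y))) \_ B); last first.
    by apply/funext => y; rewrite /f restrE mem_set.
  by move/(integrable_mkcond _ mB).
have FE x : (\int[m2]_y f (x, y) = ((fun x => \int[m2]_(y in B) (F (x, y))%:E) \_ A) x)%E.
  rewrite [RHS]/patch; case: ifPn => xA.
    by rewrite [RHS]integral_mkcond; apply: eq_integral => y _; rewrite /f restrE xA.
  by apply: integral0_eq => y _; rewrite /f restrE (negbTE xA).
have iG : m1.-integrable A (fun x => \int[m2]_(y in B) (F (x, y))%:E)%E.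
  apply/(integrable_mkcond _ mA).
  rewrite (_ : _ \_ _ = (fun x => \int[m2]_y f (x, y))%E); last by apply/funext => x; rewrite FE.
  exact: (integrable_fubini_F imf).
have [iR ER] := integrable_fine mA iG.
split=> //; rewrite [RHS]ER [LHS]/Rintegral; congr fine.
rewrite integral_mkcond -/f -(integral12_prod_meas1 imf) [RHS]integral_mkcond.
by apply: eq_integral => x _; exact: FE.
Qed.

Lemma rect_fubini2 F A B : measurable A -> measurable B ->
  (m1 \x m2)%E.-integrable (A `*` B) (EFin \o F) ->
  [/\ {ae m2, forall y, B y -> m1.-integrable A (EFin \o (fun x => F (x, y)))},
      m2.-integrable B (EFin \o (fun y => \int[m1]_(x in A) F (x, y))) &
      \int[(m1 \x m2)%E]_(z in A `*` B) F z = \int[m2]_(y in B) \int[m1]_(x in A) F (x, y)].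
Proof.
move=> mA mB iF; set f := (EFin \o F) \_ (A `*` B).
have mAB : measurable (A `*` B) by exact: measurableX.
have imf : (m1 \x m2)%E.-integrable setT f by apply/(integrable_mkcond _ mAB).
have ae1 : {ae m2, forall y, B y -> m1.-integrable A (EFin \o (fun x => F (x, y)))}.
  apply: filterS (ae_integrable2 imf) => y + By.
  rewrite (_ : (fun x => f (x, y)) = (EFin \o (fun x => F (x, y))) \_ A); last first.
    by apply/funext => x; rewrite /f restrE /patch (mem_set By).
  by move/(integrable_mkcond _ mA).
have FE y : (\int[m1]_x f (x, y) = ((fun y => \int[m1]_(x in A) (F (x, y))%:E) \_ B) y)%E.
  rewrite [RHS]/patch; case: ifPn => yB.
    by rewrite [RHS]integral_mkcond; apply: eq_integral => x _; rewrite /f restrE /patch yB.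
  by apply: integral0_eq => x _; rewrite /f restrE /patch (negbTE yB) if_same.
have iG : m2.-integrable B (fun y => \int[m1]_(x in A) (F (x, y))%:E)%E.
  apply/(integrable_mkcond _ mB).
  rewrite (_ : _ \_ _ = (fun y => \int[m1]_x f (x, y))%E); last by apply/funext => y; rewrite FE.
  apply/integrableP; split; first exact: (measurable_fubini_G imf).
  have mf := measurable_int _ imf.
  have lty := (@integrable21ltyP _ _ _ _ _ m1 m2 f mf).1 imf.
  apply: le_lt_trans lty.
  apply: ge0_le_integral => //.
  - by apply: measurableT_comp => //; exact: (measurable_fubini_G imf).
  - apply: (measurable_fun_fubini_tonelli_G (abse \o f)) => //=.
    exact: measurableT_comp.
  - move=> y _; apply: le_abse_integral => //.
    by apply: measurableT_comp.
have [iR ER] := integrable_fine mB iG.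
split=> //; rewrite [RHS]ER [LHS]/Rintegral; congr fine.
rewrite integral_mkcond -/f -(integral21_prod_meas1 imf) [RHS]integral_mkcond.
by apply: eq_integral => y _; exact: FE.
Qed.

End RectFubini.

(** * The fundamental lemma on a cylinder *)

Section PlaneZero.
Context {R : realType}.
Notation mu := (@lebesgue_measure R).
Notation mu2 := (mu \x mu)%E.
Implicit Types (f g : R -> R) (T a b c x y : R).

Lemma measurable_tensor (D : set (R * R)) (a b : R -> R) : continuous a -> continuous b ->
  measurable_fun D (fun z => a z.1 * b z.2).
Proof.
move=> ca cb; apply: measurable_funM; apply: measurable_funTS.
  apply: (measurableT_comp (f := a)); last exact: measurable_fst.
  exact: continuous_measurable_fun.
apply: (measurableT_comp (f := b)); last exact: measurable_snd.
exact: continuous_measurable_fun.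
Qed.

Lemma sin_pi_gt0 x : 0 < x -> x < 1 -> 0 < sin (pi * x).
Proof.
move=> x0 x1; have pi0 : 0 < pi :> R := pi_gt0 R.
by apply: sin_gt0_pi; rewrite mulr_gt0//= gtr_pMr.
Qed.

(** Each sine changes sign under h |-> h + 1, so that the product is 1-periodic;
    between 0 and 1 it has the sign of x - y. *)
Definition circ y x : R := sin (pi * (x - y)) * sin (pi * (1 - x)).

Lemma smooth_circ y : smooth (circ y).
Proof.
apply: smoothM.
  rewrite (_ : (fun x => _) = sin \o (fun x => pi * x + - (pi * y))).
    by apply: smooth_comp; [exact: smooth_sin|exact: smooth_affine].
  by apply/funext => x /=; rewrite mulrBr.
rewrite (_ : (fun x => _) = sin \o (fun x => - pi * x + pi)).
  by apply: smooth_comp; [exact: smooth_sin|exact: smooth_affine].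
by apply/funext => x /=; rewrite mulrBr mulr1 addrC mulNr.
Qed.

Lemma circ_periodic y x : circ y (x + 1) = circ y x.
Proof.
rewrite /circ.
have -> : pi * (x + 1 - y) = pi * (x - y) + pi by ring.
have -> : pi * (1 - x) = pi * (1 - (x + 1)) + pi by ring.
by rewrite !sinDpi mulNr mulrN.
Qed.

Lemma circ_gt0 y x : 0 <= y -> y < 1 -> 0 < x -> x < 1 -> (0 < circ y x)%R = (y < x)%R.
Proof.
move=> y0 y1 x0 x1; rewrite /circ pmulr_lgt0; last by apply: sin_pi_gt0; lra.
have [yx|xy] := ltP y x; first by apply: sin_pi_gt0; lra.
apply/negbTE; rewrite -leNgt.
have -> : pi * (x - y) = - (pi * (y - x)) by ring.
rewrite sinN oppr_le0; move: xy; rewrite le_eqVlt => /predU1P[->|xy].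
  by rewrite subrr mulr0 sin0.
by apply/ltW; apply: sin_pi_gt0; lra.
Qed.

(** The whole line is included so that one factor of a rectangle can be left
    free. *)
Let rays : set (set R) := [set setT] `|` @RGenOInfty.G R.

Lemma rays_approx (A : set R) : rays A -> exists2 a : nat -> R -> R,
  (forall n, smooth (a n)) /\ (forall n x, `|a n x| <= 1) &
  forall x, a n x @[n --> \oo] --> (\1_A x : R).
Proof.
move=> [->|[c ->]].
  exists (fun _ => cst 1); first by split=> [n|n x]; [exact: smooth_cst|rewrite normr1].
  by move=> x; rewrite indicE in_setT; exact: cvg_cst.
exists (fun n x => flat 0 (n%:R * (x - c))).
  split=> [n|n x]; last by rewrite ger0_norm ?flat_ge0// flat0_le1.
  rewrite (_ : (fun x => _) = flat 0 \o (fun x => n%:R * x + - (n%:R * c))).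
    by apply: smooth_comp; [exact: smooth_flat|exact: smooth_affine].
  by apply/funext => x /=; rewrite mulrBr.
move=> x; have := @cvg_flat0 R (x - c); congr (_ --> _).
by rewrite indicE mem_setE in_itv/= andbT subr_gt0.
Qed.

(** Test functions on the cylinder have to be periodic in h, hence the use of
    [circ] to separate the points after c from those before. *)
Lemma rays_approx_periodic (B : set R) : rays B -> exists2 b : nat -> R -> R,
  [/\ forall n, smooth (b n), forall n x, `|b n x| <= 1 & forall n x, b n (x + 1) = b n x] &
  forall x, 0 < x < 1 -> b n x @[n --> \oo] --> (\1_B x : R).
Proof.
move=> [->|[c ->]].
  exists (fun _ => cst 1); first by split=> // [n|n x]; [exact: smooth_cst|rewrite normr1].
  by move=> x _; rewrite indicE in_setT; exact: cvg_cst.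
have [c0|c0] := ltP c 0.
  exists (fun _ => cst 1); first by split=> // [n|n x]; [exact: smooth_cst|rewrite normr1].
  move=> x /andP[x0 x1]; rewrite indicE mem_setE in_itv/= andbT (lt_trans c0 x0).
  exact: cvg_cst.
have [c1|c1] := leP 1 c.
  exists (fun _ => cst 0); first by split=> // [n|n x]; [exact: smooth_cst|rewrite normr0].
  move=> x /andP[x0 x1]; rewrite indicE mem_setE in_itv/= andbT ltNge (le_trans (ltW x1) c1).
  exact: cvg_cst.
exists (fun n x => flat 0 (n%:R * circ c x)).
  split=> [n|n x|n x]; last by rewrite circ_periodic.
    apply: (@smooth_comp _ _ (flat 0)); first exact: smooth_flat.
    exact: smoothZ (smooth_circ c).
  by rewrite ger0_norm ?flat_ge0// flat0_le1.
move=> x /andP[x0 x1]; have := @cvg_flat0 R (circ c x); congr (_ --> _).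
by rewrite indicE mem_setE in_itv/= andbT circ_gt0.
Qed.

Lemma rays_setI : setI_closed rays.
Proof.
move=> A B [->|[x ->]]; first by rewrite setTI.
move=> [->|[y ->]]; first by rewrite setIT; right; exists x.
right; exists (Num.max x y); apply/seteqP; split => z /=; rewrite !in_itv/= !andbT gt_max.
  by move=> [-> ->].
by move=> /andP[-> ->].
Qed.

Lemma rays_measurable : @measurable _ R = <<s rays >>.
Proof.
apply/seteqP; split.
  apply: (@subset_trans _ (<<s @RGenOInfty.G R >>)).
    have E : @measurable _ R = <<s @RGenOInfty.G R >> := RGenOInfty.measurableE R.
    by move=> A mA; rewrite -E.
  by apply: sub_sigma_algebra2 => A; right.
apply: smallest_sub; first exact: sigma_algebra_measurable.
by move=> A [->|[x ->]] //; exact: measurable_itv.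
Qed.

(** The integral of v vanishes over products of two rays; the pi-lambda theorem
    extends this to Borel sets in the first factor, then in the second factor,
    and finally to all Borel sets of the plane. *)
Lemma fundamental_cylinder T (v : R * R -> R) :
  mu2.-integrable (`]0, T[ `*` `]0, 1[) (EFin \o v) ->
  (forall a b : R -> R, smooth a -> smooth b -> (forall x, b (x + 1) = b x) ->
    \int[mu2]_(z in `]0, T[ `*` `]0, 1[) (v z * (a z.1 * b z.2)) = 0) ->
  {ae mu2, forall z, (`]0, T[ `*` `]0, 1[) z -> v z = 0}.
Proof.
set X := `]0, T[ `*` `]0, 1[; move=> iv H.
have mX : measurable X by exact: measurableX.
have rmeas (A : set R) : rays A -> measurable A.
  by move=> rA; rewrite rays_measurable; exact: sub_sigma_algebra.
have K0 (A B : set R) : rays A -> rays B -> \int[mu2]_(z in X `&` (A `*` B)) v z = 0.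
  move=> rA rB; have [a [sa a1] ca] := rays_approx rA.
  have [b [sb b1 pb] cb] := rays_approx_periodic rB.
  apply: (@Rintegral_indic_lim0 _ _ _ mu2 _ _ _ (fun n z => a n z.1 * b n z.2)) => //.
  - by apply: measurableX; exact: rmeas.
  - by move=> n; apply: measurable_tensor; exact: smooth_continuous.
  - move=> [t h] [/= _]; rewrite in_itv/= => h01.
    rewrite (_ : \1_(A `*` B) (t, h) = \1_A t * \1_B h :> R); last first.
      rewrite !indicE -natrM mulnb; congr (nat_of_bool _)%:R.
      by apply/idP/andP => [/set_mem[? ?]|[/set_mem ? /set_mem ?]]; [split|]; exact/mem_set.
    by apply: cvgM; [exact: ca|exact: cb].
  - by move=> z n _; rewrite normrM; apply: mulr_ile1; rewrite ?normr_ge0 ?a1 ?b1.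
  - move=> n; apply: H; [exact: sa|exact: sb|exact: pb].
have rT : rays setT by left.
have iS (Y : set (R * R)) : measurable Y -> Y `<=` X -> mu2.-integrable Y (EFin \o v).
  by move=> mY YX; exact: integrableS iv.
have mfst (A : set R) : measurable A -> measurable (fst @^-1` A : set (R * R)).
  by move=> mA; rewrite -[Y in measurable Y]setTI; exact: measurable_fst.
have msnd (A : set R) : measurable A -> measurable (snd @^-1` A : set (R * R)).
  by move=> mA; rewrite -[Y in measurable Y]setTI; exact: measurable_snd.
have K1 (A B : set R) : measurable A -> rays B -> \int[mu2]_(z in X `&` (A `*` B)) v z = 0.
  move=> mA rB.
  have E (C : set R) : X `&` (C `*` B) = (X `&` snd @^-1` B) `&` fst @^-1` C.
    by apply/seteqP; split => z /=; [move=> [? [? ?]]|move=> [[? ?] ?]].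
  rewrite E; apply: (@Rintegral_setI_pi _ _ _ mu2 _ _ fst rays) => //.
  - exact: rays_setI.
  - exact: rays_measurable.
  - by apply: measurableI => //; exact: (msnd _ (rmeas _ rB)).
  - by apply: iS; [apply: measurableI => //; exact: (msnd _ (rmeas _ rB))|exact: subIsetl].
  - have := K0 _ _ rT rB; rewrite E preimage_setT setIT; exact.
  - by move=> C rC; rewrite -E; exact: K0.
have K2 (A B : set R) : measurable A -> measurable B -> \int[mu2]_(z in X `&` (A `*` B)) v z = 0.
  move=> mA mB.
  have E (C : set R) : X `&` (A `*` C) = (X `&` fst @^-1` A) `&` snd @^-1` C.
    by apply/seteqP; split => z /=; [move=> [? [? ?]]|move=> [[? ?] ?]].
  rewrite E; apply: (@Rintegral_setI_pi _ _ _ mu2 _ _ snd rays) => //.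
  - exact: rays_setI.
  - exact: rays_measurable.
  - by apply: measurableI => //; exact: (mfst _ mA).
  - by apply: iS; [apply: measurableI => //; exact: (mfst _ mA)|exact: subIsetl].
  - have := K1 _ _ mA rT; rewrite E preimage_setT setIT; exact.
  - by move=> C rC; rewrite -E; exact: K1.
apply: (@Rintegral_setI_ae0 _ _ _ mu2) => // A mA.
apply: (@Rintegral_setI_pi _ _ _ mu2 _ _ id [set A1 `*` A2 | A1 in measurable & A2 in measurable]) => //.
- move=> _ _ [A1 mA1 [A2 mA2 <-]] [B1 mB1 [B2 mB2 <-]].
  exists (A1 `&` B1); first exact: measurableI.
  exists (A2 `&` B2); first exact: measurableI.
  by rewrite setXI.
- exact: measurable_prod_measurableType.
- by have := K2 setT setT measurableT measurableT; rewrite setXTT setIT.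
- by move=> _ [A1 mA1 [A2 mA2 <-]]; exact: K2.
Qed.

End PlaneZero.

(** * Continuity on the space-time strip *)

Section StripContinuity.
Context {R : realType}.
Implicit Types (T a b c x y t h : R).

Lemma ler_cube a b : 0 <= a -> 0 <= b -> (a ^+ 3 <= b ^+ 3) = (a <= b).
Proof. by move=> a0 b0; rewrite ler_pXn2r. Qed.

Lemma normr_sub_cube a b : 0 <= a -> 0 <= b -> `|a - b| ^+ 3 <= `|a ^+ 3 - b ^+ 3|.
Proof.
wlog ab : a b / b <= a.
  move=> W a0 b0; have [ba|/ltW ab] := leP b a; first exact: W.
  by rewrite distrC [leRHS]distrC; exact: W.
move=> a0 b0; rewrite !ger0_norm ?subr_ge0 ?ler_cube//.
rewrite -subr_ge0.
have -> : a ^+ 3 - b ^+ 3 - (a - b) ^+ 3 = 3 * (a * b * (a - b)) by ring.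
by rewrite !mulr_ge0// subr_ge0.
Qed.

(** The cube root is Hoelder continuous: this transfers the uniform continuity of
    u^3 to u. *)
Lemma cube_close a b (e : R) : 0 <= a -> 0 <= b -> 0 <= e ->
  `|a ^+ 3 - b ^+ 3| <= e ^+ 3 -> `|a - b| <= e.
Proof.
move=> a0 b0 e0 H; rewrite -ler_cube//.
exact: le_trans (normr_sub_cube a0 b0) H.
Qed.

Variables (T : R) (w : R * R -> R).
Hypothesis cw : {within `[0, T] `*` setT, continuous w}.

Lemma strip_eps t h (e : R) : t \in `[0, T] -> 0 < e -> exists2 d : R, 0 < d &
  forall t' h', t' \in `[0, T] -> `|t - t'| < d -> `|h - h'| < d -> `|w (t, h) - w (t', h')| < e.
Proof.
move=> t0 e0; have /subspace_continuousP := cw.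
move=> /(_ (t, h)) /(_ (conj t0 I)) /cvgrPdist_lt /(_ e e0).
rewrite near_withinE => /nbhs_ballP [d /= d0 H]; exists d => // t' h' t'0 tt hh.
by apply: H; [split|split].
Qed.

Lemma slice_continuous t : t \in `[0, T] -> continuous (fun h => w (t, h)).
Proof.
move=> t0 h; apply/cvgrPdist_lt => e e0; have [d d0 H] := strip_eps h t0 e0.
near=> h'; apply: H; [by []|by rewrite subrr normr0|].
by near: h'; exists d.
Unshelve. all: end_near. Qed.

Hypothesis pw : hperiodic `[0, T] w.

Lemma hper_int t (n : int) h : t \in `[0, T] -> w (t, h + n%:~R) = w (t, h).
Proof.
by move=> t0; apply: (@periodicz _ (fun h => w (t, h))) => x; exact: pw.
Qed.

(** Compactness of one period, extended to the strip by periodicity. *)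
Lemma strip_unif (e : R) : 0 < e -> exists2 d : R, 0 < d &
  forall t t' h, t \in `[0, T] -> t' \in `[0, T] -> `|t - t'| < d ->
    `|w (t, h) - w (t', h)| < e.
Proof.
move=> e0; have cK : compact (`[0, T] `*` `[0, 1] : set (R * R)).
  by apply: compact_setX; exact: segment_compact.
move/compact_near_coveringP/near_covering_withinP : cK.
move=> /(_ nat \oo (fun n z => forall t', t' \in `[0, T] -> `|z.1 - t'| < n.+1%:R^-1 ->
   `|w z - w (t', z.2)| < e) _).
case=> [|N _ HN]; [move=> [t h] [/= t0 h0]|].
  have e20 : 0 < e / 2 by rewrite divr_gt0.
  have [d d0 H] := strip_eps h t0 e20.
  have d20 : 0 < d / 2 by rewrite divr_gt0.
  near=> z n => -[z1 z2] t' t'0 zt'.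
  have n1 : n.+1%:R^-1 < d / 2 by near: n; exact: (near_infty_natSinv_lt (PosNum d20)).
  have zb : ball (t, h) (d / 2) z by near: z; apply: nbhsx_ballx; rewrite divr_gt0.
  case: zb => /= zb1 zb2.
  have {}zb1 : `|t - z.1| < d / 2 by exact: zb1.
  have {}zb2 : `|h - z.2| < d / 2 by exact: zb2.
  have dd : d / 2 < d by lra.
  have z1' : z.1 \in `[0, T] by exact: z1.
  have A1 : `|w (t, h) - w (z.1, z.2)| < e / 2 by apply: H => //; [exact: lt_trans zb1 dd|exact: lt_trans zb2 dd].
  have A2 : `|w (t, h) - w (t', z.2)| < e / 2.
    apply: H => //; last exact: lt_trans zb2 dd.
    apply: le_lt_trans (ler_distD z.1 t t') _; rewrite (splitr d).
    by apply: ltrD => //; exact: lt_trans zt' n1.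
  rewrite [w z](_ : _ = w (z.1, z.2)); last by case: (z).
  apply: le_lt_trans (ler_distD (w (t, h)) (w (z.1, z.2)) (w (t', z.2))) _.
  by rewrite (distrC (w (z.1, z.2)) (w (t, h))) (splitr e) ltrD.
exists N.+1%:R^-1; first by rewrite invr_gt0.
move=> t t' h t0 t'0 tt'.
have -> : h = (h - (Num.floor h)%:~R) + (Num.floor h)%:~R by rewrite subrK.
rewrite !hper_int//; apply: (HN N (leqnn N) (t, h - (Num.floor h)%:~R)) => //.
split => //=; rewrite in_itv/= subr_ge0 ge_floor/= lerBlDl -intrD1.
by apply/ltW; rewrite floorD1_gt.
Unshelve. all: end_near. Qed.

Lemma strip_max : 0 <= T -> exists t0 h0, t0 \in `[0, T] /\
  forall t h, t \in `[0, T] -> w (t, h) <= w (t0, h0).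
Proof.
move=> T0; have cK : compact (`[0, T] `*` `[0, 1] : set (R * R)).
  by apply: compact_setX; exact: segment_compact.
have K0 : (`[0, T] `*` `[0, 1] : set (R * R)) !=set0.
  by exists (0, 0); split => /=; rewrite in_itv/= lexx/= ?ler01 ?T0.
have cwK : {within `[0, T] `*` `[0, 1], continuous w}.
  by apply: continuous_subspaceW cw => z [? _]; split.
have [[t0 h0] + H] := compact_EVT_max K0 cK cwK.
rewrite inE => -[/= t00 _]; exists t0, h0; split => // t h tT.
have [y /andP[y0 y1] ->] := @periodic_repr _ (fun h => w (t, h)) (fun x => pw x tT) h.
by apply: H; rewrite inE; split => //=; rewrite in_itv/= y0 ltW.
Qed.

End StripContinuity.

(** * The equation almost everywhere *)

Section PlaneTools.
Context {R : realType}.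
Notation mu := (@lebesgue_measure R).
Notation mu2 := (mu \x mu)%E.
Implicit Types (T a b c d x y t h : R).

Lemma continuous_bounded_itv (f : R -> R) a b : {within `[a, b], continuous f} ->
  exists2 M : R, 0 <= M & forall x, x \in `[a, b] -> `|f x| <= M.
Proof.
move=> cf; have [ab|ba] := leP a b; last first.
  by exists 0 => // x; rewrite in_itv/= => /andP[ax xb]; have := le_trans ax xb; rewrite leNgt ba.
have cn : {within `[a, b], continuous (fun x => `|f x|)}.
  by move=> x; apply: (continuous_comp (cf x)); exact: norm_continuous.
have [c _ H] := EVT_max ab cn.
by exists `|f c|.
Qed.

Lemma box_integrable (O : set (R * R)) f a b c d : measurable O -> locally_integrable2 O f ->
  `[a, b] `*` `[c, d] `<=` O -> mu2.-integrable (`[a, b] `*` `[c, d]) (EFin \o f).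
Proof.
move=> mO [mf oO H] sub; have mK : measurable (`[a, b] `*` `[c, d] : set (R * R)) by exact: measurableX.
apply/integrableP; split.
  apply/measurable_EFinP => mK' Y mY.
  have := mf mO Y mY; move=> /(measurableI _ _ mK); rewrite setIA (setIidl sub).
  exact.
by apply: H => //; apply: compact_setX; exact: segment_compact.
Qed.

Lemma sq_integrable (disp : measure_display) (S : measurableType disp) (m : {measure set S -> \bar R}) (D : set S) (f : S -> R) :
  measurable D -> measurable_fun D f -> (m D < +oo)%E ->
  (\int[m]_(z in D) ((f z ^+ 2)%:E) < +oo)%E ->
  m.-integrable D (EFin \o (fun z => f z ^+ 2)) /\ m.-integrable D (EFin \o f).
Proof.
move=> mD mf Dfin f2.
have i2 : m.-integrable D (EFin \o (fun z => f z ^+ 2)).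
  apply/integrableP; split; first exact/measurable_EFinP/measurable_funX.
  by move: f2; congr (_ < _)%E; apply: eq_integral => x _ /=; rewrite ger0_norm// sqr_ge0.
split => //.
have i1 : m.-integrable D (EFin \o (fun z => 1 + f z ^+ 2)).
  have ic : m.-integrable D (EFin \o (fun=> 1 : R)).
    apply/integrableP; split; first exact/measurable_EFinP.
    by rewrite (eq_integral (cst 1%:E)) ?integral_cst ?mul1e// => x _ /=; rewrite normr1.
  exact: (integrableD mD ic i2).
apply: le_integrable i1 => //; first exact/measurable_EFinP.
move=> x _ /=; rewrite lee_fin [leRHS]ger0_norm ?addr_ge0 ?sqr_ge0//.
rewrite -(real_normK (num_real (f x))) -subr_ge0.
set q := `|f x|.
have -> : 1 + q ^+ 2 - q = (q - 2^-1) ^+ 2 + 3 / 4 by field.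
by rewrite addr_ge0 ?sqr_ge0// divr_ge0.
Qed.

Lemma cell_bnd (F : R * R -> R) (i : interval R) : measurable_fun ([set` i] `*` `[0, 1] : set (R * R)) F ->
  \int[mu2]_(z in [set` i] `*` `[0, 1]) F z = \int[mu2]_(z in [set` i] `*` `]0, 1[) F z.
Proof.
move=> mF; have mXc : measurable ([set` i] `*` `[0, 1] : set (R * R)) by exact: measurableX.
have mX : measurable ([set` i] `*` `]0, 1[ : set (R * R)) by exact: measurableX.
have sub : [set` i] `*` `]0, 1[ `<=` ([set` i] `*` `[0, 1] : set (R * R)).
  by move=> [t h] [/= t1 h1]; split => //=; exact: subset_itv_oo_cc h1.
set Xc := ([set` i] `*` `[0, 1] : set (R * R)) in mF mXc sub *.
set Xo := ([set` i] `*` `]0, 1[ : set (R * R)) in mX sub *.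
transitivity (\int[mu2]_(z in Xc `&` Xo) F z); last by rewrite (setIidr sub).
rewrite [RHS]Rintegral_mul_indic.
apply: (@Rintegral_ae_eq _ _ _ mu2 Xc F (fun z => F z * \1_Xo z)) => //.
  by apply: measurable_funM => //; apply: measurable_funTS; exact: measurable_indic.
exists (setT `*` ([set 0] `|` [set 1])); split.
- by apply: measurableX => //; apply: measurableU.
- have mN : measurable ([set 0] `|` [set 1] : set R) by exact: measurableU.
  have Z : ((mu \x mu) (setT `*` ([set 0%R] `|` [set 1%R])) = 0)%E.
    have N0 : mu ([set 0%R] `|` [set 1%R]) = 0%E.
      by rewrite null_set_setU//; exact: lebesgue_measure_set1.
    rewrite product_measure1E//; transitivity (mu setT * 0)%E; last exact: mule0.
    by congr (_ * _)%E.
  exact: Z.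
- move=> [t h] /= /not_implyP[[/= t0 h01] H]; split => //.
  have /andP[h0 h1] : 0 <= h <= 1 by move: h01; rewrite /= in_itv.
  apply: contrapT => /not_orP[/eqP n0 /eqP n1]; apply: H.
  rewrite indicE mem_set ?mulr1//; split => //=.
  by rewrite in_itv/= !lt_neqAle h0 h1 n1 eq_sym n0.
Qed.

Lemma iterD_et_tensor (a b : R -> R) : smooth a -> smooth b ->
  iterD (nseq 1 et) (fun z : R * R => a z.1 * b z.2) = (fun z => 'D_1 a z.1 * b z.2).
Proof. by move=> sa sb; apply/funext => z; exact: derive_et_tensor. Qed.

End PlaneTools.

Section WeakSolution.
Context {R : realType}.
Notation mu := (@lebesgue_measure R).
Notation mu2 := (mu \x mu)%E.
Variables (T : R) (u0 : R -> R) (u ut g : R * R -> R).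
Hypothesis T0 : 0 < T.
Hypothesis ws : weak_solution_with T u0 u ut g.
Implicit Types (a b c d t h x y : R).

Let strip : set (R * R) := `]0, T[ `*` setT.
Let X : set (R * R) := `]0, T[ `*` `]0, 1[.
Let w := cube u.

Lemma ws_w_periodic : hperiodic `[0, T] w.
Proof. by move=> t h tT; rewrite /w /cube (ws_periodic ws). Qed.

Lemma measurable_strip : measurable strip.
Proof. exact: measurableX. Qed.

Lemma measurable_X : measurable X.
Proof. exact: measurableX. Qed.

Lemma ws_u_loc : locally_integrable2 strip u.
Proof. by case: (ws_t ws). Qed.

Lemma ws_ut_loc : locally_integrable2 strip ut.
Proof. by case: (ws_t ws). Qed.

Lemma measurable_PTper : measurable (PTper T u).
Proof.
have [mu_ _ _] := ws_u_loc.
have := mu_ measurable_strip (~` [set 0]) (measurableC (measurable_set1 0)).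
congr measurable; apply/seteqP; split => -[t h] /=.
  by move=> [[t0 _] /eqP u1]; split => //; move: t0; rewrite /= in_itv.
by move=> [t0 /eqP]; split => //; split => //; rewrite /= in_itv.
Qed.

Lemma PT_sub : PT T u `<=` X.
Proof. by move=> [t h] [/= t0 h0 _]; split; rewrite /= in_itv. Qed.

Lemma PT_PTper : PT T u = PTper T u `&` X.
Proof.
apply/seteqP; split => -[t h] /=.
  by move=> H; split; [case: H|exact: PT_sub].
by move=> [[/= t0 u1] [_ /=]]; rewrite in_itv/=.
Qed.

Lemma measurable_PT : measurable (PT T u).
Proof. by rewrite PT_PTper; apply: measurableI; [exact: measurable_PTper|exact: measurable_X]. Qed.

Lemma X_finite : (mu2 X < +oo)%E.
Proof.
rewrite product_measure1E//= !lebesgue_measure_itv/= !lte_fin T0 ltr01.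
by rewrite -!EFinD -EFinM ltry.
Qed.

Lemma ws_ut_int : mu2.-integrable X (EFin \o (fun z => ut z ^+ 2)) /\ mu2.-integrable X (EFin \o ut).
Proof.
have [mut _ _] := ws_ut_loc.
have mX : measurable_fun X ut.
  by apply: measurable_funS mut; [exact: measurable_strip|move=> z [? _]; split].
apply: sq_integrable => //; [exact: measurable_X|exact: X_finite|].
apply: le_lt_trans (ws_t_L2 ws); apply: ge0_subset_integral => //.
- exact: measurable_X.
- exact: measurableX.
- apply/measurable_EFinP; apply: measurable_funX.
  by apply: measurable_funS mut; [exact: measurable_strip|move=> z [? _]; split].
- by move=> z _; rewrite lee_fin sqr_ge0.
- by move=> [t h] [/= t1 h1]; split => //=; exact: subset_itv_oo_cc h1.
Qed.

Lemma measurable_flux : measurable_fun (PT T u) (fun z => u z ^+ 2 * g z).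
Proof.
have [mu_ _ _] := ws_u_loc; have [_ [mg _ _] _] := ws_hhhh ws.
apply: measurable_funM.
  apply: measurable_funX; apply: measurable_funS mu_; first exact: measurable_strip.
  by move=> z /PT_sub [? _]; split.
apply: measurable_funS mg; first exact: measurable_PTper.
by rewrite PT_PTper; exact: subIsetl.
Qed.

Lemma ws_flux_int : mu2.-integrable (PT T u) (EFin \o (fun z => u z ^+ 2 * g z)).
Proof.
have fin : (mu2 (PT T u) < +oo)%E.
  apply: le_lt_trans X_finite; apply: le_measure; rewrite ?inE.
  - exact: measurable_PT.
  - exact: measurable_X.
  - exact: PT_sub.
by have [_] := sq_integrable (m := mu2) measurable_PT measurable_flux fin (ws_hhhh_L2 ws).
Qed.

(** By the weak formulation, u_t + u^2 (u^3)_hhhh, extended by 0 to the zero set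
    of u, is orthogonal to all periodic tensor products. *)
Lemma ws_equation_ae : {ae mu2, forall z, X z ->
  ut z + ((fun z => u z ^+ 2 * g z) \_ (PT T u)) z = 0}.
Proof.
set q := (fun z => u z ^+ 2 * g z); have [_ iut] := ws_ut_int.
have iq : mu2.-integrable X (EFin \o (q \_ (PT T u))).
  rewrite -restrict_EFin; have [H _] := integrable_restrict mu2 measurable_PT measurable_X (EFin \o q).
  apply: H; rewrite setIidr; [exact: ws_flux_int|exact: PT_sub].
have iv : mu2.-integrable X (EFin \o (fun z => ut z + (q \_ (PT T u)) z)).
  have mX := measurable_X.
  exact: (integrableD (mX : measurable (X : set (measurableTypeR R * measurableTypeR R))) iut iq).
apply: fundamental_cylinder => // a b sa sb pb.
have bd (f : R * R -> R) : mu2.-integrable X (EFin \o f) ->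
    mu2.-integrable X (EFin \o (fun z => f z * (a z.1 * b z.2))).
  move=> intf.
  have [M M0 HM] := continuous_bounded_itv (a := 0) (b := T) (continuous_subspaceT (smooth_continuous sa)).
  have [N N0 HN] := continuous_bounded_itv (a := 0) (b := 1) (continuous_subspaceT (smooth_continuous sb)).
  apply: (@integrableM_bounded _ _ _ mu2 _ _ _ (M * N)) => //; first exact: measurable_X.
    by apply: measurable_tensor; exact: smooth_continuous.
  move=> [t h] [/= t0 h0]; rewrite normrM ler_pM//; [apply: HM|apply: HN].
    by apply: subset_itv_oo_cc t0.
  by apply: subset_itv_oo_cc h0.
under eq_Rintegral do rewrite mulrDl.
rewrite RintegralD; [|exact: measurable_X|exact: bd|exact: bd].
have hp : hperiodic `[0, T] (fun z : R * R => a z.1 * b z.2).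
  by move=> t h _ /=; rewrite pb.
rewrite -[RHS](ws_weak ws (smooth_tensor sa sb) hp).
rewrite cell_bnd; last first.
  apply: measurable_funM; first by apply: measurable_tensor; exact: smooth_continuous.
  have [mut _ _] := ws_ut_loc.
  by apply: measurable_funS mut; [exact: measurable_strip|move=> z [? _]; split].
congr (_ + _); first by apply: eq_Rintegral => z _; rewrite mulrC.
transitivity (\int[mu2]_(z in X `&` PT T u) (a z.1 * b z.2 * q z)); last by rewrite (setIidr PT_sub).
rewrite [RHS]Rintegral_mkcondr; apply: eq_Rintegral => z _.
by rewrite /patch; case: ifPn => _; rewrite ?mul0r// mulrC.
Qed.

End WeakSolution.

(** * Dissipation of the energy and increments in time *)

Section BoxFubini.
Context {R : realType}.
Notation mu := (@lebesgue_measure R).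
Notation mu2 := (mu \x mu)%E.
Implicit Types (a b c d t h : R) (f : R * R -> R) (p q : R -> R).

Lemma measurable_seg a b : measurable (`[a, b]%classic : set (measurableTypeR R)).
Proof. exact: measurable_itv. Qed.

Lemma box_integrableM f a b c d p q :
  mu2.-integrable (`[a, b] `*` `[c, d]) (EFin \o f) -> continuous p -> continuous q ->
  mu2.-integrable (`[a, b] `*` `[c, d]) (EFin \o (fun z => f z * (p z.1 * q z.2))).
Proof.
move=> iF cp cq; have mK : measurable (`[a, b] `*` `[c, d] : set (R * R)) by exact: measurableX.
have cp' : {within `[a, b], continuous p} by exact: continuous_subspaceT.
have cq' : {within `[c, d], continuous q} by exact: continuous_subspaceT.
have [M M0 HM] := continuous_bounded_itv cp'.
have [N N0 HN] := continuous_bounded_itv cq'.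
apply: (@integrableM_bounded _ _ _ mu2 _ _ _ (M * N)) => //.
- exact: measurable_tensor.
- by move=> [t h] [/= t0 h0]; rewrite normrM ler_pM//; [exact: HM|exact: HN].
Qed.

Lemma box_fubini_tensor f a b c d p q :
  mu2.-integrable (`[a, b] `*` `[c, d]) (EFin \o f) -> continuous p -> continuous q ->
  mu.-integrable `[a, b] (EFin \o (fun t => \int[mu]_(h in `[c, d]) (f (t, h) * q h))) /\
  \int[mu2]_(z in `[a, b] `*` `[c, d]) (f z * (p z.1 * q z.2)) =
  \int[mu]_(t in `[a, b]) ((\int[mu]_(h in `[c, d]) (f (t, h) * q h)) * p t).
Proof.
move=> iF cp cq.
have i1 : mu2.-integrable (`[a, b] `*` `[c, d]) (EFin \o (fun z => f z * q z.2)).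
  have := box_integrableM iF (@cst_continuous R R 1) cq.
  by apply: eq_integrable => [|z _ /=]; [exact: measurableX|rewrite mul1r].
have [ae1 iV _] := rect_fubini1 (measurable_seg a b) (measurable_seg c d) i1.
have [_ iV2 ->] := rect_fubini1 (measurable_seg a b) (measurable_seg c d) (box_integrableM iF cp cq).
split => //.
have cp' : {within `[a, b], continuous p} by exact: continuous_subspaceT.
have iVp := integrableM_cont iV cp'.
apply: Rintegral_ae_eq => //.
- exact: (measurable_EFinP _ _).1 (measurable_int _ iV2).
- exact: (measurable_EFinP _ _).1 (measurable_int _ iVp).
apply: ae_imply ae1 => t H tab; rewrite -RintegralZr//; last exact: H.
by apply: eq_Rintegral => h _ /=; rewrite mulrA mulrAC.
Qed.

Lemma box_fubini_swap f a b c d q :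
  mu2.-integrable (`[a, b] `*` `[c, d]) (EFin \o f) -> continuous q ->
  mu.-integrable `[c, d] (EFin \o (fun h => \int[mu]_(t in `[a, b]) f (t, h))) /\
  \int[mu]_(t in `[a, b]) (\int[mu]_(h in `[c, d]) (f (t, h) * q h)) =
  \int[mu]_(h in `[c, d]) ((\int[mu]_(t in `[a, b]) f (t, h)) * q h).
Proof.
move=> iF cq.
have i1 : mu2.-integrable (`[a, b] `*` `[c, d]) (EFin \o (fun z => f z * q z.2)).
  have := box_integrableM iF (@cst_continuous R R 1) cq.
  by apply: eq_integrable => [|z _ /=]; [exact: measurableX|rewrite mul1r].
have [ae1 iV _] := rect_fubini2 (measurable_seg a b) (measurable_seg c d) iF.
have [_ _ <-] := rect_fubini1 (measurable_seg a b) (measurable_seg c d) i1.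
have [_ iV2 ->] := rect_fubini2 (measurable_seg a b) (measurable_seg c d) i1.
split => //.
have cq' : {within `[c, d], continuous q} by exact: continuous_subspaceT.
have iVq := integrableM_cont iV cq'.
apply: Rintegral_ae_eq => //.
- exact: (measurable_EFinP _ _).1 (measurable_int _ iV2).
- exact: (measurable_EFinP _ _).1 (measurable_int _ iVq).
by apply: ae_imply ae1 => h H hcd; rewrite -RintegralZr//; exact: H.
Qed.

End BoxFubini.

Section TimeIdentity.
Context {R : realType}.
Notation mu := (@lebesgue_measure R).
Notation mu2 := (mu \x mu)%E.
Variables (T : R) (u0 : R -> R) (u ut g : R * R -> R).
Hypothesis T0 : 0 < T.
Hypothesis ws : weak_solution_with T u0 u ut g.
Implicit Types (a b c d t h x y e : R).

Let X : set (R * R) := `]0, T[ `*` `]0, 1[.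
Let w := cube u.

Lemma ws_u_unif e : 0 < e -> exists2 d : R, 0 < d &
  forall t t' h, t \in `[0, T] -> t' \in `[0, T] -> `|t - t'| < d ->
    `|u (t, h) - u (t', h)| <= e.
Proof.
move=> e0; have [d d0 H] := strip_unif (ws_continuous ws) (ws_w_periodic ws) (exprn_gt0 3 e0).
exists d => // t t' h tT t'T td; apply: cube_close; [exact: (ws_ge0 ws)..|exact: ltW|].
exact/ltW/(H t t' h).
Qed.

Lemma ws_w_slice t : t \in `[0, T] -> continuous (fun h => w (t, h)).
Proof. exact: (slice_continuous (ws_continuous ws)). Qed.

Lemma ws_u_slice t : t \in `[0, T] -> continuous (fun h => u (t, h)).
Proof.
move=> tT h; apply/cvgrPdist_le => e e0.
have /cvgrPdist_le /(_ _ (exprn_gt0 3 e0)) H := @ws_w_slice t tT h.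
near=> h'; apply: cube_close; [exact: (ws_ge0 ws)..|exact: ltW|].
by near: h'; exact: H.
Unshelve. all: end_near. Qed.

Lemma energyE_ge0 (f : R -> R) : (0 <= energyE f)%E.
Proof.
rewrite /energyE; case: ifP => // _; apply: integral_ge0 => x _.
by rewrite lee_fin mulr_ge0// sqr_ge0.
Qed.

Lemma energyF_ge0 (f : R -> R) : (0 <= energyF f)%E.
Proof.
rewrite /energyF mule_ge0 ?lee_fin//; apply: integral_ge0 => x _.
by rewrite lee_fin sqr_ge0.
Qed.

(** By the equation, the energy dissipated is the integral of u_t^2. *)
Lemma ws_dissipation (e0 : R) : (energyE (slice u 0) <= e0%:E)%E ->
  \int[mu2]_(z in X) (ut z ^+ 2) <= e0.
Proof.
move=> He; set q := fun z => u z ^+ 2 * g z.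
have [i2 _] := ws_ut_int T0 ws.
have [mut _ _] := ws_ut_loc ws.
have mX' : measurable_fun X ut.
  by apply: measurable_funS mut; [exact: measurable_strip|move=> z [? _]; split].
have E : (\int[mu2]_(z in X) ((ut z ^+ 2)%:E) = \int[mu2]_(z in PT T u) ((q z ^+ 2)%:E))%E.
  transitivity (\int[mu2]_(z in X) (((fun z => (q z ^+ 2)%:E) \_ (PT T u)) z))%E; last first.
    by rewrite -integral_mkcondr (setIidr (@PT_sub _ _ _)).
  apply: ge0_ae_eq_integral.
  - exact: measurable_X.
  - exact/measurable_EFinP/measurable_funX.
  - have [H _] := measurable_restrict (fun z => (q z ^+ 2)%:E) (measurable_PT ws) (measurable_X T).
    apply: H; rewrite (setIidr (@PT_sub _ _ _)).
    by apply/measurable_EFinP/measurable_funX; exact: measurable_flux ws.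
  - by move=> z _; rewrite lee_fin sqr_ge0.
  - by move=> z _; rewrite /patch; case: ifP => // _; rewrite lee_fin sqr_ge0.
  - have := ws_equation_ae T0 ws => -[N [mN N0 H]]; exists N; split => // z /= nH.
    apply: H => /= H; apply: nH => Xz; move: (H Xz); rewrite /patch -/q.
    case: ifP => _ /eqP; last by rewrite addr0 => /eqP ->; rewrite expr0n.
    by rewrite addr_eq0 => /eqP ->; rewrite sqrrN.
rewrite -lee_fin /Rintegral fineK; last first.
  by apply: integrable_fin_num => //; exact: measurable_X.
rewrite E; apply: le_trans He; apply: le_trans (ws_dissipE ws).
by rewrite -[leLHS]add0e leeD2r// energyE_ge0.
Qed.

Let strip_box a b c d : 0 < a -> b < T -> `[a, b] `*` `[c, d] `<=` (`]0, T[ `*` setT : set (R * R)).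
Proof.
move=> a0 bT [t h] [/= t1 _]; split => //=.
by move: t1; rewrite !in_itv/= => /andP[at_ tb]; rewrite (lt_le_trans a0 at_) (le_lt_trans tb bT).
Qed.

(** Tested against a smooth function of h, this is [weak_ftc] in time; the
    pointwise form follows by [fundamental_itv]. *)
Lemma ws_time_identity a b : 0 < a -> a <= b -> b < T ->
  {ae mu, forall h, h \in `[0, 1] ->
    u (b, h) - u (a, h) = \int[mu]_(t in `[a, b]) ut (t, h)}.
Proof.
move=> a0 ab bT.
have lu := ws_u_loc ws; have lut := ws_ut_loc ws.
have mS := @measurable_strip R T.
have inT t : 0 < t -> t < T -> t \in `[0, T] by move=> t0 tT; rewrite in_itv/= !ltW.
have iut a' b' c d : 0 < a' -> b' < T -> mu2.-integrable (`[a', b'] `*` `[c, d]) (EFin \o ut).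
  by move=> a'0 b'T; apply: (box_integrable mS lut); exact: strip_box.
have iu t : 0 < t -> t < T -> mu.-integrable `[0, 1] (EFin \o (fun h => u (t, h))).
  move=> t0 tT; apply: continuous_integrable_itv; apply: continuous_subspaceT.
  by apply: ws_u_slice; exact: inT.
have [ae1 iW _] := rect_fubini2 (measurable_seg a b) (measurable_seg 0 1) (iut a b 0 1 a0 bT).
have bT' : 0 < b by exact: lt_le_trans ab.
have aT : a < T by exact: le_lt_trans bT.
suff : {ae mu, forall h, h \in `[0, 1] ->
    (u (b, h) - u (a, h)) - \int[mu]_(t in `[a, b]) ut (t, h) = 0}.
  by apply: ae_imply => h H h01; apply/eqP; rewrite -subr_eq0; apply/eqP; exact: H.
have iD : mu.-integrable `[0, 1] (EFin \o (fun h => u (b, h) - u (a, h))).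
  exact: (integrableB _ (iu b bT' bT) (iu a a0 aT)).
apply: fundamental_itv; first exact: (integrableB _ iD iW).
move=> be sbe be0.
have cbe := smooth_continuous sbe.
have wbe : {within `[0, 1], continuous be} by exact: continuous_subspaceT.
have [M M0 HM] := continuous_bounded_itv wbe.
pose U t := \int[mu]_(h in `[0, 1]) (u (t, h) * be h).
pose V t := \int[mu]_(h in `[0, 1]) (ut (t, h) * be h).
have iub t : 0 < t -> t < T -> mu.-integrable `[0, 1] (EFin \o (fun h => u (t, h) * be h)).
  by move=> t0 tT; apply: integrableM_cont => //; exact: iu.
have FTC := @weak_ftc R 0 T U V.
have {}FTC : U b - U a = \int[mu]_(t in `[a, b]) V t.
  apply: FTC => //.
  - move=> t t0 tT; apply/cvgrPdist_le => e e0.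
    have e1 : 0 < e / (M + 1) by rewrite divr_gt0// ltr_wpDl.
    have [d d0 H] := ws_u_unif e1.
    near=> t'.
    have t'0 : 0 < t' by near: t'; exact: lt_nbhsr.
    have t'T : t' < T by near: t'; exact: lt_nbhsl.
    rewrite /U -RintegralB//; [|exact: iub..].
    have iB : mu.-integrable `[0, 1] (EFin \o (fun h => u (t, h) * be h - u (t', h) * be h)).
      exact: (integrableB _ (iub t t0 tT) (iub t' t'0 t'T)).
    apply: le_trans; first by apply: le_normr_Rintegral.
    apply: (@le_trans _ _ (\int[mu]_(h in `[0, 1]) e)); last first.
      by rewrite Rintegral_cst_itv// subr0 mulr1.
    apply: le_Rintegral => //.
    + exact: integrable_norm.
    + exact: integrable_cst_itv.
    + move=> h h01; rewrite -mulrBl normrM.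
      have -> : e = (e / (M + 1)) * (M + 1) by rewrite divfK// gt_eqF// ltr_wpDl.
      apply: ler_pM => //; last by rewrite (le_trans (HM h h01))// lerDl.
      apply: H; [exact: inT|exact: inT|].
      by near: t'; exists d.
  - move=> a' b' a'0 b'T.
    by have [] := box_fubini_tensor (iut a' b' 0 1 a'0 b'T) (@cst_continuous R R 1) cbe.
  - move=> a' b' phi a'0 b'T sphi phi0.
    have sub := @strip_box a' b' 0 1 a'0 b'T.
    have [_ _ D] := ws_t ws.
    have := D _ (test_function2 sphi sbe sub phi0 be0).
    rewrite expr1 mulN1r iterD_et_tensor//.
    have red (f : R * R -> R) (p : R -> R) : locally_integrable2 (`]0, T[ `*` setT) f ->
      smooth p -> (forall x, x \notin `[a', b'] -> p x = 0) ->
      \int[mu2]_(z in `]0, T[ `*` setT) (f z * (p z.1 * be z.2)) =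
      \int[mu]_(t in `[a', b']) ((\int[mu]_(h in `[0, 1]) (f (t, h) * be h)) * p t).
      move=> lf sp p0; transitivity (\int[mu2]_(z in `[a', b'] `*` `[0, 1]) (f z * (p z.1 * be z.2))).
        apply: Rintegral_supp => // -[t h] _ nz /=.
        have [t1|/p0 ->] := boolP (t \in `[a', b']); last by rewrite mul0r mulr0.
        have [h1|/be0 ->] := boolP (h \in `[0, 1]); last by rewrite !mulr0.
        by case: nz.
      have ibox := box_integrable mS lf sub.
      by have [_ ->] := box_fubini_tensor ibox (smooth_continuous sp) cbe.
    have dphi0 x : x \notin `[a', b'] -> 'D_1 phi x = 0 by exact: derive_supp.
    have r1 := red u ('D_1 phi) lu (smooth_derive (1 : R) sphi) dphi0.
    have r2 := red ut phi lut sphi phi0.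
    by move=> D'; rewrite -[LHS]r1 -r2.
have [_ E] := box_fubini_swap (iut a b 0 1 a0 bT) cbe.
have iWbe := integrableM_cont iW wbe.
have iDbe := integrableM_cont iD wbe.
transitivity (\int[mu]_(h in `[0, 1]) ((u (b, h) - u (a, h)) * be h) -
   \int[mu]_(h in `[0, 1]) ((\int[mu]_(t in `[a, b]) ut (t, h)) * be h)).
  by rewrite -RintegralB//; apply: eq_Rintegral => h _; rewrite mulrBl.
rewrite -E -FTC /U -RintegralB//; [|exact: iub..].
apply/eqP; rewrite subr_eq0; apply/eqP; apply: eq_Rintegral => h _.
by rewrite mulrBl.
Unshelve. all: end_near. Qed.

End TimeIdentity.

(** * Initial energies and times of bounded curvature *)

Section LowerIntegral.
Local Open Scope ereal_scope.
Context d (S : measurableType d) (R : realType) (m : {measure set S -> \bar R}).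
Import HBNNSimple.

(** The integral is a supremum over the simple functions below f, among which is
    c on A: this covers functions of unknown measurability, such as the energy
    as a function of time. *)
Lemma integral_ge_cst (A D : set S) (f : S -> \bar R) (c : R) : measurable A -> A `<=` D ->
  (0 <= c)%R -> (forall x, D x -> 0 <= f x) -> (forall x, A x -> c%:E <= f x) ->
  c%:E * m A <= \int[m]_(x in D) f x.
Proof.
move=> mA AD c0 f0 cf; rewrite ge0_integralE//.
apply: ereal_sup_ubound => /=.
exists (scale_nnsfun (indic_nnsfun R mA) c0); last by rewrite sintegralrM sintegral_indic.
move=> x /=; rewrite /patch.
have -> : mindic R mA x = (x \in A)%:R by rewrite -indicE.
case: ifPn => xD.
  have [xA|xA] := boolP (x \in A); first by rewrite mulr1; apply: cf; exact: set_mem.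
  by rewrite mulr0; apply: f0; exact: set_mem.
have -> : (x \in A) = false.
  by apply/negbTE; apply: contra xD => /set_mem xA; apply/mem_set; exact: AD.
by rewrite mulr0.
Qed.

End LowerIntegral.

Section Initial.
Context {R : realType}.
Notation mu := (@lebesgue_measure R).
Implicit Types (f g w v : R -> R).

Lemma continuous_locally_integrable f : continuous f -> locally_integrable setT f.
Proof.
move=> cf; split; [exact: continuous_measurable_fun|exact: openT|].
move=> K _ cK; have cfK : {within K, continuous f} by exact: continuous_subspaceT.
by have /integrableP[] := continuous_compact_integrable cK cfK.
Qed.

(** The slice u(0) agrees with the initial datum almost everywhere only: its
    regularity is obtained in this way. *)
Lemma Hper_ae m w v : {ae mu, forall h, w h = v h} -> continuous v ->
  (forall x, v (x + 1) = v x) -> Hper m w -> Hper m v.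
Proof.
move=> wv cv pv [Hw _]; split; last by apply: aeW => h; exact: pv.
move=> k km; have [g dg g2] := Hw k km; exists g => //.
by apply: (weak_deriv_ae wv) => //; exact: continuous_locally_integrable.
Qed.

Lemma le_Hnorm2 w (k : nat) : (k < 3)%N ->
  \int[mu]_(h in `[0, 1]) (wderiv k w h ^+ 2) <= Hnorm 2 w ^+ 2.
Proof.
have p j : 0 <= \int[mu]_(h in `[0, 1]) (wderiv j w h ^+ 2).
  by apply: Rintegral_ge0 => x _; exact: sqr_ge0.
rewrite /Hnorm sqr_sqrtr; last by apply: sumr_ge0 => i _; exact: p.
move=> k3; rewrite (bigD1 (Ordinal k3))//= lerDl; apply: sumr_ge0 => i _; exact: p.
Qed.

Lemma energyE_curv f : Hper 2 (fun h => f h ^+ 3) ->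
  energyE f = (6^-1 * \int[mu]_(h in `[0, 1]) (wderiv 2 (fun h => f h ^+ 3) h ^+ 2))%:E.
Proof.
move=> Hf; rewrite /energyE asboolT//.
have [_ i] := Hloc_wderiv Hf.1 (leqnn 2).
rewrite -RintegralZl// /Rintegral fineK//.
by apply: integrable_fin_num => //; exact: (integrableZl _ 6^-1 (i 0 1)).
Qed.

End Initial.

Section Energies.
Context {R : realType}.
Notation mu := (@lebesgue_measure R).
Notation mu2 := (mu \x mu)%E.
Variables (T : R) (u0 : R -> R) (u ut g : R * R -> R).
Hypothesis T0 : 0 < T.
Hypothesis ws : weak_solution_with T u0 u ut g.
Hypothesis H0 : Hper 2 (fun h => u0 h ^+ 3).
Implicit Types (a b c d t h x y e s r : R).

Let w := cube u.
Let N0 := Hnorm 2 (fun h => u0 h ^+ 3).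

Let t00 : 0 \in `[0, T].
Proof. by rewrite in_itv/= lexx ltW. Qed.

Let pw t x : t \in `[0, T] -> slice w t (x + 1) = slice w t x.
Proof. by move=> tT; exact: (ws_w_periodic ws). Qed.

Let cw t : t \in `[0, T] -> continuous (slice w t).
Proof. by move=> tT; exact: (ws_w_slice ws). Qed.

Let ae0 : {ae mu, forall h, u0 h ^+ 3 = slice w 0 h}.
Proof. by apply: ae_imply (ws_initial ws) => h; rewrite /slice /w /cube => ->. Qed.

Lemma init_Hper : Hper 2 (slice w 0).
Proof.
apply: (Hper_ae ae0); [exact: cw|by move=> x; exact: pw|exact: H0].
Qed.

Lemma init_wderiv k : wderiv k (slice w 0) = wderiv k (fun h => u0 h ^+ 3).
Proof.
apply/esym/wderiv_ae; first exact: ae0.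
  by have [g0 [l _ _] _] := H0.1 0%N isT.
by apply: continuous_locally_integrable; exact: cw.
Qed.

Lemma init_curv : curv (slice w 0) (3 * N0 ^+ 2).
Proof.
have := Hper2_curv init_Hper (fun x => pw x t00).
rewrite init_wderiv => -[g0 d0 [i0 I0]]; exists g0 => //; split => //.
by apply: le_trans I0 _; rewrite ler_pM2l// le_Hnorm2.
Qed.

Lemma init_energyE : (energyE (slice u 0) <= (N0 ^+ 2)%:E)%E.
Proof.
rewrite (@energyE_curv _ (slice u 0) init_Hper) lee_fin.
have -> : wderiv 2 (fun h => slice u 0 h ^+ 3) = wderiv 2 (fun h => u0 h ^+ 3) by exact: init_wderiv.
have := le_Hnorm2 (fun h => u0 h ^+ 3) (isT : (2 < 3)%N); rewrite -/N0.
have : 0 <= \int[mu]_(h in `[0, 1]) (wderiv 2 (fun h0 => u0 h0 ^+ 3) h ^+ 2).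
  by apply: Rintegral_ge0 => x _; exact: sqr_ge0.
by set i := Rintegral _ _ _ => i0 iN; lra.
Qed.

Let iw2 : mu.-integrable `[0, 1] (EFin \o (fun h => slice w 0 h ^+ 2)).
Proof.
apply: continuous_integrable_itv; apply: continuous_subspaceT => x.
by apply: (@continuous_comp _ _ _ (slice w 0) (fun y : R => y ^+ 2)); [exact: cw|exact: exprn_continuous].
Qed.

Lemma init_L2 : \int[mu]_(h in `[0, 1]) (slice w 0 h ^+ 2) <= N0 ^+ 2.
Proof.
have l := continuous_locally_integrable (cw t00).
have d := weak_deriv0 l; have := weak_deriv_unique d (wderivP d).
rewrite init_wderiv => ae.
have [_ [mg _ _] _] := wderivP d; rewrite init_wderiv in mg.
have [mw _ _] := l.
apply: le_trans (le_Hnorm2 (fun h => u0 h ^+ 3) (isT : (0 < 3)%N)).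
rewrite le_eqVlt; apply/orP; left; apply/eqP; apply: Rintegral_ae_eq => //.
- by apply: measurable_funX; exact: measurable_funTS.
- by apply: measurable_funX; exact: measurable_funTS.
- by apply: ae_imply ae => h -> _.
Qed.

(** From u^2 <= 1 + u^6. *)
Lemma init_energyF : (energyF (slice u 0) <= (1 + N0 ^+ 2)%:E)%E.
Proof.
have cu : {within `[0, 1], continuous (fun h => slice u 0 h ^+ 2)}.
  by apply: continuous_subspaceT => x; apply: (@continuous_comp _ _ _ (slice u 0) (fun y : R => y ^+ 2)); [exact: (ws_u_slice ws t00)|exact: exprn_continuous].
have iu2 := continuous_integrable_itv cu.
have i1 : mu.-integrable `[0, 1] (EFin \o (fun=> 1 : R)).
  exact: integrable_cst_itv.
have le : \int[mu]_(h in `[0, 1]) (slice u 0 h ^+ 2) <= 1 + N0 ^+ 2.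
  apply: (@le_trans _ _ (\int[mu]_(h in `[0, 1]) (1 + slice w 0 h ^+ 2))).
    apply: le_Rintegral => //; first exact: (integrableD _ i1 iw2).
    move=> h _; rewrite /slice /w /cube.
    have [u1|u1] := leP (u (0, h)) 1.
      have : u (0, h) ^+ 2 <= 1 by rewrite expr_le1// (ws_ge0 ws).
      have : 0 <= (u (0, h) ^+ 3) ^+ 2 by exact: sqr_ge0.
      lra.
    have : u (0, h) ^+ 2 <= (u (0, h) ^+ 3) ^+ 2.
      rewrite -exprM; apply: ler_weXn2l => //; exact: ltW.
    lra.
  rewrite RintegralD// Rintegral_cst_itv// subr0 mulr1.
  by rewrite lerD2l init_L2.
rewrite /energyF.
have -> : (\int[mu]_(h in `[0%R, 1%R]) ((slice u 0 h ^+ 2)%:E) =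
    (\int[mu]_(h in `[0, 1]) (slice u 0 h ^+ 2))%:E)%E.
  by rewrite /Rintegral fineK//; apply: integrable_fin_num.
rewrite -EFinM lee_fin.
have : 0 <= \int[mu]_(h in `[0, 1]) (slice u 0 h ^+ 2).
  by apply: Rintegral_ge0 => x _; exact: sqr_ge0.
by move: le; set i := Rintegral _ _ _ => ? ?; lra.
Qed.

(** The L^2 norm bounds the minimum, and the curvature the oscillation. *)
Lemma init_sup h : slice w 0 h <= N0 + 3 * N0 ^+ 2 + 2.
Proof.
have N00 : 0 <= N0 by exact: sqrtr_ge0.
have c0 : {within `[0, 1], continuous (slice w 0)} by apply: continuous_subspaceT; exact: cw.
have [y y01 H] := EVT_min ler01 c0.
have y0 : 0 <= slice w 0 y by rewrite /slice /w /cube exprn_ge0// (ws_ge0 ws).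
have le : slice w 0 y <= N0.
  rewrite -(@ler_pXn2r _ 2)//; apply: le_trans init_L2.
  have -> : slice w 0 y ^+ 2 = \int[mu]_(h in `[0, 1]) (slice w 0 y ^+ 2).
    by rewrite Rintegral_cst_itv// subr0 mulr1.
  apply: le_Rintegral => //.
    exact: integrable_cst_itv.
  by move=> x x01; rewrite ler_pXn2r ?nnegrE ?H// /slice /w /cube exprn_ge0// (ws_ge0 ws).
have := curv_osc (cw t00) (fun x => pw x t00) init_curv h y.
lra.
Qed.

(** Otherwise the energy would be large on all of ]a, b[, and its time integral
    larger than the dissipation of F allows. *)
Lemma curv_time a b : 0 <= a -> a < b -> b <= T ->
  exists s, a < s < b /\ curv (slice w s) (3 * ((2 + N0 ^+ 2) / (b - a))).
Proof.
move=> a0 ab bT; apply: contrapT => no.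
have ba0 : 0 < b - a by rewrite subr_gt0.
pose B := (2 + N0 ^+ 2) / (b - a).
have B0 : 0 <= B by rewrite divr_ge0 ?(ltW ba0)// addr_ge0 ?sqr_ge0.
(* Outside of its domain the energy is +oo, hence large as well. *)
have big s : a < s < b -> ((6^-1 * B)%:E <= energyE (slice u s))%E.
  move=> sab; have sT : s \in `[0, T].
    by move/andP : sab => [? ?]; rewrite in_itv/=; apply/andP; split; lra.
  have [Hs|Hs] := pselect (Hper 2 (slice w s)); last first.
    by rewrite /energyE asboolF// leey.
  rewrite (@energyE_curv _ (slice u s) Hs) lee_fin ler_pM2l ?invr_gt0// leNgt.
  apply/negP => lt; apply: no; exists s; split => //.
  have [gs ds [igs Igs]] := Hper2_curv Hs (fun x => pw x sT).
  exists gs => //; split => //; apply: le_trans Igs _.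
  by rewrite ler_pM2l//; exact: ltW.
have sub : `]a, b[ `<=` `[0, T].
  by move=> t /=; rewrite !in_itv/= => /andP[? ?]; apply/andP; split; lra.
have c0 : 0 <= 6^-1 * B by rewrite mulr_ge0.
have big' t : `]a, b[%classic t -> ((6^-1 * B)%:E <= energyE (slice u t))%E.
  by rewrite /= in_itv/=; exact: big.
have := @integral_ge_cst _ _ R mu `]a, b[%classic `[0, T]%classic
  (fun t => energyE (slice u t)) _ (measurable_itv _) sub c0
  (fun t _ => energyE_ge0 (slice u t)) big'.
rewrite /= lebesgue_measure_itv/= lte_fin ab -EFinB -EFinM => I1.
have I2 : (6%:E * \int[mu]_(t in `[0%R, T]) energyE (slice u t) <= (1 + N0 ^+ 2)%:E)%E.
  apply: le_trans init_energyF; apply: le_trans (ws_dissipF ws).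
  by rewrite -[leLHS]add0e leeD2r// energyF_ge0.
have six : (0 <= 6%:E :> \bar R)%E by rewrite lee_fin.
have := le_trans (lee_wpmul2l six I1) I2.
rewrite -EFinM lee_fin.
have -> : 6 * (6^-1 * B * (b - a)) = 2 + N0 ^+ 2.
  by rewrite /B; field; rewrite gt_eqF.
lra.
Qed.

End Energies.

(** * Interpolation between two times *)

Section TimeHolder.
Context {R : realType}.
Notation mu := (@lebesgue_measure R).
Notation mu2 := (mu \x mu)%E.
Variables (T : R) (u0 : R -> R) (u ut g : R * R -> R).
Hypothesis T0 : 0 < T.
Hypothesis ws : weak_solution_with T u0 u ut g.
Implicit Types (a b c d t h x y e s r k : R).

Let w := cube u.
Let Xc : set (R * R) := `]0, T[ `*` `[0, 1].

Let pw t x : t \in `[0, T] -> slice w t (x + 1) = slice w t x.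
Proof. by move=> tT; exact: (ws_w_periodic ws). Qed.

Let cw t : t \in `[0, T] -> continuous (slice w t).
Proof. by move=> tT; exact: (ws_w_slice ws). Qed.

Let mut : measurable_fun Xc ut.
Proof.
have [mut _ _] := ws_ut_loc ws.
by apply: measurable_funS mut; [exact: measurable_strip|move=> z [? _]; split].
Qed.

Let iut2 : mu2.-integrable Xc (EFin \o (fun z => ut z ^+ 2)).
Proof.
have mXc : measurable Xc by exact: measurableX.
have fin : (mu2 Xc < +oo)%E.
  rewrite product_measure1E//= !lebesgue_measure_itv/= !lte_fin T0 ltr01.
  by rewrite -!EFinD -EFinM ltry.
by have [] := sq_integrable (m := mu2) mXc mut fin (ws_t_L2 ws).
Qed.

(** The Cauchy-Schwarz inequality for u_t over the box, in weighted form. *)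
Lemma ws_increment (D lam : R) a b c d : \int[mu2]_(z in `]0, T[ `*` `]0, 1[) (ut z ^+ 2) <= D ->
  0 < a -> a <= b -> b < T -> 0 <= c -> c <= d -> d <= 1 -> 0 < lam ->
  `|\int[mu]_(h in `[c, d]) (u (b, h) - u (a, h))| <=
    lam * D / 2 + (b - a) * (d - c) / (2 * lam).
Proof.
move=> HD a0 ab bT c0 cd d1 lam0.
have mS := @measurable_strip R T; have lut := ws_ut_loc ws.
have sub : `[a, b] `*` `[c, d] `<=` (Xc : set (R * R)).
  move=> [t h] [/=]; rewrite !in_itv/= => /andP[? ?] /andP[? ?].
  by split; rewrite /= in_itv/=; apply/andP; split; lra.
have subS : `[a, b] `*` `[c, d] `<=` (`]0, T[ `*` setT : set (R * R)).
  by move=> z /sub [? _]; split.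
have iut := box_integrable mS lut subS.
have [iW E] := box_fubini_swap iut (@cst_continuous R R 1).
have inT t : 0 < t -> t < T -> t \in `[0, T] by move=> ? ?; rewrite in_itv/= !ltW.
have aT : a < T by exact: le_lt_trans bT.
have b0 : 0 < b by exact: lt_le_trans ab.
have iu t : 0 < t -> t < T -> mu.-integrable `[c, d] (EFin \o (fun h => u (t, h))).
  move=> t0 tT; apply: continuous_integrable_itv; apply: continuous_subspaceT.
  by apply: (ws_u_slice ws); exact: inT.
have iD : mu.-integrable `[c, d] (EFin \o (fun h => u (b, h) - u (a, h))).
  exact: (integrableB _ (iu b b0 bT) (iu a a0 aT)).
have mbox : measurable (`[a, b] `*` `[c, d] : set (measurableTypeR R * measurableTypeR R)).
  exact: measurableX.
have mXc : measurable (Xc : set (measurableTypeR R * measurableTypeR R)) by exact: measurableX.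
have -> : \int[mu]_(h in `[c, d]) (u (b, h) - u (a, h)) =
    \int[mu2]_(z in `[a, b] `*` `[c, d]) ut z.
  have [_ _ ->] := rect_fubini2 (measurable_seg a b) (measurable_seg c d) iut.
  apply: Rintegral_ae_eq => //.
  - exact: (measurable_EFinP _ _).1 (measurable_int _ iD).
  - exact: (measurable_EFinP _ _).1 (measurable_int _ iW).
  - apply: ae_imply (ws_time_identity ws a0 ab bT) => h H hcd; apply: H.
    by move: hcd; rewrite /= !in_itv/= => /andP[? ?]; apply/andP; split; lra.
apply: le_trans; first by apply: le_normr_Rintegral.
have i2 : mu2.-integrable (`[a, b] `*` `[c, d]) (EFin \o (fun z => ut z ^+ 2)).
  exact: (integrableS mXc mbox sub iut2).
have fin : mu2 (`[a, b] `*` `[c, d]) = ((b - a) * (d - c))%:E.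
  rewrite [LHS]product_measure1E//= !lebesgue_measure_itv/= !lte_fin.
  have [ab'|ab'] := ltP a b; last by have -> : b = a by [apply/eqP; rewrite eq_le ab ab']; rewrite subrr mul0r mul0e.
  have [cd'|cd'] := ltP c d; last by have -> : d = c by [apply/eqP; rewrite eq_le cd cd']; rewrite subrr mulr0 mule0.
  by rewrite -!EFinD -EFinM.
have ic : mu2.-integrable (`[a, b] `*` `[c, d]) (EFin \o (fun=> (2 * lam)^-1)).
  apply/integrableP; split; first exact/measurable_EFinP.
  under eq_integral do rewrite /=.
  by rewrite integral_cst// [X in (_ * X)%E]fin -EFinM ltry.
have il : mu2.-integrable (`[a, b] `*` `[c, d]) (EFin \o (fun z => lam / 2 * ut z ^+ 2)).
  exact: (integrableZl _ (lam / 2) i2).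
apply: (@le_trans _ _ (\int[mu2]_(z in `[a, b] `*` `[c, d]) (lam / 2 * ut z ^+ 2 + (2 * lam)^-1))).
  apply: le_Rintegral => //.
  - exact: integrable_norm.
  - exact: (integrableD _ il ic).
  - by move=> z _; rewrite -(real_normK (num_real (ut z))); exact: ler_weighted_sq.
rewrite RintegralD// RintegralZl// Rintegral_cst//= fin/=.
have le : \int[mu2]_(z in `[a, b] `*` `[c, d]) (ut z ^+ 2) <= D.
  apply: le_trans HD; rewrite -cell_bnd; last exact/measurable_funX.
  apply: fine_le.
  - exact: integrable_fin_num.
  - exact: integrable_fin_num.
  - apply: ge0_subset_integral => //; first exact/measurable_EFinP/measurable_funX.
    by move=> z _; rewrite lee_fin sqr_ge0.
have l2 : 0 <= lam / 2 by rewrite divr_ge0// ltW.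
apply: lerD; first by rewrite (_ : lam * D / 2 = lam / 2 * D) ?ler_wpM2l//; ring.
by rewrite mulrC.
Qed.

(** The constant of [interpolation], where B bounds the curvature at unit scale,
    U the solution and D the integral of u_t^2.  It is affine in U^2, which is
    essential for [sup_bound]. *)
Definition interp_cst (B U D : R) := 4 * B + 2 + 3 * U ^+ 2 * (D + 1).

(** Let M be the maximum of f = w(s) - w(s'), attained at h0.  By [curv_max] with
    lam = r^5, f >= M - dl on an interval of length k = r^2 / 2 ending at h0,
    where dl is of order r.  There u(s) - u(s') >= (M - dl) / (3 U^2), while by
    [ws_increment] with lam = r^3 its integral is at most r^3 (D + 1) / 2. *)
Lemma interpolation_le (B U D r : R) s s' h : \int[mu2]_(z in `]0, T[ `*` `]0, 1[) (ut z ^+ 2) <= D ->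
  0 < U -> (forall t h, t \in `[0, T] -> u (t, h) <= U) ->
  0 < r -> r <= 1 -> 0 < s -> s < T -> 0 < s' -> s' < T -> `|s - s'| <= 2 * r ^+ 4 ->
  curv (slice w s) (B / r ^+ 4) -> curv (slice w s') (B / r ^+ 4) ->
  slice w s h - slice w s' h <= interp_cst B U D * r.
Proof.
move=> HD U0 HU r0 r1 s0 sT s'0 s'T ss' c1 c2.
have inT t : 0 < t -> t < T -> t \in `[0, T] by move=> ? ?; rewrite in_itv/= !ltW.
have sI := inT s s0 sT; have s'I := inT s' s'0 s'T.
have D0 : 0 <= D by apply: le_trans HD; apply: Rintegral_ge0 => z _; exact: sqr_ge0.
pose f := slice w s \- slice w s'.
have cf : continuous f by move=> x; apply: continuousB; exact: cw.
have pf x : f (x + 1) = f x by rewrite /f /= !pw.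
have cvf := curv_sub c1 c2.
have [h0 /andP[h00 h01] Hmax] := periodic_max cf pf.
apply: (le_trans (Hmax h)).
set M := f h0 in Hmax *.
pose k := r ^+ 2 / 2; pose lam := r ^+ 5; pose dl := (4 * B + 3 / 2) * r.
have k0 : 0 < k by rewrite divr_gt0// exprn_gt0.
have r2 : r ^+ 2 <= 1 by rewrite expr_le1// ltW.
have k1 : k <= 2^-1 by rewrite /k; lra.
have lam0 : 0 < lam by rewrite exprn_gt0.
have B0 : 0 <= B.
  have [g1 _ [_ I1]] := c1.
  have : 0 <= B / r ^+ 4 by apply: le_trans I1; apply: Rintegral_ge0 => x _; exact: sqr_ge0.
  by rewrite pmulr_lge0// invr_gt0 exprn_gt0.
have dl0 : 0 <= dl by rewrite mulr_ge0 ?(ltW r0)// addr_ge0// mulr_ge0.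
have near k' : 0 <= k' -> k' <= k -> M - dl <= f (h0 - k') /\ M - dl <= f (h0 + k').
  rewrite le_eqVlt => /predU1P[<- _|k'0 k'k].
    by rewrite subr0 addr0 -/M lerBlDr lerDl dl0.
  have k'h : k' <= 2^-1 by exact: le_trans k1.
  have := @curv_max R f _ h0 k' lam cf cvf (_ : 0 <= h0 <= 1) Hmax k'0 k'h lam0.
  rewrite h00 h01 => /(_ isT).
  have -> : lam * (2 * (B / r ^+ 4 + B / r ^+ 4)) = 4 * B * r.
    by rewrite /lam; field; rewrite gt_eqF.
  have le : 12 * k' ^+ 3 / lam <= 3 / 2 * r.
    rewrite ler_pdivrMr// /lam (_ : 3 / 2 * r * r ^+ 5 = 3 / 2 * r ^+ 6); last by ring.
    have : k' ^+ 3 <= k ^+ 3 by rewrite ler_pXn2r// nnegrE ltW.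
    have -> : k ^+ 3 = r ^+ 6 / 8 by rewrite /k; field.
    lra.
  by rewrite /dl -/M => -[? ?]; split; lra.
have [Mdl|dlM] := leP M dl.
  apply: (le_trans Mdl); rewrite /dl ler_pM2r// /interp_cst.
  have D1 : 0 <= D + 1 by rewrite addr_ge0.
  have : 0 <= 3 * U ^+ 2 * (D + 1) by rewrite mulr_ge0// mulr_ge0// sqr_ge0.
  lra.
(* The interval lies on the side of h0 where it stays inside [0, 1]. *)
have [c [cc0 [c1' J]]] : exists c, 0 <= c /\ c + k <= 1 /\
    forall x, x \in `[c, c + k] -> M - dl <= f x.
  have [hk|hk] := leP (h0 + k) 1.
    exists h0; split => //; split => // x; rewrite in_itv/= => /andP[x1 x2].
    have [_ +] := near (x - h0) ltac:(lra) ltac:(lra).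
    by rewrite (_ : h0 + (x - h0) = x)//; ring.
  exists (h0 - k); split; first by lra.
  split; first by lra.
  move=> x; rewrite in_itv/= => /andP[x1 x2].
  have [+ _] := near (h0 - x) ltac:(lra) ltac:(lra).
  by have -> : h0 - (h0 - x) = x by ring.
(* As u <= U, the factor p^2 + p q + q^2 of p - q is at most 3 U^2. *)
have lower x : x \in `[c, c + k] -> (M - dl) / (3 * U ^+ 2) <= u (s, x) - u (s', x).
  move=> xJ; have fx := J x xJ.
  have U2 : 0 < 3 * U ^+ 2 by rewrite mulr_gt0// exprn_gt0.
  rewrite ler_pdivrMr//; apply: (le_trans fx).
  have p0 : 0 <= u (s, x) by exact: (ws_ge0 ws).
  have q0 : 0 <= u (s', x) by exact: (ws_ge0 ws).
  have pU : u (s, x) <= U by exact: HU.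
  have qU : u (s', x) <= U by exact: HU.
  have fpos : 0 < f x by apply: lt_le_trans fx; rewrite subr_gt0.
  move: fpos; rewrite /f /= /slice /w /cube.
  set p := u (s, x) in p0 pU *; set q := u (s', x) in q0 qU *.
  have fac : p ^+ 3 - q ^+ 3 = (p - q) * (p ^+ 2 + p * q + q ^+ 2) by ring.
  move=> fpos; have pq : q <= p.
    by rewrite -(@ler_cube R q p)// -subr_ge0 ltW.
  rewrite fac; apply: ler_wpM2l; first by rewrite subr_ge0.
  have : p ^+ 2 <= U ^+ 2 by rewrite ler_pXn2r// nnegrE ltW.
  have : q ^+ 2 <= U ^+ 2 by rewrite ler_pXn2r// nnegrE ltW.
  have : p * q <= U ^+ 2 by rewrite expr2 ler_pM.
  lra.
have cont t : t \in `[0, T] -> {within `[c, c + k], continuous (fun x => u (t, x))}.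
  by move=> tT; apply: continuous_subspaceT; exact: (ws_u_slice ws tT).
have iu t : t \in `[0, T] -> mu.-integrable `[c, c + k] (EFin \o (fun x => u (t, x))).
  by move=> tT; exact: continuous_integrable_itv (cont t tT).
have intl : k * ((M - dl) / (3 * U ^+ 2)) <= \int[mu]_(x in `[c, c + k]) (u (s, x) - u (s', x)).
  have -> : k * ((M - dl) / (3 * U ^+ 2)) = \int[mu]_(x in `[c, c + k]) ((M - dl) / (3 * U ^+ 2)).
    rewrite Rintegral_cst_itv ?lerDl ?(ltW k0)// (_ : c + k - c = k) 1?mulrC//; ring.
  apply: le_Rintegral => //.
    exact: integrable_cst_itv.
  exact: (integrableB _ (iu s sI) (iu s' s'I)).
have ck : c <= c + k by rewrite lerDl ltW.
have incr : `|\int[mu]_(x in `[c, c + k]) (u (s, x) - u (s', x))| <= r ^+ 3 * (D + 1) / 2.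
  have r3 : 0 < r ^+ 3 by rewrite exprn_gt0.
  have fin (tau : R) : tau <= 2 * r ^+ 4 ->
      r ^+ 3 * D / 2 + tau * (c + k - c) / (2 * r ^+ 3) <= r ^+ 3 * (D + 1) / 2.
    move=> htau; have -> : c + k - c = k by ring.
    have : tau * k / (2 * r ^+ 3) <= r ^+ 3 / 2.
      rewrite ler_pdivrMr ?mulr_gt0//.
      have -> : r ^+ 3 / 2 * (2 * r ^+ 3) = 2 * r ^+ 4 * k by rewrite /k; field.
      by rewrite ler_pM2r.
    lra.
  have [le|lt] := leP s' s.
    apply: le_trans (ws_increment HD s'0 le sT cc0 ck c1' r3) _; apply: fin.
    by rewrite -[leLHS]ger0_norm// subr_ge0.
  have -> : \int[mu]_(x in `[c, c + k]) (u (s, x) - u (s', x)) =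
      - \int[mu]_(x in `[c, c + k]) (u (s', x) - u (s, x)).
    rewrite !RintegralB ?opprB//; exact: iu.
  rewrite normrN; apply: le_trans (ws_increment HD s0 (ltW lt) s'T cc0 ck c1' r3) _; apply: fin.
  by rewrite -[leLHS]ger0_norm ?subr_ge0 ?(ltW lt)// distrC.
have := le_trans intl (le_trans (ler_norm _) incr).
have U2 : 0 < 3 * U ^+ 2 by rewrite mulr_gt0// exprn_gt0.
rewrite mulrA ler_pdivrMr// => H.
have : (M - dl) <= 3 * U ^+ 2 * (D + 1) * r.
  rewrite -(ler_pM2l k0); apply: (le_trans H).
  rewrite le_eqVlt; apply/orP; left; apply/eqP; by rewrite /k; field.
rewrite /dl /interp_cst; set q := 3 * U ^+ 2 * (D + 1) => Hq; lra.
Qed.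

Lemma interpolation (B U D r : R) s s' h : \int[mu2]_(z in `]0, T[ `*` `]0, 1[) (ut z ^+ 2) <= D ->
  0 < U -> (forall t h, t \in `[0, T] -> u (t, h) <= U) ->
  0 < r -> r <= 1 -> 0 < s -> s < T -> 0 < s' -> s' < T -> `|s - s'| <= 2 * r ^+ 4 ->
  curv (slice w s) (B / r ^+ 4) -> curv (slice w s') (B / r ^+ 4) ->
  `|w (s, h) - w (s', h)| <= interp_cst B U D * r.
Proof.
move=> HD U0 HU r0 r1 s0 sT s'0 s'T ss' c1 c2; rewrite ler_norml.
have := interpolation_le h HD U0 HU r0 r1 s0 sT s'0 s'T ss' c1 c2.
have ss2 : `|s' - s| <= 2 * r ^+ 4 by rewrite distrC.
have := interpolation_le h HD U0 HU r0 r1 s'0 s'T s0 sT ss2 c2 c1.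
by rewrite /slice => ? ?; apply/andP; split; lra.
Qed.

End TimeHolder.

(** * Hoelder continuity in time *)

Section TimeChain.
Context {R : realType}.
Notation mu := (@lebesgue_measure R).
Notation mu2 := (mu \x mu)%E.
Variables (T : R) (u0 : R -> R) (u ut g : R * R -> R).
Hypothesis T0 : 0 < T.
Hypothesis ws : weak_solution_with T u0 u ut g.
Hypothesis H0 : Hper 2 (fun h => u0 h ^+ 3).
Implicit Types (a b c d t h x y e s r k : R).

Let w := cube u.
Let N0 := Hnorm 2 (fun h => u0 h ^+ 3).
Let B := 6 * (2 + N0 ^+ 2).

Lemma curvW f a b : a <= b -> curv f a -> curv f b.
Proof. by move=> ab [q dq [iq Iq]]; exists q => //; split => //; exact: le_trans ab. Qed.

(** The curvature bound is that of [curv_time] for an interval of length r^4 / 2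
    with t at one end. *)
Definition good_near t r s :=
  [/\ 0 < s, s < T, `|s - t| <= r ^+ 4 / 2 & curv (slice w s) (B / r ^+ 4)].

Lemma good_exists t r : t \in `[0, T] -> 0 < r -> r ^+ 4 <= T -> exists s, good_near t r s.
Proof.
rewrite in_itv/= => /andP[t0 tT] r0 rT.
have r4 : 0 < r ^+ 4 by rewrite exprn_gt0.
have rewr a b : b - a = r ^+ 4 / 2 -> 3 * ((2 + N0 ^+ 2) / (b - a)) = B / r ^+ 4.
  by move=> ->; rewrite /B; field; rewrite gt_eqF.
(* The interval lies after t if there is room before T. *)
have [le|lt] := leP (t + r ^+ 4 / 2) T.
  have lt : t < t + r ^+ 4 / 2 by rewrite ltrDl divr_gt0.
  have [s [/andP[s1 s2] cs]] := curv_time T0 ws H0 t0 lt le.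
  exists s; split; [lra|lra|by rewrite ler_norml; apply/andP; split; lra|].
  by rewrite rewr in cs => //; ring.
have ge : 0 <= t - r ^+ 4 / 2 by lra.
have lt' : t - r ^+ 4 / 2 < t by rewrite gtrBl divr_gt0.
have [s [/andP[s1 s2] cs]] := curv_time T0 ws H0 ge lt' tT.
exists s; split; [lra|lra|by rewrite ler_norml; apply/andP; split; lra|].
by rewrite rewr in cs => //; ring.
Qed.

Variables (U : R).
Hypothesis U0 : 0 < U.
Hypothesis HU : forall t h, t \in `[0, T] -> u (t, h) <= U.

Let K := interp_cst (16 * B) U (N0 ^+ 2).

Let HD : \int[mu2]_(z in `]0, T[ `*` `]0, 1[) (ut z ^+ 2) <= N0 ^+ 2.
Proof. exact: (ws_dissipation T0 ws (init_energyE T0 ws H0)). Qed.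

Let B0 : 0 <= B.
Proof. by rewrite mulr_ge0// addr_ge0// sqr_ge0. Qed.

Lemma interp_cst_ge0 : 0 <= K.
Proof.
rewrite /K /interp_cst addr_ge0//; first by rewrite addr_ge0// mulr_ge0// mulr_ge0.
by rewrite mulr_ge0// ?addr_ge0 ?sqr_ge0// mulr_ge0// sqr_ge0.
Qed.

Lemma good_close t1 t2 r s1 s2 h : 0 < r -> r <= 1 -> good_near t1 r s1 -> good_near t2 r s2 ->
  `|t1 - t2| <= r ^+ 4 -> `|w (s1, h) - w (s2, h)| <= K * r.
Proof.
move=> r0 r1 [s10 s1T st1 c1] [s20 s2T st2 c2] tt.
have r4 : 0 < r ^+ 4 by rewrite exprn_gt0.
have BB : B / r ^+ 4 <= 16 * B / r ^+ 4.
  by rewrite ler_pM2r ?invr_gt0//; move: B0; lra.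
apply: (interpolation T0 ws h HD U0 HU) => //; [|exact: curvW c1|exact: curvW c2].
move: st1 st2 tt; rewrite !ler_norml => /andP[? ?] /andP[? ?] /andP[? ?].
by apply/andP; split; lra.
Qed.

(** Halving r costs a factor 16 in the curvature bound, whence the constant
    16 B in K. *)
Lemma good_refine t r s s' h : 0 < r -> r <= 1 -> good_near t r s -> good_near t (r / 2) s' ->
  `|w (s, h) - w (s', h)| <= K * r.
Proof.
move=> r0 r1 [s10 s1T st1 c1] [s20 s2T st2 c2].
have r4 : 0 < r ^+ 4 by rewrite exprn_gt0.
have E : (r / 2) ^+ 4 = r ^+ 4 / 16 by field.
have BB : B / r ^+ 4 <= 16 * B / r ^+ 4.
  by rewrite ler_pM2r ?invr_gt0//; move: B0; lra.
have E' : B / (r / 2) ^+ 4 = 16 * B / r ^+ 4.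
  by rewrite E; field; rewrite gt_eqF.
rewrite E' in c2.
apply: (interpolation T0 ws h HD U0 HU) => //; [|exact: curvW c1].
move: st1 st2; rewrite E !ler_norml => /andP[? ?] /andP[? ?].
by apply/andP; split; lra.
Qed.

(** The increments K r, K r / 2, K r / 4, ... form a geometric series. *)
Lemma good_chain t r s h n : t \in `[0, T] -> 0 < r -> r <= 1 -> r ^+ 4 <= T -> good_near t r s ->
  exists s', good_near t (r / 2 ^+ n) s' /\
    `|w (s, h) - w (s', h)| <= 2 * K * (r - r / 2 ^+ n).
Proof.
move=> tT r0 r1 rT gs; elim: n => [|n [s' [gs' ds']]].
  by exists s; rewrite expr0 divr1; split => //; rewrite !subrr normr0 mulr0.
pose q := r / 2 ^+ n.
have p2 : 1 <= 2 ^+ n :> R by rewrite exprn_ege1// ler1n.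
have p0 : 0 < 2 ^+ n :> R by exact: lt_le_trans p2.
have q0 : 0 < q by rewrite divr_gt0.
have qr : q <= r by rewrite ler_pdivrMr// ler_peMr// ltW.
have q1 : q <= 1 by exact: le_trans r1.
have E : r / 2 ^+ n.+1 = q / 2 by rewrite /q exprS; field; rewrite gt_eqF.
have q2T : (q / 2) ^+ 4 <= T.
  have q20 : 0 <= q / 2 by lra.
  by apply: le_trans rT; rewrite ler_pXn2r// ?nnegrE ?(ltW r0)//; lra.
have [s2 gs2] := good_exists tT (divr_gt0 q0 (ltr0n _ 2)) q2T.
exists s2; rewrite E; split => //.
have d2 := good_refine h q0 q1 gs' gs2.
apply: le_trans (ler_distD (w (s', h)) _ _) _.
move: ds' d2; rewrite -/q => ds' d2.
have -> : 2 * K * (r - q / 2) = 2 * K * (r - q) + K * q by field.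
exact: lerD.
Qed.

(** Good times at the scales r / 2^n converge to t, where w is continuous. *)
Lemma good_limit t r s h : t \in `[0, T] -> 0 < r -> r <= 1 -> r ^+ 4 <= T -> good_near t r s ->
  `|w (s, h) - w (t, h)| <= 2 * K * r.
Proof.
move=> tT r0 r1 rT gs; apply/ler_addgt0Pr => e e0.
have [d d0 Hd] := strip_unif (ws_continuous ws) (ws_w_periodic ws) e0.
have [n _ Hn] := near_infty_natSinv_lt (PosNum d0).
have /= {}Hn := Hn n (leqnn n).
have [s' [[s'0 s'T st' _] ds']] := good_chain h n tT r0 r1 rT gs.
pose q := r / 2 ^+ n.
have p2 : n.+1%:R <= 2 ^+ n :> R by rewrite -natrX ler_nat ltn_expl.
have p0 : 0 < 2 ^+ n :> R by rewrite exprn_gt0.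
have q0 : 0 < q by rewrite divr_gt0.
have qn : q <= n.+1%:R^-1.
  apply: (@le_trans _ _ (1 / 2 ^+ n)); first by rewrite ler_pM2r ?invr_gt0.
  by rewrite div1r lef_pV2 ?posrE// ltr0n.
have q1 : q <= 1 by apply: le_trans qn _; rewrite invf_le1 ?ler1n ?ltr0n.
have q4 : q ^+ 4 <= q.
  by rewrite -[leRHS]expr1; apply: ler_wiXn2l => //; exact: ltW.
have st : `|s' - t| < d.
  apply: le_lt_trans _ (le_lt_trans qn Hn); apply: le_trans q4; apply: (le_trans st').
  by rewrite -/q ler_pdivrMr// ler_peMr ?exprn_ge0 ?ler1n// ltW.
have s'I : s' \in `[0, T] by rewrite in_itv/= !ltW.
have := Hd s' t h s'I tT st.
have K0 := interp_cst_ge0.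
have : 2 * K * (r - q) <= 2 * K * r.
  by apply: ler_wpM2l; [exact: mulr_ge0|rewrite gerBl ltW].
move: ds'; rewrite -/q => ? ? ?.
by apply: le_trans (ler_distD (w (s', h)) _ _) _; lra.
Qed.

(** From t1 to t2 through a good time near each of them. *)
Lemma time_holder t1 t2 r h : t1 \in `[0, T] -> t2 \in `[0, T] -> 0 < r -> r <= 1 ->
  `|t1 - t2| = r ^+ 4 -> `|w (t1, h) - w (t2, h)| <= 5 * K * r.
Proof.
move=> t1T t2T r0 r1 tr.
have rT : r ^+ 4 <= T.
  rewrite -tr; move: t1T t2T; rewrite !in_itv/= => /andP[? ?] /andP[? ?].
  by rewrite ler_norml; apply/andP; split; lra.
have [s1 g1] := good_exists t1T r0 rT.
have [s2 g2] := good_exists t2T r0 rT.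
have tr' : `|t1 - t2| <= r ^+ 4 by rewrite tr.
have := good_close h r0 r1 g1 g2 tr'.
have := good_limit h t1T r0 r1 rT g1.
have := good_limit h t2T r0 r1 rT g2.
rewrite !ler_norml => /andP[? ?] /andP[? ?] /andP[? ?].
by apply/andP; split; lra.
Qed.

End TimeChain.

(** * Folding integrals on the circle *)

Section Folding.
Context {R : realType}.
Notation mu := (@lebesgue_measure R).
Implicit Types (a b c x y : R) (f P : R -> R).

Lemma iterDB k f P : smooth f -> smooth P ->
  iterD (nseq k (1 : R)) (fun x => f x - P x) =
  (fun x => iterD (nseq k (1 : R)) f x - iterD (nseq k (1 : R)) P x).
Proof.
move=> sf sP; elim: k => [//|k IH].
transitivity ('D_1 (iterD (nseq k (1 : R)) (fun x => f x - P x))); first by [].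
rewrite IH; apply/funext => x; apply: deriveB.
  exact/diff_derivable/smooth_diff/smooth_iterD.
exact/diff_derivable/smooth_diff/smooth_iterD.
Qed.

Lemma iterD_step_supp k x : x \notin `[0, 1] -> iterD (nseq k.+1 (1 : R)) step x = 0.
Proof.
move: x; elim: k => [|k IH] x.
  exact: (cutoff_derive_supp cutoff_step).
by move=> xn; apply: (derive_supp IH).
Qed.

(** The integer translates of this bump form a partition of unity. *)
Definition unitbump x : R := step x - step (1 * x - 1).

Lemma smooth_unitbump : smooth unitbump.
Proof.
apply: smoothB; first exact: smooth_step.
exact: (smooth_shift (-1) (@smooth_step R)).
Qed.

Lemma unitbump_supp x : x \notin `[0, 2] -> unitbump x = 0.
Proof.
rewrite in_itv/= negb_and -!ltNge /unitbump => /orP[x0|x2].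
  by rewrite !step_le0 ?subrr//; lra.
by rewrite !step_ge1 ?subrr//; lra.
Qed.

Variable f : R -> R.
Hypothesis pf : forall x, f (x + 1) = f x.

Let shift12 (P : R -> R) : mu.-integrable `[1, 2] (EFin \o (fun x => f x * P x)) ->
  \int[mu]_(x in `[1, 2]) (f x * P x) = \int[mu]_(x in `[0, 1]) (f x * P (x + 1)).
Proof.
move=> iP; rewrite -(Rintegral_shift_itv 1 iP) subrr (_ : 2 - 1 = 1 :> R); last by ring.
by apply: eq_Rintegral => x _; rewrite pf.
Qed.

Lemma fold_unitbump : mu.-integrable `[0, 2] (EFin \o f) ->
  \int[mu]_(x in `[0, 2]) (f x * unitbump x) = \int[mu]_(x in `[0, 1]) f x.
Proof.
move=> iF.
have cU a b : {within `[a, b], continuous unitbump} by exact/smooth_within/smooth_unitbump.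
have cS a b : {within `[a, b], continuous step} by exact/smooth_within/smooth_step.
have iFU := integrableM_cont iF (cU 0 2).
have s1 : `[0, 1] `<=` (`[0, 2] : set R) by move=> x /=; rewrite !in_itv/= => /andP[? ?]; apply/andP; split; lra.
have s2 : `[1, 2] `<=` (`[0, 2] : set R) by move=> x /=; rewrite !in_itv/= => /andP[? ?]; apply/andP; split; lra.
have i1 : mu.-integrable `[0, 1] (EFin \o f) by exact: integrableS iF.
have i2 : mu.-integrable `[1, 2] (EFin \o f) by exact: integrableS iF.
rewrite (@Rintegral_itv_split _ _ 0 1 2)//; last by rewrite ler1n.
rewrite shift12; last exact: (integrableM_cont i2 (cU 1 2)).
have iS := integrableM_cont i1 (cS 0 1).
transitivity (\int[mu]_(x in `[0, 1]) (f x * step x) + \int[mu]_(x in `[0, 1]) (f x - f x * step x)).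
  congr (_ + _); apply: eq_Rintegral => x; rewrite inE/= in_itv/= /unitbump => /andP[x0 x1].
    by rewrite (@step_le0 _ (1 * x - 1)) ?subr0//; lra.
  rewrite (@step_ge1 _ (x + 1)); last by lra.
  by rewrite (_ : 1 * (x + 1) - 1 = x); ring.
by rewrite RintegralB// addrC subrK.
Qed.

(** The integer translates of the bump sum up to 1, so that those of its
    derivatives sum up to 0. *)
Lemma fold_unitbump_derive k : continuous f ->
  \int[mu]_(x in `[0, 2]) (f x * iterD (nseq k.+1 (1 : R)) unitbump x) = 0.
Proof.
move=> cf; pose P := iterD (nseq k.+1 (1 : R)) step.
have sP : smooth P by apply: smooth_iterD; exact: smooth_step.
have P0 x : x \notin `[0, 1] -> P x = 0 by exact: iterD_step_supp.
have E : iterD (nseq k.+1 (1 : R)) unitbump = (fun x => P x - P (1 * x - 1)).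
  rewrite [LHS](iterDB _ (@smooth_step R) (smooth_shift (-1) (@smooth_step R))).
  by rewrite [X in (fun x => _ - X x)](iterD_shift _ (-1) (@smooth_step R)).
rewrite E; clear E.
have cP : continuous P := smooth_continuous sP.
have cP' : continuous (fun x => P (1 * x - 1)) := smooth_continuous (smooth_shift (-1) sP).
have i (Q : R -> R) a b : continuous Q -> mu.-integrable `[a, b] (EFin \o (fun x => f x * Q x)).
  by move=> cQ; apply: integrableM_cont; [apply: continuous_integrable_itv|]; exact: continuous_subspaceT.
transitivity (\int[mu]_(x in `[0, 2]) (f x * P x) - \int[mu]_(x in `[0, 2]) (f x * P (1 * x - 1))).
  rewrite -RintegralB//; [|exact: i|exact: i].
  by apply: eq_Rintegral => x _; rewrite mulrBr.
have -> : \int[mu]_(x in `[0, 2]) (f x * P x) = \int[mu]_(x in `[0, 1]) (f x * P x).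
  apply: Rintegral_supp_itv => [x /=|x xn]; last by rewrite P0 ?mulr0.
  by rewrite !in_itv/= => /andP[? ?]; apply/andP; split; lra.
have -> : \int[mu]_(x in `[0, 2]) (f x * P (1 * x - 1)) = \int[mu]_(x in `[1, 2]) (f x * P (1 * x - 1)).
  apply: Rintegral_supp_itv => [x /=|x xn].
    by rewrite !in_itv/= => /andP[? ?]; apply/andP; split; lra.
  rewrite P0 ?mulr0//; apply: contra xn; rewrite !in_itv/= => /andP[? ?].
  by apply/andP; split; lra.
rewrite shift12; last exact: i.
apply/eqP; rewrite subr_eq0; apply/eqP; apply: eq_Rintegral => x _.
by rewrite (_ : 1 * (x + 1) - 1 = x)//; ring.
Qed.

End Folding.

(** * Conservation of the integral of 1/u where u is at least 1 *)

Section InverseIncrement.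
Context {R : realType}.
Notation mu := (@lebesgue_measure R).
Implicit Types (a b x y e t : R) (f v q : R -> R).

Lemma inv_close x y : 1 <= x -> 1 <= y -> `|x^-1 - y^-1| <= `|x - y|.
Proof.
move=> x1 y1; have x0 : 0 < x by exact: lt_le_trans x1.
have y0 : 0 < y by exact: lt_le_trans y1.
have -> : x^-1 - y^-1 = (y - x) / (x * y) by field; rewrite !gt_eqF.
rewrite normrM distrC normfV [`|x * y|]gtr0_norm ?mulr_gt0//.
by rewrite ler_piMr// invf_le1 ?mulr_gt0// mulr_ege1.
Qed.

(** The function 1/y for y >= 1, extended so as to be continuous and bounded: its
    composite with u is then measurable and bounded. *)
Definition trunc_inv y : R := (Num.max 1 y)^-1.

Lemma trunc_invE y : 1 <= y -> trunc_inv y = y^-1.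
Proof. by move=> y1; rewrite /trunc_inv max_r. Qed.

Lemma max1_gt0 y : 0 < Num.max 1 y.
Proof. by rewrite lt_max ltr01. Qed.

Lemma continuous_trunc_inv : continuous trunc_inv.
Proof.
move=> y; apply: cvgV; first by rewrite gt_eqF// max1_gt0.
by apply: continuous_max; [exact: cvg_cst|exact: cvg_id].
Qed.

Lemma trunc_inv_bound y : 0 <= trunc_inv y <= 1.
Proof.
rewrite /trunc_inv invr_ge0 (ltW (max1_gt0 y))/=.
by rewrite invf_le1 ?max1_gt0// le_max lexx.
Qed.

Lemma Rintegral_ae_le a b f q : mu.-integrable `[a, b] (EFin \o f) ->
  mu.-integrable `[a, b] (EFin \o q) -> {ae mu, forall x, x \in `[a, b] -> f x <= q x} ->
  \int[mu]_(x in `[a, b]) f x <= \int[mu]_(x in `[a, b]) q x.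
Proof.
move=> intf intq fq; rewrite -subr_ge0 -RintegralB//.
have iB : mu.-integrable `[a, b] (EFin \o (fun x => q x - f x)) by exact: (integrableB _ intq intf).
have -> : \int[mu]_(x in `[a, b]) (q x - f x) = \int[mu]_(x in `[a, b]) `|q x - f x|; last first.
  by apply: Rintegral_ge0.
apply: Rintegral_ae_eq => //.
- exact: (measurable_EFinP _ _).1 (measurable_int _ iB).
- have iN : mu.-integrable `[a, b] (EFin \o (fun x => `|q x - f x|)) by exact: integrable_norm.
  exact: (measurable_EFinP _ _).1 (measurable_int _ iN).
- by apply: ae_imply fq => x H Dx; rewrite ger0_norm// subr_ge0 H.
Qed.

(** The chain rule for 1/q, with error: as q b - q a is the integral of v, the
    left-hand side is the integral of v (1/q^2 - 1/(q a * q b)), where the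
    second factor is at most 3 e. *)
Lemma inv_increment v q a b e : a <= b -> mu.-integrable `[a, b] (EFin \o v) ->
  mu.-integrable `[a, b] (EFin \o (fun t => v t * trunc_inv (q t) ^+ 2)) ->
  (forall t, t \in `[a, b] -> 1 <= q t /\ `|q t - q a| <= e) ->
  q b - q a = \int[mu]_(t in `[a, b]) v t ->
  `|(q b)^-1 - (q a)^-1 + \int[mu]_(t in `[a, b]) (v t * trunc_inv (q t) ^+ 2)| <=
    3 * e * \int[mu]_(t in `[a, b]) `|v t|.
Proof.
move=> ab iv ivq H E.
have aI : a \in `[a, b] by rewrite in_itv/= lexx.
have bI : b \in `[a, b] by rewrite in_itv/= lexx ab.
have [qa1 _] := H a aI; have [qb1 qba] := H b bI.
have qa0 : 0 < q a by exact: lt_le_trans qa1.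
have qb0 : 0 < q b by exact: lt_le_trans qb1.
set c := (q a * q b)^-1.
have ivc : mu.-integrable `[a, b] (EFin \o (fun t => v t * c)).
  by apply: integrableM_cont => //; apply: continuous_subspaceT => x; exact: cvg_cst.
have -> : (q b)^-1 - (q a)^-1 = - \int[mu]_(t in `[a, b]) (v t * c).
  rewrite RintegralZr// -E /c; field.
  by rewrite !gt_eqF.
rewrite addrC -RintegralB//.
have iB : mu.-integrable `[a, b] (EFin \o (fun t => v t * trunc_inv (q t) ^+ 2 - v t * c)).
  exact: (integrableB _ ivq ivc).
have iV : mu.-integrable `[a, b] (EFin \o (fun t => `|v t|)) by exact: integrable_norm.
apply: le_trans; first by apply: le_normr_Rintegral.
rewrite -RintegralZl//; apply: le_Rintegral => //.
- exact: integrable_norm.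
- exact: (integrableZl _ (3 * e) iV).
move=> t tab; rewrite -mulrBr normrM mulrC ler_wpM2r//.
have [q1 qe] := H t tab.
have q0 : 0 < q t by exact: lt_le_trans q1.
rewrite trunc_invE//.
have -> : (q t)^-1 ^+ 2 - c = (q t)^-1 * ((q t)^-1 - (q a)^-1) + (q a)^-1 * ((q t)^-1 - (q b)^-1).
  by rewrite /c; field; rewrite !gt_eqF.
have inv1 x : 1 <= x -> 0 <= x^-1 /\ x^-1 <= 1.
  by move=> x1; have x0 : 0 < x := lt_le_trans ltr01 x1; rewrite invr_ge0 ltW// invf_le1.
have [p1 p2] := inv1 _ q1; have [p3 p4] := inv1 _ qa1.
have n1 := inv_close q1 qa1; have n2 := inv_close q1 qb1.
apply: le_trans (ler_normD _ _) _; rewrite !normrM (ger0_norm p1) (ger0_norm p3).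
have m1 : (q t)^-1 * `|(q t)^-1 - (q a)^-1| <= e.
  by apply: le_trans qe; apply: le_trans n1; rewrite ler_piMl.
have m2 : (q a)^-1 * `|(q t)^-1 - (q b)^-1| <= e + e.
  apply: (@le_trans _ _ `|(q t)^-1 - (q b)^-1|); first by rewrite ler_piMl.
  apply: (le_trans n2); apply: (le_trans (ler_distD (q a) _ _)).
  by apply: lerD => //; rewrite distrC.
lra.
Qed.

End InverseIncrement.

Section Conservation.
Context {R : realType}.
Notation mu := (@lebesgue_measure R).
Notation mu2 := (mu \x mu)%E.
Variables (T : R) (u0 : R -> R) (u ut g : R * R -> R).
Hypothesis T0 : 0 < T.
Hypothesis ws : weak_solution_with T u0 u ut g.
Implicit Types (a b c d t h x y e s r k : R).

Let w := cube u.

Let inT t : 0 < t -> t < T -> t \in `[0, T].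
Proof. by move=> ? ?; rewrite in_itv/= !ltW. Qed.

Section Window.
Variables (al be : R).
Hypothesis al0 : 0 < al.
Hypothesis beT : be < T.
Hypothesis u1 : forall t h, t \in `[al, be] -> 1 <= u (t, h).

Let win t : t \in `[al, be] -> 0 < t < T.
Proof.
by rewrite in_itv/= => /andP[at_ tb]; rewrite (lt_le_trans al0 at_) (le_lt_trans tb beT).
Qed.

Let subP c d : `[al, be] `*` `[c, d] `<=` PTper T u.
Proof.
move=> [t h] [/= tab _]; split; first exact: win.
by rewrite gt_eqF// (lt_le_trans ltr01 (u1 h tab)).
Qed.

Let mP := measurable_PTper ws.

Let lw : locally_integrable2 (PTper T u) w.
Proof. by have [] := ws_hhhh ws. Qed.

Let lg : locally_integrable2 (PTper T u) g.
Proof. by have [] := ws_hhhh ws. Qed.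

(** Where u > 0, (u^3)_hhhh is a derivative on the circle.  Testing with
    p(t) unitbump(h) gives its mean over a period on one side, and on the other
    the integral of u^3 against the fourth derivative of the bump, which folds
    to 0. *)
Lemma ws_mean_hhhh : {ae mu, forall t, t \in `[al, be] -> \int[mu]_(h in `[0, 1]) g (t, h) = 0}.
Proof.
have ig c d : mu2.-integrable (`[al, be] `*` `[c, d]) (EFin \o g).
  exact: box_integrable mP lg (@subP c d).
have [_ iG _] := rect_fubini1 (measurable_seg al be) (measurable_seg 0 1) (ig 0 1).
have [ag2 _ _] := rect_fubini1 (measurable_seg al be) (measurable_seg 0 2) (ig 0 2).
apply: fundamental_itv => // p sp p0.
have sU := @smooth_unitbump R.
have [_ _ D] := ws_hhhh ws.
have := D _ (test_function2 sp sU (@subP 0 2) p0 (@unitbump_supp R)).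
rewrite iterD_eh_tensor// -signr_odd expr0 mul1r.
set D4 := iterD _ unitbump.
have sD4 : smooth D4 by exact: smooth_iterD.
have red (f : R * R -> R) (q : R -> R) : locally_integrable2 (PTper T u) f -> continuous q ->
    (forall x, x \notin `[0, 2] -> q x = 0) ->
    \int[mu2]_(z in PTper T u) (f z * (p z.1 * q z.2)) =
    \int[mu]_(t in `[al, be]) ((\int[mu]_(h in `[0, 2]) (f (t, h) * q h)) * p t).
  move=> lf cq q0; transitivity (\int[mu2]_(z in `[al, be] `*` `[0, 2]) (f z * (p z.1 * q z.2))).
    apply: Rintegral_supp => [|[t h] _ nz /=]; first exact: subP.
    have [t1|/p0 ->] := boolP (t \in `[al, be]); last by rewrite mul0r mulr0.
    have [h1|/q0 ->] := boolP (h \in `[0, 2]); last by rewrite !mulr0.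
    by case: nz.
  have ibox := box_integrable mP lf (@subP 0 2).
  by have [_ ->] := box_fubini_tensor ibox (smooth_continuous sp) cq.
have D40 x : x \notin `[0, 2] -> D4 x = 0.
  move=> xn; rewrite /D4 /=; do 4! (apply: (@derive_supp _ _ 0 2) => //; move: x xn => _ _ x xn).
  exact: unitbump_supp.
have r1 := red w D4 lw (smooth_continuous sD4) D40.
have r2 := red g unitbump lg (smooth_continuous sU) (@unitbump_supp R).
(* Against the periodic w(t), the fourth derivative of the bump folds to 0. *)
have E1 : \int[mu]_(t in `[al, be]) ((\int[mu]_(h in `[0, 2]) (w (t, h) * D4 h)) * p t) = 0.
  rewrite (@eq_Rintegral _ _ _ _ _ (fun=> 0)) ?Rintegral_cst// ?mul0r// => t.
  rewrite inE/= => tab; have /andP[t0 tT] := win tab.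
  have tI := inT t0 tT.
  rewrite [X in X * _](_ : _ = 0) ?mul0r//.
  apply: (@fold_unitbump_derive R (fun h => w (t, h)) _ 3).
    by move=> x; exact: (ws_w_periodic ws).
  exact: (ws_w_slice ws).
move=> D'; have : \int[mu]_(t in `[al, be]) ((\int[mu]_(h in `[0, 2]) (g (t, h) * unitbump h)) * p t) = 0.
  by rewrite -r2 -E1 -r1 D'; ring.
move=> E2; rewrite -[RHS]E2; clear E2.
have mp : {within `[al, be], continuous p} by exact: smooth_within.
have [iGU _] := box_fubini_tensor (ig 0 2) (smooth_continuous sp) (smooth_continuous sU).
apply: Rintegral_ae_eq => //.
- exact: (measurable_EFinP _ _).1 (measurable_int _ (integrableM_cont iG mp)).
- exact: (measurable_EFinP _ _).1 (measurable_int _ (integrableM_cont iGU mp)).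
apply: ae_imply ag2 => t H tab; congr (_ * _); apply/esym/fold_unitbump; last exact: H.
by move=> x; apply: (ws_hhhh_periodic ws); rewrite /= in_itv/=; exact: win.
Qed.

Let inAB a b t : al <= a -> b <= be -> t \in `[a, b] -> t \in `[al, be].
Proof.
by move=> ala bbe; rewrite !in_itv/= => /andP[? ?]; apply/andP; split; lra.
Qed.

Let mS := @measurable_strip R T.

Let subS a b c d : al <= a -> b <= be -> `[a, b] `*` `[c, d] `<=` (`]0, T[ `*` setT : set (R * R)).
Proof.
move=> ala bbe [t h] [/= tab _]; split => //=; rewrite in_itv/=.
exact: win (inAB ala bbe tab).
Qed.

Let kap z := trunc_inv (u z) ^+ 2.

Let iut a b c d : al <= a -> b <= be -> mu2.-integrable (`[a, b] `*` `[c, d]) (EFin \o ut).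
Proof. by move=> ala bbe; exact: box_integrable mS (ws_ut_loc ws) (subS ala bbe). Qed.

Let iutk a b : al <= a -> b <= be ->
  mu2.-integrable (`[a, b] `*` `[0, 1]) (EFin \o (fun z => ut z * kap z)).
Proof.
move=> ala bbe; have mbox : measurable (`[a, b] `*` `[0, 1] : set (R * R)) by exact: measurableX.
apply: (@integrableM_bounded _ _ _ mu2 _ _ _ 1) => //; first exact: iut.
  apply: measurable_funX.
  apply: (measurableT_comp (f := @trunc_inv R)).
    by apply: continuous_measurable_fun; exact: continuous_trunc_inv.
  have [mu_ _ _] := ws_u_loc ws.
  by apply: measurable_funS mu_ => //; exact: subS.
move=> z _; have /andP[k0 k1] := trunc_inv_bound (u z).
by rewrite ger0_norm ?exprn_ge0// expr_le1.
Qed.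

(** By the equation u_t / u^2 = - (u^3)_hhhh, whose mean over a period is 0. *)
Lemma ws_flux_mean a b : al <= a -> b <= be ->
  \int[mu2]_(z in `[a, b] `*` `[0, 1]) (ut z * kap z) = 0.
Proof.
move=> ala bbe.
have sub : `[a, b] `*` `[0, 1] `<=` PTper T u.
  by move=> [t h] [/= tab h01]; apply: (@subP 0 1); split => //=; exact: inAB tab.
have ig := box_integrable mP lg sub.
have mbox : measurable (`[a, b] `*` `[0, 1] : set (R * R)) by exact: measurableX.
have mbo : measurable (`[a, b] `*` `]0, 1[ : set (R * R)) by exact: measurableX.
have subo : `[a, b] `*` `]0, 1[ `<=` (`[a, b] `*` `[0, 1] : set (R * R)).
  by move=> [t h] [/= t1 h1]; split => //=; exact: subset_itv_oo_cc h1.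
have mutk := (measurable_EFinP _ _).1 (measurable_int _ (iutk ala bbe)).
have mg := (measurable_EFinP _ _).1 (measurable_int _ ig).
transitivity (- \int[mu2]_(z in `[a, b] `*` `[0, 1]) g z); last first.
  have [_ iG ->] := rect_fubini1 (measurable_seg a b) (measurable_seg 0 1) ig.
  apply/eqP; rewrite oppr_eq0; apply/eqP.
  rewrite (@Rintegral_ae_eq _ _ _ _ _ _ (fun=> 0)) ?Rintegral_cst// ?mul0r//.
  - exact: (measurable_EFinP _ _).1 (measurable_int _ iG).
  - by apply: ae_imply ws_mean_hhhh => t H tab; apply: H; exact: inAB tab.
transitivity (\int[mu2]_(z in `[a, b] `*` `[0, 1]) (-1 * g z)); last first.
  by rewrite RintegralZl// mulN1r.
rewrite cell_bnd// cell_bnd; last exact: measurable_funM.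
apply: Rintegral_ae_eq => //.
- exact: measurable_funS mutk.
- by apply: measurable_funM => //; exact: measurable_funS mg.
have := ws_equation_ae T0 ws => -[N [mN N0 H]]; exists N; split => // z /= nH.
apply: H => /= H; apply: nH; case: z H => t h H [/= tab h01].
have tw := inAB ala bbe tab; have uz := u1 h tw.
have u0' : 0 < u (t, h) by exact: lt_le_trans uz.
have Xz : (`]0, T[ `*` `]0, 1[)%classic (t, h) by split => //=; rewrite in_itv/=; exact: win.
move: (H Xz); rewrite /patch mem_set; last first.
  by split; [exact: win|by move: h01; rewrite /= in_itv|rewrite gt_eqF].
move/eqP; rewrite addr_eq0 => /eqP ->; rewrite /kap trunc_invE//.
by field; rewrite gt_eqF.
Qed.

Let Phi t := \int[mu]_(h in `[0, 1]) (u (t, h))^-1.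
Let V t := \int[mu]_(h in `[0, 1]) `|ut (t, h)|.

Let iinv t : t \in `[al, be] -> mu.-integrable `[0, 1] (EFin \o (fun h => (u (t, h))^-1)).
Proof.
move=> tab; apply: continuous_integrable_itv; apply: continuous_subspaceT => h.
have /andP[t0 tT] := win tab.
apply: cvgV; first by rewrite gt_eqF// (lt_le_trans ltr01 (u1 h tab)).
by apply: (ws_u_slice ws); exact: inT.
Qed.

Let iabs a b : al <= a -> b <= be ->
  mu2.-integrable (`[a, b] `*` `[0, 1]) (EFin \o (fun z => `|ut z|)).
Proof. by move=> ala bbe; apply: integrable_norm; exact: iut. Qed.

Let iV a b : al <= a -> b <= be -> mu.-integrable `[a, b] (EFin \o V).
Proof.
move=> ala bbe.
by have [_ iV _] := rect_fubini1 (measurable_seg a b) (measurable_seg 0 1) (iabs ala bbe).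
Qed.

(** [inv_increment] integrated over a period, where [ws_flux_mean] removes the
    leading term. *)
Lemma ws_inv_step a b e : al <= a -> a <= b -> b <= be ->
  (forall t h, t \in `[a, b] -> `|u (t, h) - u (a, h)| <= e) ->
  `|Phi b - Phi a| <= 3 * e * \int[mu]_(t in `[a, b]) V t.
Proof.
move=> ala ab bbe He.
have aI : a \in `[al, be] by rewrite in_itv/= ala (le_trans ab bbe).
have bI : b \in `[al, be] by rewrite in_itv/= bbe (le_trans ala ab).
have a0 : 0 < a by exact: lt_le_trans ala.
have bT : b < T by exact: le_lt_trans beT.
have iutab := iut 0 1 ala bbe.
have [ae1 _ _] := rect_fubini2 (measurable_seg a b) (measurable_seg 0 1) iutab.
have [ae2 ik E2] := rect_fubini2 (measurable_seg a b) (measurable_seg 0 1) (iutk ala bbe).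
have [_ iv E3] := rect_fubini2 (measurable_seg a b) (measurable_seg 0 1) (iabs ala bbe).
have [_ _ E4] := rect_fubini1 (measurable_seg a b) (measurable_seg 0 1) (iabs ala bbe).
rewrite -/V in E4; rewrite -E4 E3.
have iD : mu.-integrable `[0, 1] (EFin \o (fun h => (u (b, h))^-1 - (u (a, h))^-1)).
  exact: (integrableB _ (iinv bI) (iinv aI)).
have -> : Phi b - Phi a = \int[mu]_(h in `[0, 1]) ((u (b, h))^-1 - (u (a, h))^-1 +
    \int[mu]_(t in `[a, b]) (ut (t, h) * kap (t, h))).
  by rewrite RintegralD// -E2 ws_flux_mean// addr0 RintegralB//; exact: iinv.
have iS : mu.-integrable `[0, 1] (EFin \o (fun h => (u (b, h))^-1 - (u (a, h))^-1 +
    \int[mu]_(t in `[a, b]) (ut (t, h) * kap (t, h)))).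
  exact: (integrableD _ iD ik).
apply: le_trans; first by apply: le_normr_Rintegral.
rewrite -RintegralZl//; apply: Rintegral_ae_le => //.
- exact: integrable_norm.
- exact: (integrableZl _ (3 * e) iv).
have ae3 := ws_time_identity ws a0 ab bT.
apply: ae_imply2 (ae_imply2 _ ae1 ae2) ae3; last by move=> h P Q; exact: (conj P Q).
move=> h [Q1 Q2] Q3 h01; apply: (@inv_increment _ (fun t => ut (t, h)) (fun t => u (t, h))) => //.
- exact: Q1.
- exact: Q2.
- by move=> t tab; split; [apply: u1; exact: inAB tab|exact: He].
- exact: Q3.
Qed.

(** The right-hand side is additive in the interval, so that the bound of
    [ws_inv_step] on short intervals adds up. *)
Lemma ws_inv_partition e d n a b : 0 < d -> 0 <= e -> al <= a -> a <= b -> b <= be ->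
  (forall t t' h, t \in `[al, be] -> t' \in `[al, be] -> `|t - t'| <= d ->
    `|u (t, h) - u (t', h)| <= e) ->
  b - a <= n%:R * d -> `|Phi b - Phi a| <= 3 * e * \int[mu]_(t in `[a, b]) V t.
Proof.
move=> d0 e0 ala + + He; elim: n b => [|n IH] b ab bbe ban.
  have -> : b = a by apply/eqP; rewrite eq_le ab -subr_le0; rewrite mul0r in ban; rewrite ban.
  rewrite subrr normr0 mulr_ge0 ?mulr_ge0//; apply: Rintegral_ge0 => t _.
  by apply: Rintegral_ge0.
have step c : al <= c -> c <= b -> b - c <= d -> `|Phi b - Phi c| <= 3 * e * \int[mu]_(t in `[c, b]) V t.
  move=> alc cb bc; apply: ws_inv_step => // t h tcb.
  apply: He; [exact: inAB tcb|by rewrite in_itv/= alc (le_trans cb)|].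
  move: tcb; rewrite in_itv/= => /andP[ct tb].
  by rewrite ger0_norm ?subr_ge0//; lra.
have [bd|db] := leP (b - a) d; first exact: step.
have am : a <= b - d by lra.
have mb : b - d <= b by lra.
have mbe : b - d <= be by lra.
have mn : b - d - a <= n%:R * d by move: ban; rewrite -natr1 mulrDl mul1r; lra.
rewrite (Rintegral_itv_split am mb); last exact: iV.
rewrite mulrDr [leRHS]addrC.
apply: (le_trans (ler_distD (Phi (b - d)) _ _)); apply: lerD; last exact: IH.
by apply: step => //; lra.
Qed.

(** On intervals short enough for u to vary by at most e, [ws_inv_partition]
    bounds the increment by a multiple of e. *)
Lemma ws_inv_conserved : al <= be -> Phi be = Phi al.
Proof.
move=> albe; set A := \int[mu]_(t in `[al, be]) V t.
have A0 : 0 <= A by apply: Rintegral_ge0 => t _; apply: Rintegral_ge0.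
apply/eqP; rewrite -subr_eq0 -normr_le0; apply/ler_addgt0Pr => e e0; rewrite add0r.
pose e' := e / (3 * (A + 1)).
have A1 : 0 < A + 1 by rewrite ltr_wpDl.
have e'0 : 0 < e' by rewrite divr_gt0// mulr_gt0.
have [d d0 Hd] := ws_u_unif ws e'0.
have d20 : 0 < d / 2 by rewrite divr_gt0.
pose n := Num.bound ((be - al) / (d / 2)).
have n1 : be - al <= n%:R * (d / 2).
  rewrite -ler_pdivrMr//; apply/ltW; apply: le_lt_trans (archi_boundP _) => //.
  by rewrite divr_ge0 ?subr_ge0// ltW.
apply: le_trans (ws_inv_partition d20 (ltW e'0) (lexx _) albe (lexx _) _ n1) _.
  move=> t t' h tI t'I tt; apply: Hd.
  - by have /andP[? ?] := win tI; exact: inT.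
  - by have /andP[? ?] := win t'I; exact: inT.
  - by apply: (le_lt_trans tt); lra.
rewrite -/A; have -> : 3 * e' * A = e * (A / (A + 1)) by rewrite /e'; field; rewrite gt_eqF.
by rewrite ler_piMr ?(ltW e0)// ler_pdivrMr// mul1r lerDl.
Qed.

(** 1/M is at most the mean of 1/u at the time al, which is that at the time be
    and at most 1/m. *)
Lemma ws_min_max_window M m : al <= be -> (forall h, u (al, h) <= M) ->
  (forall h, m <= u (be, h)) -> m <= M.
Proof.
move=> albe HM Hm; have [m1|m1] := leP m 1.
  by apply: (le_trans m1); apply: le_trans (HM 0); apply: u1; rewrite in_itv/= lexx.
have alI : al \in `[al, be] by rewrite in_itv/= lexx.
have beI : be \in `[al, be] by rewrite in_itv/= lexx albe.
have m0 : 0 < m by exact: lt_trans m1.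
have M0 : 0 < M by apply: lt_le_trans (HM 0); exact: lt_le_trans (u1 0 alI).
have cst c : \int[mu]_(h in `[0, 1]) c = c.
  by rewrite Rintegral_cst_itv// subr0 mulr1.
have icst c := @integrable_cst_itv R 0 1 c.
rewrite -(@lef_pV2 _ M m) ?posrE//.
have -> : M^-1 = \int[mu]_(h in `[0, 1]) M^-1 by rewrite cst.
have -> : m^-1 = \int[mu]_(h in `[0, 1]) m^-1 by rewrite cst.
apply: (@le_trans _ _ (Phi al)).
  apply: le_Rintegral => //; first exact: iinv.
  move=> h _; rewrite lef_pV2 ?posrE//.
  exact: lt_le_trans (u1 h alI).
rewrite -(ws_inv_conserved albe); apply: le_Rintegral => //; first exact: iinv.
move=> h _; rewrite lef_pV2 ?posrE//.
exact: lt_le_trans (u1 h beI).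
Qed.

End Window.

(** The equation holds inside ]0, T[; the closed interval is reached by uniform
    continuity. *)
Lemma ws_min_max a b M m : 0 <= a -> a <= b -> b <= T ->
  (forall t h, t \in `[a, b] -> 1 <= u (t, h)) ->
  (forall h, u (a, h) <= M) -> (forall h, m <= u (b, h)) -> m <= M.
Proof.
move=> a0; rewrite le_eqVlt => /predU1P[<- _ _ HM Hm|ab bT u1 HM Hm].
  exact: le_trans (Hm 0) (HM 0).
apply/ler_addgt0Pr => e e0.
have e20 : 0 < e / 2 by rewrite divr_gt0.
have [d d0 Hd] := ws_u_unif ws e20.
pose c := Num.min (d / 2) ((b - a) / 2).
have c0 : 0 < c by rewrite lt_min; apply/andP; split; lra.
have cd : c <= d / 2 by rewrite ge_min lexx.
have cb : c <= (b - a) / 2 by rewrite ge_min lexx orbT.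
have aT : a \in `[0, T] by rewrite in_itv/=; apply/andP; split; lra.
have bI : b \in `[0, T] by rewrite in_itv/=; apply/andP; split; lra.
have acT : a + c \in `[0, T] by rewrite in_itv/=; apply/andP; split; lra.
have bcT : b - c \in `[0, T] by rewrite in_itv/=; apply/andP; split; lra.
have : m - e / 2 <= M + e / 2.
  apply: (@ws_min_max_window (a + c) (b - c)).
  - lra.
  - lra.
  - move=> t h tI; apply: u1; move: tI; rewrite !in_itv/= => /andP[? ?].
    by apply/andP; split; lra.
  - lra.
  - move=> h; have dd : `|a + c - a| < d by rewrite ger0_norm; lra.
    have := Hd _ _ h acT aT dd; rewrite ler_norml => /andP[_].
    by move: (HM h); lra.
  - move=> h; have dd : `|b - c - b| < d by rewrite ler0_norm; lra.
    have := Hd _ _ h bcT bI dd; rewrite ler_norml => /andP[+ _].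
    by move: (Hm h); lra.
lra.
Qed.

End Conservation.

(** * The bound on u and the theorem *)

Section UniformBound.
Context {R : realType}.
Notation mu := (@lebesgue_measure R).
Variables (T : R) (u0 : R -> R) (u ut g : R * R -> R).
Hypothesis T0 : 0 < T.
Hypothesis ws : weak_solution_with T u0 u ut g.
Hypothesis H0 : Hper 2 (fun h => u0 h ^+ 3).
Implicit Types (a b c d t h x y e s r k : R).

Let w := cube u.
Let N0 := Hnorm 2 (fun h => u0 h ^+ 3).
Let B := 6 * (2 + N0 ^+ 2).
Let W0 := N0 + 3 * N0 ^+ 2 + 2.

Definition holder_cst (N U : R) : R := interp_cst (16 * (6 * (2 + N ^+ 2))) U (N ^+ 2).

Let N00 : 0 <= N0.
Proof. exact: sqrtr_ge0. Qed.

Let B0 : 0 <= B.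
Proof. by rewrite mulr_ge0// addr_ge0// sqr_ge0. Qed.

Let W00 : 0 <= W0.
Proof. by rewrite !addr_ge0// mulr_ge0// sqr_ge0. Qed.

Let t00 : 0 \in `[0, T].
Proof. by rewrite in_itv/= lexx ltW. Qed.

Let w0 t h : t \in `[0, T] -> 0 <= w (t, h).
Proof. by move=> tT; rewrite /w /cube exprn_ge0// (ws_ge0 ws). Qed.

Lemma fourth_root_pow x : 0 <= x -> (x `^ 4^-1) ^+ 4 = x.
Proof. by move=> x0; rewrite -powR_mulrn ?powR_ge0// -powRrM mulVf ?powRr1. Qed.

Lemma fourth_root_le1 x : 0 <= x -> x <= 1 -> x `^ 4^-1 <= 1.
Proof.
move=> x0 x1; rewrite -(@ler_pXn2r _ 4) ?nnegrE ?powR_ge0//.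
by rewrite fourth_root_pow// expr1n.
Qed.

Section Bounded.
Variable U : R.
Hypothesis U0 : 0 < U.
Hypothesis HU : forall t h, t \in `[0, T] -> u (t, h) <= U.

Let K := holder_cst N0 U.

Let K0 : 0 <= K.
Proof. exact: interp_cst_ge0. Qed.

Lemma time_holder_powR t1 t2 h : t1 \in `[0, T] -> t2 \in `[0, T] -> `|t1 - t2| <= 1 ->
  `|w (t1, h) - w (t2, h)| <= 5 * K * `|t1 - t2| `^ 4^-1.
Proof.
move=> t1T t2T t12; have [->|t1t2] := eqVneq t1 t2.
  by rewrite !subrr normr0 mulr_ge0 ?mulr_ge0// powR_ge0.
have d0 : 0 < `|t1 - t2| by rewrite normr_gt0 subr_eq0.
apply: (time_holder T0 ws H0 U0 HU) => //.
- by rewrite powR_gt0.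
- exact: fourth_root_le1.
- by rewrite fourth_root_pow.
Qed.

Definition osc_cst := W0 + B + 2 + 10 * K.

(** If T >= 1, a good time at the scale 1 lies near t; otherwise the initial time
    is at distance at most 1.  The oscillation is bounded at both. *)
Lemma osc_bound t h h' : t \in `[0, T] -> w (t, h) - w (t, h') <= osc_cst.
Proof.
move=> tT; have [t0 tT'] : 0 <= t /\ t <= T by move: tT; rewrite in_itv/= => /andP.
rewrite /osc_cst.
have [T1|T1] := ltP T 1.
  have near x : `|w (t, x) - w (0, x)| <= 5 * K.
    have d1 : `|t - 0| <= 1 by rewrite subr0 ger0_norm//; lra.
    apply: (le_trans (time_holder_powR x tT t00 d1)).
    by rewrite ler_piMr ?mulr_ge0// fourth_root_le1.
  have := init_sup T0 ws H0 h; rewrite -/N0 -/W0 /slice -/w => b1.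
  have := near h; have := near h'; rewrite !ler_norml => /andP[? ?] /andP[? ?].
  by have := w0 h' t00; move: B0; lra.
have r14 : (1 : R) ^+ 4 <= T by rewrite expr1n.
have [s gs] := good_exists T0 ws H0 tT ltr01 r14.
have l1 := good_limit T0 ws H0 U0 HU h tT ltr01 (lexx 1) r14 gs.
have l2 := good_limit T0 ws H0 U0 HU h' tT ltr01 (lexx 1) r14 gs.
have [s0 sT _ cs] := gs.
have sI : s \in `[0, T] by rewrite in_itv/= !ltW.
have := curv_osc (ws_w_slice ws sI) (fun x => ws_w_periodic ws x sI) cs h h'.
rewrite expr1n divr1 -/N0 -/B /slice -/w.
move: l1 l2; rewrite -/N0 -/(holder_cst N0 U) -/K -/w !ler_norml => /andP[? ?] /andP[? ?].
by move: W00 K0 B0; lra.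
Qed.

Lemma slice_max t : t \in `[0, T] -> exists h1, forall h, u (t, h) <= u (t, h1).
Proof.
move=> tT; have [h1 _ H] := periodic_max (ws_u_slice ws tT) (fun x => ws_periodic ws x tT).
by exists h1.
Qed.

(** Let al be the last time before t at which the minimum of u is at most 1 (or 0
    if there is none).  As u >= 1 from al on, [ws_min_max] bounds m by the
    maximum of u(al), which the oscillation bound controls. *)
Lemma slice_min_bound t m : t \in `[0, T] -> 1 < m -> (forall h, m <= u (t, h)) ->
  m ^+ 3 <= W0 + osc_cst + 8.
Proof.
move=> tT m1 Hm; have [t0 tT'] : 0 <= t /\ t <= T by move: tT; rewrite in_itv/= => /andP.
have m0 : 0 <= m by lra.
have O0 : 0 <= osc_cst by have := osc_bound 0 0 t00; rewrite subrr.
have cubeM s h1 : s \in `[0, T] -> m <= u (s, h1) -> m ^+ 3 <= w (s, h1).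
  by move=> sT ms; rewrite /w /cube ler_cube// (ws_ge0 ws).
pose A : set R := [set s | 0 <= s <= t /\ exists h, u (s, h) <= 1].
have [[s1 As1]|nA] := pselect (A !=set0); last first.
  have [h1 Hh1] := slice_max t00.
  have mM : m <= u (0, h1).
    apply: (ws_min_max T0 ws (lexx 0) t0 tT') => // s h; rewrite in_itv/= => st.
    rewrite leNgt; apply/negP => lt; apply: nA; exists s; split => //.
    by exists h; exact: ltW.
  apply: (le_trans (cubeM 0 h1 t00 mM)).
  have := init_sup T0 ws H0 h1; rewrite -/N0 -/W0 /slice -/w; lra.
have supA : has_sup A by split; [exists s1|exists t => s [/andP[]]].
pose al := sup A.
have al0 : 0 <= al.
  by have [/andP[s10 _] _] := As1; apply: (le_trans s10); apply: ub_le_sup; [exact: supA.2|].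
have alt : al <= t by apply: ge_sup; [exists s1|move=> s [/andP[]]].
have alT : al \in `[0, T] by rewrite in_itv/= al0 (le_trans alt).
have after s h : al < s -> s <= t -> 1 <= u (s, h).
  move=> als st; rewrite leNgt; apply/negP => lt.
  suff : s <= al by rewrite leNgt als.
  apply: ub_le_sup; first exact: supA.2.
  by split; [rewrite st andbT; lra|exists h; exact: ltW].
(* At al itself by continuity, from later times. *)
have ge1 s h : s \in `[al, t] -> 1 <= u (s, h).
  rewrite in_itv/= le_eqVlt => /andP[/predU1P[<- _|]]; last exact: after.
  have [alt'|tal] := ltP al t; last first.
    have -> : al = t by apply/eqP; rewrite eq_le alt tal.
    by apply: le_trans (Hm h); exact: ltW.
  apply/ler_addgt0Pr => e e0; have [d d0 Hd] := ws_u_unif ws e0.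
  pose c := Num.min (d / 2) (t - al).
  have c0 : 0 < c by rewrite lt_min; apply/andP; split; lra.
  have cd : c <= d / 2 by rewrite ge_min lexx.
  have ct : c <= t - al by rewrite ge_min lexx orbT.
  have acT : al + c \in `[0, T] by rewrite in_itv/=; apply/andP; split; lra.
  have dd : `|al + c - al| < d by rewrite ger0_norm; lra.
  have := Hd _ _ h acT alT dd; rewrite ler_norml => /andP[_].
  have := @after (al + c) h ltac:(lra) ltac:(lra); lra.
(* The bound is 2 instead of 1: al is only a limit of times at which the
   minimum is at most 1. *)
have [h0 uh0] : exists h0, u (al, h0) <= 2.
  have [d d0 Hd] := ws_u_unif ws (@ltr01 R).
  have [s [/andP[s0 st] [h uh]] als] := sup_adherent d0 supA.
  have sal : s <= al by apply: ub_le_sup; [exact: supA.2|split; [rewrite s0|exists h]].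
  have sT : s \in `[0, T] by rewrite in_itv/= s0 (le_trans st).
  have {}als : al - d < s := als.
  have dd : `|al - s| < d by rewrite ger0_norm; lra.
  exists h; have := Hd _ _ h alT sT dd; rewrite ler_norml => /andP[_]; lra.
have [h1 Hh1] := slice_max alT.
have mM : m <= u (al, h1) by exact: (ws_min_max T0 ws al0 alt tT' ge1).
apply: (le_trans (cubeM al h1 alT mM)).
have := osc_bound h1 h0 alT.
have : w (al, h0) <= 8.
  have -> : 8 = 2 ^+ 3 :> R by ring.
  by rewrite /w /cube ler_cube// (ws_ge0 ws).
by move: W00; lra.
Qed.

Lemma slice_bound t h : t \in `[0, T] -> u (t, h) ^+ 3 <= W0 + 2 * osc_cst + 9.
Proof.
move=> tT.
have cN : continuous (fun h => - u (t, h)).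
  by move=> x; apply: cvgN; exact: (ws_u_slice ws tT).
have pN x : - u (t, x + 1) = - u (t, x) by rewrite (ws_periodic ws).
have [h1 _ H] := periodic_max cN pN.
have Hm x : u (t, h1) <= u (t, x) by rewrite -lerN2 H.
have O0 : 0 <= osc_cst by have := osc_bound 0 0 t00; rewrite subrr.
have := osc_bound h h1 tT; rewrite /w /cube => osc.
suff : u (t, h1) ^+ 3 <= W0 + osc_cst + 9 by lra.
have [m1|m1] := leP (u (t, h1)) 1.
  have : u (t, h1) ^+ 3 <= 1 by rewrite expr_le1// (ws_ge0 ws).
  by move: W00; lra.
by have := slice_min_bound tT m1 Hm; lra.
Qed.

End Bounded.

(** This is 1 + a + b, where U^3 <= a + b U^2 is the bound of [slice_bound] once
    [interp_cst] is expanded in powers of U. *)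
Definition sup_cst (N : R) : R :=
  1 + (3 * (N + 3 * N ^+ 2 + 2) + 1282 * (6 * (2 + N ^+ 2)) + 53) + 60 * (N ^+ 2 + 1).

Lemma cubic_le a b (U : R) : 0 <= a -> 0 <= b -> U ^+ 3 <= a + b * U ^+ 2 -> U <= 1 + a + b.
Proof.
move=> a0 b0 H; rewrite leNgt; apply/negP => lt.
have U1 : 1 < U by lra.
have U2 : 1 <= U ^+ 2 by rewrite exprn_ege1// ltW.
have : (1 + a + b) * U ^+ 2 < U ^+ 3 by rewrite exprS ltr_pM2r// (lt_le_trans ltr01).
have : a <= a * U ^+ 2 by rewrite ler_peMr.
lra.
Qed.

Lemma sup_cst_gt0 : 0 < sup_cst N0.
Proof.
rewrite /sup_cst -/W0 -/B; have := sqr_ge0 N0; move: W00 B0; lra.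
Qed.

(** At a maximum of u, of value U, [slice_bound] bounds U^3 by a quadratic
    expression in U. *)
Lemma sup_bound t h : t \in `[0, T] -> u (t, h) <= sup_cst N0.
Proof.
move=> tT.
have [t1 [h1 [t1T H]]] := strip_max (ws_continuous ws) (ws_w_periodic ws) (ltW T0).
have HU s x : s \in `[0, T] -> u (s, x) <= u (t1, h1).
  by move=> sT; rewrite -ler_cube ?(ws_ge0 ws)//; exact: H.
apply: (le_trans (HU t h tT)).
set U := u (t1, h1) in HU *.
have [U0|U0] := leP U 0; first by apply: (le_trans U0); exact/ltW/sup_cst_gt0.
have := slice_bound U0 HU h1 t1T; rewrite -/U /osc_cst /holder_cst /interp_cst -/B => HB.
have N2 := sqr_ge0 N0.
rewrite /sup_cst -/W0 -/B; apply: cubic_le; [by move: W00 B0; lra|lra|].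
move: HB; rewrite -subr_ge0 => HB; rewrite -subr_ge0; apply: (le_trans HB).
rewrite le_eqVlt; apply/orP; left; apply/eqP; ring.
Qed.

End UniformBound.

Theorem proposition2p6 (R : realType) :
  exists C : R -> R,
  forall (T : R) (u0 : R -> R) (m0 : R) (u : R * R -> R),
    0 < T ->
    (forall h, 0 <= u0 h) ->
    (forall h, u0 (h + 1) = u0 h) ->
    Hper 2 (fun h => u0 h ^+ 3) ->
    (\int[lebesgue_measure]_(h in `[0%R, 1%R]) ((u0 h)%:E^-1) = m0%:E)%E ->
    weak_solution T u0 u ->
    (forall t1 t2 h : R, t1 \in `[0, T] -> t2 \in `[0, T] -> h \in `[0, 1] ->
       `|u (t1, h) ^+ 3 - u (t2, h) ^+ 3|
         <= C (Hnorm 2 (fun h => u0 h ^+ 3)) * `|t2 - t1| `^ (4^-1)) /\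
    (forall t : R, t \in `[0, T] -> holder 2^-1 (fun h => u (t, h) ^+ 3)).
Proof.
exists (fun N => 5 * holder_cst N (sup_cst N) + sup_cst N ^+ 3).
move=> T u0 m0 u T0 _ _ H0 _ [ut [g ws]]; split; last first.
  move=> t tT; apply: Hloc1_holder; first exact: (ws_w_slice ws tT).
  by have [] := ws_H1 ws tT.
move=> t1 t2 h t1T t2T _; set N := Hnorm 2 _.
have U0 := sup_cst_gt0 u0; have HU := sup_bound T0 ws H0.
rewrite -/N in U0 HU.
have K0 : 0 <= holder_cst N (sup_cst N) by exact: interp_cst_ge0.
have P0 : 0 <= `|t2 - t1| `^ 4^-1 by exact: powR_ge0.
have U3 : 0 <= sup_cst N ^+ 3 by rewrite exprn_ge0// ltW.
rewrite mulrDl; have [le1|gt1] := leP `|t2 - t1| 1.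
  rewrite distrC in le1.
  have := time_holder_powR T0 ws H0 U0 HU h t1T t2T le1; rewrite (distrC t1 t2) => /le_trans; apply.
  by rewrite lerDl mulr_ge0.
(* Times at distance more than 1: the bound on u suffices. *)
apply: (@le_trans _ _ (sup_cst N ^+ 3 * `|t2 - t1| `^ 4^-1)); last first.
  by rewrite lerDr mulr_ge0// mulr_ge0.
have P1 : 1 <= `|t2 - t1| `^ 4^-1.
  rewrite -(@ler_pXn2r _ 4) ?nnegrE ?powR_ge0//.
  by rewrite fourth_root_pow// expr1n ltW.
apply: (@le_trans _ _ (sup_cst N ^+ 3)); last by rewrite ler_peMr.
have b t : t \in `[0, T] -> 0 <= u (t, h) ^+ 3 <= sup_cst N ^+ 3.
  move=> tT; have u00 := ws_ge0 ws h tT.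
  by rewrite exprn_ge0//= ler_cube ?HU// ltW.
have /andP[? ?] := b t1 t1T; have /andP[? ?] := b t2 t2T.
by rewrite ler_norml; apply/andP; split; lra.
Qed.
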